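(* Let $\mathbf N=(N_1,\dots,N_d)$ be a stationary multivariate linear Hawkes process with baseline intensities $\eta_j>0$ and reproduction functions $(h_{ij})_{1\le i,j\le d}$, and assume that the spectral radius of the reproduction matrix $\mathbf M=(\lVert h_{ij}\rVert_{L^1})_{1\le i,j\le d}$ is strictly less than $1$. Assume further that there exists $\beta>0$ such that $$\sup_{1\le i,j\le d}\int_{\mathbb R} t^{1+\beta}h_{ij}(t)\,\mathrm dt<\infty .$$ Then, for any $0<\gamma<\beta$, as $\tau\to\infty$, $$\alpha_{\mathbf N}(\tau)=\mathcal O(\tau^{-\gamma}),$$ where $\alpha_{\mathbf N}$ is the strong mixing coefficient of $\mathbf N$.
   Context: Let $d\ge 1$, let $(\Omega,\mathcal F,\mathbb P)$ be a probability space, and let $(\mathfrak N,\mathcal N)$ be the measurable space of locally finite counting measures on $\mathbb R$ with values in $\mathbb N^d$. A multivariate point process is a measurable map $\mathbf N=(N_1,\dots,N_d):\Omega\to\mathfrak N$. Multivariate linear Hawkes process: given baseline intensities $\eta_j>0$ and reproduction functions $h_{ij}:\mathbb R^+\to\mathbb R^+$ (extended by $0$ to $\mathbb R$; $h_{ij}$ is the reproduction function from component $i$ to component $j$), it is the point process on $\mathbb R$ whose component $N_j$ has conditional intensity, with respect to the natural filtration $(\mathcal F_t)$ of $\mathbf N$, $$\lambda_j(t)=\eta_j+\sum_{i=1}^d\int_{-\infty}^t h_{ij}(t-u)\,N_i(\mathrm du)$$ (left-continuous, i.e. only points strictly before $t$ contribute), in the sense that $\mathbb P(N_j((t,t+h))=1\mid\mathcal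 F_{t^-})=\lambda_j(t)h+o(h)$, and which is orderly: distinct components never jump simultaneously and $\mathbb P(\lVert\mathbf N((t,t+h))\rVert_1\ge 2\mid\mathcal F_{t^-})=o(h)$, where $\lVert\cdot\rVert_1$ is the $\ell^1$-norm on $\mathbb R^d$. Equivalently, it is a Poisson cluster process: immigrants (generation $0$) of type $j$ arrive according to independent homogeneous Poisson processes on $\mathbb R$ with rate $\eta_j$; each individual of generation $k$ and type $i$ located at $x$ generates, independently, offspring of generation $k+1$ and type $j$ according to an inhomogeneous Poisson process with intensity $h_{ij}(\cdot-x)$; $N_j$ counts all individuals of type $j$. The spectral radius condition ensures existence and stationarity of the process. $\lVert h\rVert_{L^1}=\int_{\mathbb R}|h(x)|\,\mathrm dx$. Strong mixing coefficient: for $-\infty\le a<b\le+\infty$, $\mathcal E_a^b$ is the cylindrical $\sigma$-algebra on $\mathfrak N$ generated by the sets $\{\nu\in\mathfrak N:\nu(B)=\mathbf m\}$, $B$ a Borel subset of $(a,b]$ (of $(a,\infty)$ if $b=+\infty$), $\mathbf m\in\mathbb N^d$. Then $$\alpha_{\mathbf N}(\tau)=\sup_{t\in\mathbb R}\ \sup_{\mathcal A\in\mathcal E_{-\infty}^t,\ \mathcal B\in\mathcal E_{t+\tau}^{\infty}}\bigl|\mathrm{Cov}(\mathbb 1_{\mathcal A}(\mathbf N),\mathbb 1_{\mathcal B}(\mathbf N))\bigr|.$$ *)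

(* Defs.v *)
From HB Require Import structures.
From mathcomp Require Import all_boot all_order all_algebra.
From mathcomp Require Import complex.
From mathcomp Require Import all_classical all_reals all_analysis.
From mathcomp Require Import measurable_realfun.

Set Implicit Arguments.
Unset Strict Implicit.
Unset Printing Implicit Defensive.

Import Order.TTheory GRing.Theory Num.Theory.
Import numFieldNormedType.Exports.

Local Open Scope classical_set_scope.
Local Open Scope ring_scope.
Local Open Scope ereal_scope.

Record config (R : realType) (d : nat) := Config {
  config_measure :> 'I_d -> {measure set (measurableTypeR R) -> \bar R} ;
  config_locally_finite : forall (i : 'I_d) (B : set R),
    measurable B -> bounded_set B ->
    exists k : nat, config_measure i B = k%:R%:E }.

Section config_space.
Variables (R : realType) (d : nat).

Lemma empty_config_subproof (i : 'I_d) (B : set R) :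
  measurable B -> bounded_set B ->
  exists k : nat, (mzero : {measure set (measurableTypeR R) -> \bar R}) B
                  = k%:R%:E.
Proof. by move=> _ _; exists 0%N. Qed.

Definition empty_config : config R d := Config empty_config_subproof.

HB.instance Definition _ := gen_eqMixin (config R d).
HB.instance Definition _ := gen_choiceMixin (config R d).
HB.instance Definition _ := isPointed.Build (config R d) empty_config.

(* The counts are required to be finite here, but nu i B may be +oo when B is
   unbounded. *)
Definition count_cylinders (D : set R) : set (set (config R d)) :=
  [set A | exists (B : set R) (m : 'I_d -> nat),
     [/\ measurable B, B `<=` D &
         A = [set nu : config R d | forall i, nu i B = (m i)%:R%:E]]].

HB.instance Definition _ :=
  @isMeasurable.Build (sigma_display (count_cylinders setT)) (config R d)
    <<s count_cylinders setT >> (@sigma_algebra0 _ setT _)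
    (@sigma_algebraC _ _) (@sigma_algebra_bigcup _ setT _).

(* For b = +oo this is the sigma-algebra attached to the open half-line
   (a, +oo). *)
Definition window_algebra (a b : \bar R) : set (set (config R d)) :=
  <<s count_cylinders [set x : R | a < x%:E <= b] >>.

End config_space.
Arguments window_algebra {R d} a b.

Section point_processes.
Variables (R : realType) (d : nat) (disp : measure_display)
  (Omega : measurableType disp) (P : probability Omega R)
  (N : {mfun Omega >-> config R d}).

Definition stationary : Prop :=
  forall (s : R) (n : nat) (B : 'I_n -> set R) (m : 'I_n -> 'I_d -> nat),
    (forall k, measurable (B k)) ->
    P [set w | forall k i, N w i [set (x + s)%R | x in B k] = (m k i)%:R%:E] =
    P [set w | forall k i, N w i (B k) = (m k i)%:R%:E].

Definition strong_mixing (tau : R) : \bar R :=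
  ereal_sup (range (fun t : R =>
    ereal_sup [set `| covariance P \1_(N @^-1` A) \1_(N @^-1` B) |
              | A in window_algebra -oo t%:E
              & B in window_algebra (t + tau)%:E +oo])).

End point_processes.

Section independence_and_poisson.
Variables (R : realType) (disp : measure_display)
  (Omega : measurableType disp) (P : probability Omega R).

Definition mutually_independent (I : choiceType) (F : I -> set (set Omega)) :=
  forall (s : seq I) (E : I -> set Omega), uniq s ->
    (forall i, i \in s -> F i (E i)) ->
    P (\bigcap_(i in [set` s]) E i) = \prod_(i <- s) P (E i).

Definition sigma_sequence (X : nat -> Omega -> \bar R) : set (set Omega) :=
  <<s [set X n @^-1` B | n in [set: nat] & B in measurable] >>.

(* A random point pattern is listed as a sequence of extended reals; entries
   that are not finite stand for absent points, so that finite and infinite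
   patterns are handled alike. *)
Definition nb_points (X : nat -> Omega -> \bar R) (w : Omega) (B : set R) :
  \bar R := counting [set n | exists2 x, B x & X n w = x%:E].

Definition intensity_measure (lam : R -> R) (B : set R) : \bar R :=
  \int[lebesgue_measure]_(x in B) (lam x)%:E.

(* The library's poisson_pmf is not a mass function when the parameter is 0; this
   one is then the Dirac mass at 0. *)
Definition poisson_mass (r : R) (k : nat) : R :=
  (r ^+ k / k`!%:R * expR (- r))%R.

Definition poisson_process (lam : R -> R) (X : nat -> Omega -> \bar R) : Prop :=
  (forall n, measurable_fun setT (X n)) /\
  forall (n : nat) (B : 'I_n -> set R) (m : 'I_n -> nat),
    (forall k, measurable (B k)) -> trivIset setT B ->
    (forall k, intensity_measure lam (B k) < +oo) ->
    P [set w | forall k, nb_points X w (B k) = (m k)%:R%:E] =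
    (\prod_(k < n) poisson_mass (fine (intensity_measure lam (B k))) (m k))%:E.

End independence_and_poisson.

(* Ulam-Harris labels, youngest first: (j, n) :: u is the n-th offspring of
   type j of u.  The empty label is not an individual; it acts as a virtual
   parent, located at 0, of all the immigrants.  An individual of generation k
   has a label of size k.+1. *)
Definition label (d : nat) := seq ('I_d * nat).

Definition has_type (d : nat) (j : 'I_d) (u : label d) : bool :=
  if u is (i, _) :: _ then i == j else false.

Section hawkes.
Variables (R : realType) (d : nat).

Definition offspring_intensity (eta : 'I_d -> R) (h : 'I_d -> 'I_d -> R -> R)
    (u : label d) (j : 'I_d) : R -> R :=
  if u is (i, _) :: _ then h i j else cst (eta j).

(* xi u j n is the position, relative to u, of the n-th offspring of type j of
   u, so that an individual is absent as soon as one of its ancestors is. *)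
Fixpoint location (Omega : Type) (xi : label d -> 'I_d -> nat -> Omega -> \bar R)
    (u : label d) (w : Omega) : \bar R :=
  if u is (j, n) :: v then location xi v w + xi v j n w else 0.

(* The cluster (branching) description of the linear Hawkes process whose
   conditional intensities are
     lambda_j(t) = eta_j + sum_i int_(-oo, t) h_ij(t - u) N_i(du). *)
Definition poisson_cluster (disp : measure_display)
    (Omega : measurableType disp) (P : probability Omega R)
    (N : {mfun Omega >-> config R d})
    (eta : 'I_d -> R) (h : 'I_d -> 'I_d -> R -> R) : Prop :=
  exists xi : label d -> 'I_d -> nat -> Omega -> \bar R,
    [/\ forall u j, poisson_process P (offspring_intensity eta h u j) (xi u j),
        mutually_independent P
          (fun uj : label d * 'I_d => sigma_sequence (xi uj.1 uj.2)) &
        {ae P, forall w, forall (j : 'I_d) (B : set R), measurable B ->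
          N w j B =
          counting [set u | has_type j u /\
                            exists2 x, B x & location xi u w = x%:E]} ].

(* Being a Hawkes process is a property of the law of N: the genealogy may
   live on another probability space. *)
Definition hawkes (disp : measure_display)
    (Omega : measurableType disp) (P : probability Omega R)
    (N : {mfun Omega >-> config R d})
    (eta : 'I_d -> R) (h : 'I_d -> 'I_d -> R -> R) : Prop :=
  exists (disp' : measure_display) (Omega' : measurableType disp')
         (P' : probability Omega' R) (N' : {mfun Omega' >-> config R d}),
    poisson_cluster P' N' eta h /\
    forall A : set (config R d), measurable A ->
      P (N @^-1` A) = P' (N' @^-1` A).

Definition reproduction_matrix (h : 'I_d -> 'I_d -> R -> R) : 'M[R]_d :=
  \matrix_(i, j) (\int[lebesgue_measure]_x `|h i j x|)%R.

Definition spectral_radius (M : 'M[R]_d) : R :=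
  sup [set Normc.normc z | z in
        [set z : R[i] | eigenvalue (map_mx (real_complex R) M) z]].

End hawkes.

(* Main.v *)
(* Use the cluster representation and split the clusters at time t: the left ones have
   their immigrant at a location <= t, the right ones after t.

   Conditioning on all generations but the last and using the Laplace functional of
   Poisson processes, the Laplace functional of the whole process factorizes into those
   of its left and right parts; replacing test functions by large multiples of
   indicators, the counts of left and right individuals generate independent
   sigma-algebras.  By causality the events of (-oo, t] only depend on left clusters.
   Those of (t + tau, +oo) only depend on right clusters unless some left cluster
   survives after t + tau, so the covariance is at most three times the probability
   of survival.

   For T = t + tau, give a left individual of type i at x the cost
   v_i (1 + e (T - x)^+)^-(1 + beta).  Since (1 + e (T - x - z)^+)^-p is at most
   (1 + e (T - x)^+)^-p (1 + e z)^p, the expected cost of the children of an individual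
   is at most sum_j v_j int (1 + e z)^(1 + beta) h_ij(z) dz times its own unweighted
   cost.  For small e > 0 the latter kernel is close to the reproduction matrix, whose
   spectral radius is < 1, so that a suitable positive v makes the expected cost of a
   generation decrease geometrically.  The total expected cost, which bounds the
   probability of survival, is then comparable to that of the immigrants before t,
   i.e. to int_(-oo, t) (1 + e (T - x))^-(1 + beta) dx, which is O(tau^-gamma). *)

Require Import Defs.
From HB Require Import structures.
From mathcomp Require Import all_boot all_order all_algebra.
From mathcomp Require Import all_classical all_reals all_analysis.
From mathcomp Require Import complex polyrcf measurable_realfun finmap ring lra.

Set Implicit Arguments.
Unset Strict Implicit.
Unset Printing Implicit Defensive.

Import Order.TTheory GRing.Theory Num.Theory.
Import numFieldNormedType.Exports.

Local Open Scope classical_set_scope.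
Local Open Scope ring_scope.
(** * Laplace functionals and Poisson processes *)

(** The side of an individual is read off the random location of its immigrant, so left and right
    individuals are not functions of two disjoint families of the independent variables [xi]; their
    independence reflects the splitting of a Poisson process and has to be extracted from the law.
    This is why costs carry the side as a boolean argument: integrating out a generation turns [c]
    into [next_cost c], which never mixes the two sides, and the recursion ends with an integral
    over the positions of the immigrants, which splits at t. A generation consists of infinitely
    many litters, each independent of everything else but not of its own descendants; it is removed
    litter by litter along an enumeration, followed by a limit. Counts of unbounded sets may be
    infinite, hence extended-valued costs with [lap +oo = 0]. The vector v is (1 - M)^-1 applied to
    the all-ones vector: then M v = v - 1, and the gap 1 absorbs the passage from the reproduction
    matrix M to the stretched kernel. *)

Section laplace_exponential.
Local Open Scope ereal_scope.
Context {R : realType}.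
Implicit Types x y : \bar R.

(** exp(-x) extended by 0 at +oo, which keeps [lapD] and monotone limits valid on [0, +oo]; the
    value at -oo is junk. *)
Definition lap x : \bar R :=
  if x \is a fin_num then (expR (- fine x))%:E else 0.

Lemma lap0 : lap 0 = 1.
Proof. by rewrite /lap/= oppr0 expR0. Qed.

Lemma lap_ge0 x : 0 <= lap x.
Proof. by rewrite /lap; case: ifP => // _; rewrite lee_fin expR_ge0. Qed.

Lemma lap_le1 x : 0 <= x -> lap x <= 1.
Proof.
rewrite /lap; case: ifP => // xf x0.
by rewrite lee_fin -[leRHS]expR0 ler_expR oppr_le0 fine_ge0.
Qed.

Lemma lap_fin_num x : lap x \is a fin_num.
Proof. by rewrite /lap; case: ifP. Qed.

Lemma lapy : lap +oo = 0. Proof. by []. Qed.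

Lemma lapD x y : 0 <= x -> 0 <= y -> lap (x + y) = lap x * lap y.
Proof.
case: x => [x||]//; case: y => [y||]// x0 y0; rewrite /lap//=.
- by rewrite -EFinM -expRD opprD.
- by rewrite mule0.
- by rewrite mul0e.
- by rewrite mul0e.
Qed.

Lemma lap_sum (I : Type) (s : seq I) (P : pred I) (f : I -> \bar R) :
  (forall i, P i -> 0 <= f i) ->
  lap (\sum_(i <- s | P i) f i) = \prod_(i <- s | P i) lap (f i).
Proof.
move=> f0; elim: s => [|i s IH]; first by rewrite !big_nil lap0.
rewrite !big_cons; case: ifPn => // Pi.
by rewrite lapD ?IH ?f0// sume_ge0.
Qed.

Lemma le_lap x y : -oo < x -> x <= y -> lap y <= lap x.
Proof.
case: x => [x||]//; case: y => [y||]//= _ xy; rewrite /lap//= ?lee_fin.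
by rewrite ler_expR lerN2.
Qed.

Lemma measurable_lap : measurable_fun [set: \bar R] lap.
Proof.
apply: measurable_fun_ifT => //.
  apply: (measurable_fun_bool true) => /=.
  by have := emeasurable_fin_num measurableT (@measurable_id _ (\bar R) setT); rewrite setTI.
apply/measurable_EFinP; apply: measurableT_comp => //.
by apply: measurableT_comp => //; exact: measurable_fine.
Qed.

Lemma cvg_lap (u : nat -> \bar R) (l : \bar R) : nondecreasing_seq u ->
  (forall n, 0 <= u n) -> u @ \oo --> l -> lap (u n) @[n --> \oo] --> lap l.
Proof.
move=> ndu u0 ul.
have ule n : u n <= l.
  rewrite (cvg_unique _ ul (ereal_nondecreasing_cvgn ndu))//.
  by apply: ereal_sup_ubound; exists n.
case: l ul ule => [l||] ul ule.
- have uf n : u n \is a fin_num.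
    by rewrite ge0_fin_numE// (le_lt_trans (ule n))// ltry.
  rewrite /lap/=; under eq_fun do rewrite uf.
  apply: cvg_EFin; first by near=> n.
  apply: (@continuous_cvg _ _ _ _ _ _ expR); first exact: continuous_expR.
  by apply: cvgN; exact: fine_cvg.
- rewrite lapy.
  have -> : (fun n => lap (u n)) = EFin \o (fun n => fine (lap (u n))).
    by apply/funext => n /=; rewrite fineK// lap_fin_num.
  apply: cvg_EFin; first by near=> n.
  apply/cvgr0Pnorm_le => e e0.
  move/cvgeyPge : ul => /(_ (- ln e)%R); apply: filterS => n Aun.
  rewrite /= ger0_norm; last exact/fine_ge0/lap_ge0.
  rewrite -lee_fin fineK ?lap_fin_num//.
  by rewrite (le_trans (le_lap _ Aun)) ?ltNyr// /lap/= opprK lnK.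
- by have := le_trans (u0 0%N) (ule 0%N).
Unshelve. all: end_near.
Qed.

End laplace_exponential.
Arguments lap : simpl never.

Section integral_lap.
Local Open Scope ereal_scope.
Context d (T : measurableType d) {R : realType} (P : probability T R).

(** Dominated convergence, the integrands lying in [0, 1]. The factor [Y] carries whatever is not
    being approximated. *)
Lemma cvg_integral_lap (Y : T -> \bar R) (u : nat -> T -> \bar R)
    (l : T -> \bar R) :
  measurable_fun setT Y -> (forall w, 0 <= Y w <= 1) ->
  (forall n, measurable_fun setT (u n)) ->
  (forall n w, 0 <= u n w) ->
  (forall w, nondecreasing_seq (u ^~ w)) ->
  (forall w, u n w @[n --> \oo] --> l w) ->
  \int[P]_w (Y w * lap (u n w)) @[n --> \oo] --> \int[P]_w (Y w * lap (l w)).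
Proof.
move=> mY Y01 mu u0 ndu ul.
have Yf w : Y w \is a fin_num.
  have /andP[Y0 Y1] := Y01 w.
  by rewrite ge0_fin_numE// (le_lt_trans Y1)// ltry.
have cv w : Y w * lap (u n w) @[n --> \oo] --> Y w * lap (l w).
  apply: cvgeM; last first.
  - by apply: cvg_lap.
  - exact: cvg_cst.
  - by rewrite mule_def_fin// lap_fin_num.
have mn n : measurable_fun setT (fun w => Y w * lap (u n w)).
  by apply: emeasurable_funM => //; apply: measurableT_comp (mu n) => //; exact: measurable_lap.
have [|||||] := @dominated_convergence _ T R P setT measurableT (fun n w => Y w * lap (u n w))
  (fun w => Y w * lap (l w)) (cst 1).
- exact: mn.
- apply: (emeasurable_fun_cvg (fun n w => Y w * lap (u n w))); first exact: mn.
  by move=> w _; exact: cv.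
- by apply: aeW => w _; exact: cv.
- exact: (finite_measure_integrable_cst P 1%R).
- apply: aeW => w n _; have /andP[Y0 Y1] := Y01 w.
  rewrite gee0_abs ?mule_ge0 ?lap_ge0//.
  by rewrite (le_trans (lee_pmul _ _ Y1 (lap_le1 (u0 n w)))) ?mule1 ?lap_ge0.
- by [].
Qed.

Lemma integral_le1_fin_num (Y : T -> \bar R) : measurable_fun setT Y ->
  (forall w, 0 <= Y w <= 1) -> \int[P]_w Y w \is a fin_num.
Proof.
move=> mY Y01; have Y0 w : 0 <= Y w by have /andP[] := Y01 w.
rewrite ge0_fin_numE ?integral_ge0//.
apply: (@le_lt_trans _ _ (\int[P]_w cst 1 w)).
  by apply: ge0_le_integral => // w _; have /andP[] := Y01 w.
by rewrite integral_cst// mul1e [X in X < _]probability_setT ltry.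
Qed.

Lemma integral_lap_fin_num (u : T -> \bar R) : measurable_fun setT u ->
  (forall w, 0 <= u w) -> \int[P]_w lap (u w) \is a fin_num.
Proof.
move=> mu u0; apply: integral_le1_fin_num => [|w].
  by apply: measurableT_comp mu; exact: measurable_lap.
by rewrite lap_ge0 lap_le1.
Qed.

End integral_lap.

Section on_finite.
Local Open Scope ereal_scope.
Context {R : realType}.
Implicit Types (c : R -> \bar R) (x : \bar R).

(** A non-finite entry stands for an absent point, which bears no cost. *)
Definition on_fin c x : \bar R := if x is r%:E then c r else 0.

Lemma on_fin_ge0 c x : (forall r, 0 <= c r) -> 0 <= on_fin c x.
Proof. by case: x => //=. Qed.

Lemma on_finE c x : on_fin c x = if x \is a fin_num then c (fine x) else 0.
Proof. by case: x. Qed.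

Lemma measurable_on_fin c : measurable_fun setT c ->
  measurable_fun [set: \bar R] (on_fin c).
Proof.
move=> mc; rewrite (_ : on_fin c = fun x =>
  if x \is a fin_num then c (fine x) else 0); last exact/funext/on_finE.
apply: measurable_fun_ifT => //.
  apply: (measurable_fun_bool true) => /=.
  by have := emeasurable_fin_num measurableT (@measurable_id _ (\bar R) setT); rewrite setTI.
by apply: measurableT_comp => //; exact: measurable_fine.
Qed.

End on_finite.

(** * Sums over countable index sets as series *)

Section countable_sums.
Local Open Scope ereal_scope.
Context {R : realType} {I : countType}.
Implicit Types (S : set I) (a : I -> \bar R).

(** The index type is enumerated by its pickling; codes of no index, or of an index outside [S],
    contribute 0. Partial sums and limits of [esum] are taken along this enumeration. *)
Definition enum_term S a (n : nat) : \bar R :=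
  if pickle_inv n is Some i then if i \in S then a i else 0 else 0.

Lemma enum_term_ge0 S a n : (forall i, 0 <= a i) -> 0 <= enum_term S a n.
Proof.
by move=> a0; rewrite /enum_term; case: pickle_inv => // i; case: ifP.
Qed.

Lemma esum_enum S a : (forall i, 0 <= a i) ->
  \esum_(i in S) a i = \sum_(n <oo) enum_term S a n.
Proof.
move=> a0; rewrite esum_mkcond.
rewrite nneseries_esumT; last by move=> n; exact: enum_term_ge0.
rewrite [RHS](esumID (range (@choice.pickle I))); last by move=> n _; exact: enum_term_ge0.
rewrite [X in _ + X]esum1 ?adde0 => [|n [_ nI]]; last first.
  rewrite /enum_term; case: pickle_inv (@pickle_invK I n) => //= i ni.
  by exfalso; apply: nI; exists i.
rewrite setTI (reindex_esum setT _ (@choice.pickle I)).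
  by apply: eq_esum => i _; rewrite /enum_term pickleK_inv; case: ifP.
split; first by move=> i _; exists i.
- by move=> i j _ _; exact: (pcan_inj (@choice.pickleK I)).
- by move=> _ [i _ <-]; exists i.
Qed.

Context d (T : measurableType d).

Lemma measurable_enum_term S (a : I -> T -> \bar R) n :
  (forall i, S i -> measurable_fun setT (a i)) ->
  measurable_fun setT (fun w => enum_term S (a ^~ w) n).
Proof.
move=> ma; rewrite /enum_term; case: pickle_inv => [i|]; last exact: measurable_cst.
case: (boolP (i \in S)) => [/set_mem/ma//|_]; exact: measurable_cst.
Qed.

Lemma measurable_esum S (a : I -> T -> \bar R) :
  (forall i w, 0 <= a i w) -> (forall i, S i -> measurable_fun setT (a i)) ->
  measurable_fun setT (fun w => \esum_(i in S) a i w).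
Proof.
move=> a0 ma; under eq_fun do rewrite esum_enum//.
apply: ge0_emeasurable_sum => [n w _ _|n _]; first exact: enum_term_ge0.
exact: measurable_enum_term.
Qed.

Lemma integral_esum (mu : {measure set T -> \bar R}) S (a : I -> T -> \bar R) :
  (forall i w, 0 <= a i w) -> (forall i, S i -> measurable_fun setT (a i)) ->
  \int[mu]_w (\esum_(i in S) a i w) = \esum_(i in S) \int[mu]_w a i w.
Proof.
move=> a0 ma; under eq_integral do rewrite esum_enum//.
rewrite integral_nneseries//; last 2 first.
- by move=> n; exact: measurable_enum_term.
- by move=> n w _; exact: enum_term_ge0.
rewrite esum_enum; last by move=> i; exact: integral_ge0.
apply: eq_eseriesr => n _; rewrite /enum_term; case: pickle_inv => [i|]; last exact: integral0.
by case: (i \in S) => //; exact: integral0.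
Qed.

Lemma cvg_integral_lap_esum (P : probability T R) (Y : T -> \bar R) S
    (a : I -> T -> \bar R) :
  measurable_fun setT Y -> (forall w, 0 <= Y w <= 1) ->
  (forall i w, 0 <= a i w) -> (forall i, S i -> measurable_fun setT (a i)) ->
  \int[P]_w (Y w * lap (\sum_(m < n) enum_term S (a ^~ w) m)) @[n --> \oo] -->
  \int[P]_w (Y w * lap (\esum_(i in S) a i w)).
Proof.
move=> mY Y01 a0 ma; have t0 m w : 0 <= enum_term S (a ^~ w) m.
  exact: enum_term_ge0.
apply: cvg_integral_lap => //.
- by move=> n; apply: emeasurable_sum => m; exact: measurable_enum_term.
- by move=> n w; exact: sume_ge0.
- by move=> w m n mn; rewrite -!(big_mkord xpredT (enum_term S (a ^~ w)));
    exact: lee_sum_nneg_natr.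
- move=> w; rewrite esum_enum//.
  rewrite (_ : (fun _ => _) = fun n => \sum_(0 <= m < n) enum_term S (a ^~ w) m).
    exact: is_cvg_nneseries.
  by apply/funext => n; rewrite big_mkord.
Qed.

End countable_sums.

(** * Independent sigma-algebras and freezing *)

Section independence.
Local Open Scope ereal_scope.
Context d (T : measurableType d) {R : realType} (P : probability T R).
Implicit Types (G : set (set T)) (A B : set T).

Definition indep_sets G1 G2 :=
  forall A B, G1 A -> G2 B -> P (A `&` B) = P A * P B.

Lemma indep_setsC G1 G2 : indep_sets G1 G2 -> indep_sets G2 G1.
Proof. by move=> GG A B GA GB; rewrite setIC muleC; exact: GG. Qed.

Lemma g_sigma_algebra_sub_measurable G : G `<=` measurable ->
  <<s G >> `<=` measurable.
Proof. by move=> Gm; apply: smallest_sub => //; exact: sigma_algebra_measurable. Qed.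

(** Dynkin's pi-lambda theorem: for fixed [B] the sets [A] satisfying the product formula form a
    Dynkin system. *)
Lemma indep_sets_sigma1 G1 G2 : G1 `<=` measurable -> G2 `<=` measurable ->
  setI_closed G1 -> indep_sets G1 G2 -> indep_sets <<s G1 >> G2.
Proof.
move=> G1m G2m G1I GG A B + G2B; move: A.
have mB := G2m _ G2B.
have sm := g_sigma_algebra_sub_measurable G1m.
apply: (@dynkin_induction _ (g_sigma_algebraType G1) G1
  (fun A => P (A `&` B) = P A * P B)) => //.
- by rewrite setTI probability_setT mul1e.
- by move=> A GA; exact: GG.
- move=> A /sm mA /= AB; rewrite setIC -setDE.
  rewrite measureD//=; last by rewrite (le_lt_trans (probability_le1 _ _)) ?ltry.
  have mE : P (~` A) = 1 - P A by exact: probability_setC.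
  rewrite mE [B `&` A]setIC AB muleBl ?mul1e//; exact: fin_num_measure.
- move=> /= F mF tF FB;have mF' n : @measurable _ T (F n) by exact: sm (mF n).
  rewrite setI_bigcupl measure_bigcup//; first last.
  + by apply: trivIset_setIr.
  + by move=> i _; exact: measurableI.
  have PBf : P B \is a fin_num by exact: fin_num_measure.
  rewrite measure_bigcup// -(fineK PBf) muleC -nneseriesZl//.
  by apply: eq_eseriesr => n _; rewrite fineK// muleC; exact: FB.
Qed.

Lemma indep_sets_sigma G1 G2 : G1 `<=` measurable -> G2 `<=` measurable ->
  setI_closed G1 -> setI_closed G2 -> indep_sets G1 G2 ->
  indep_sets <<s G1 >> <<s G2 >>.
Proof.
move=> G1m G2m G1I G2I GG.
apply/indep_setsC/indep_sets_sigma1 => //.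
  exact: g_sigma_algebra_sub_measurable.
by apply/indep_setsC/indep_sets_sigma1.
Qed.

(** The identity of [T], viewed as a pair of maps into the two coarser measurable spaces, has the
    product law by independence. Tonelli's theorem then lets the second argument be resampled while
    the first one is frozen. *)
Lemma freezing G1 G2 (F : g_sigma_algebraType G1 * g_sigma_algebraType G2 -> \bar R) :
  G1 `<=` measurable -> G2 `<=` measurable ->
  indep_sets <<s G1 >> <<s G2 >> ->
  measurable_fun setT F -> (forall x, 0 <= F x) ->
  \int[P]_w F (w, w) = \int[P]_w \int[P]_w' F (w, w').
Proof.
move=> /g_sigma_algebra_sub_measurable G1m /g_sigma_algebra_sub_measurable G2m.
move=> GG mF F0.
pose i1 : T -> g_sigma_algebraType G1 := id.
pose i2 : T -> g_sigma_algebraType G2 := id.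
have mi1 : measurable_fun setT i1.
  by move=> _ A mA; rewrite setTI; exact: G1m.
have mi2 : measurable_fun setT i2.
  by move=> _ A mA; rewrite setTI; exact: G2m.
pose dg (w : T) : g_sigma_algebraType G1 * g_sigma_algebraType G2 := (i1 w, i2 w).
have mdg : measurable_fun setT dg by exact: measurable_fun_pair.
transitivity (\int[pushforward P dg]_x F x).
  by rewrite ge0_integral_pushforward.
have mi1' := isMeasurableFun.Build _ _ _ _ i1 mi1.
have mi2' := isMeasurableFun.Build _ _ _ _ i2 mi2.
pose X1 : {mfun T >-> g_sigma_algebraType G1} := HB.pack i1 mi1'.
pose X2 : {mfun T >-> g_sigma_algebraType G2} := HB.pack i2 mi2'.
pose P1 := distribution P X1; pose P2 := distribution P X2.
transitivity (\int[P1 \x P2]_x F x).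
  apply: eq_measure_integral => A mA _; apply/esym.
  by apply: product_measure_unique => // B C mB mC; exact: GG.
rewrite fubini_tonelli1// ge0_integral_distribution//.
- by apply: eq_integral => w _; rewrite /= /fubini_F ge0_integral_distribution//; exact:
  measurable_fun_pair2.
- exact: measurable_fun_fubini_tonelli_F.
- by move=> x; exact: integral_ge0.
Qed.

(** Mutual independence speaks of finite families only; the finite intersections of events with
    indices in [J] form a pi-system, to which [indep_sets_sigma1] applies. *)
Lemma indep_sets_rest (I : choiceType) (F : I -> set (set T)) (J : set I) i0 :
  (forall i, F i `<=` measurable) -> (forall i, sigma_algebra setT (F i)) ->
  mutually_independent P F -> ~ J i0 ->
  indep_sets <<s \bigcup_(i in J) F i >> (F i0).
Proof.
move=> Fm Fs PF Ji0.
have FT i : F i setT by case: (Fs i) => F0 FC _; rewrite -[setT]setD0; exact: FC.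
have FI i : setI_closed (F i).
  move=> A B FA FB; have -> : A `&` B = setT `\` (\bigcup_k bigcup2 (setT `\` A) (setT `\` B)
    k).
    by rewrite !setTD bigcup2E setCU !setCK.
  case: (Fs i) => F0 FC FU; apply: (FC); apply: FU => -[|[|n]]//=; exact: FC.
pose C : set (set T) := [set A | exists (s : seq I) (E : I -> set T),
   [/\ {in s, forall i, J i}, forall i, F i (E i) & A = \bigcap_(i in [set` s]) E i]].
have Cm : C `<=` measurable.
  move=> _ [s [E [_ FE ->]]]; rewrite bigcap_seq.
  by apply: bigsetI_measurable => i _; exact/Fm/FE.
have CI : setI_closed C.
  move=> _ _ [s [E [sJ FE ->]]] [s' [E' [sJ' FE' ->]]].
  exists (s ++ s'), (fun i => (if i \in s then E i else setT) `&` (if i \in s' then E' i else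
    setT)).
  split=> [i|i|].
  - by rewrite mem_cat => /orP[/sJ|/sJ'].
  - by apply: FI; case: ifP.
  - apply/seteqP; split=> [w [sE sE'] i /=|w /= sE].
      by move=> _; split; case: ifPn => // si; [exact: sE|exact: sE'].
    split=> i /= si; have := sE i; rewrite /= mem_cat si ?orbT/=.
      by move=> /(_ isT)[].
    by move=> /(_ isT)[].
suff : indep_sets <<s C >> (F i0).
  move=> CF A B GA; apply: CF; apply: sub_smallest2r GA => // X [i Ji FX].
  exists [:: i], (fun j => if j == i then X else setT); split=> [j|j|].
  - by rewrite inE => /eqP ->.
  - by case: eqP => // ->.
  - apply/seteqP; split=> [w Xw j /=|w /(_ i)/=].
      by rewrite inE => /eqP ->; rewrite eqxx.
    by rewrite inE eqxx; apply.
apply: indep_sets_sigma1 => // _ B [s [E [sJ FE ->]]] FB.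
pose E' i := if i == i0 then B else E i.
have FE' i : F i (E' i) by rewrite /E'; case: eqP => // ->.
(* The list of indices may have repetitions, whereas mutual independence is stated for distinct
   indices. *)
have si0 : i0 \notin undup s by rewrite mem_undup; apply/negP => /sJ.
have EE : \bigcap_(i in [set` s]) E i = \bigcap_(i in [set` undup s]) E i.
  by congr bigcap; apply/seteqP; split => i /=; rewrite mem_undup.
have := PF (i0 :: undup s) E'; rewrite /= si0 undup_uniq => /(_ isT (fun i _ => FE' i)).
have EE' : \bigcap_(i in [set` undup s]) E' i = \bigcap_(i in [set` s]) E i.
  rewrite EE; apply: eq_bigcapr => i /= si; rewrite /E'; case: eqP => // ii0.
  by move: si0; rewrite -ii0 si.
have E'i0 : E' i0 = B by rewrite /E' eqxx.
have -> : \bigcap_(i in [set` i0 :: undup s]) E' i =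
    B `&` \bigcap_(i in [set` undup s]) E' i.
  apply/seteqP; split=> [w E'w|w [Bw E'w] i /=].
    split; first by rewrite -E'i0; apply: E'w; rewrite /= mem_head.
    by move=> i si; apply: E'w; rewrite /= inE (si : _ \in _) orbT.
  by rewrite inE => /predU1P[->|/E'w//]; rewrite E'i0.
rewrite EE' setIC big_cons E'i0 => ->.
by rewrite muleC -EE' (PF _ E')// undup_uniq.
Qed.

End independence.

(** * Counting, Poisson series and step functions *)

Section counting_and_exponential_series.
Local Open Scope ereal_scope.
Context {R : realType}.

Lemma counting_esum (I : choiceType) (A : set I) :
  counting A = \esum_(i in A) 1 :> \bar R.
Proof.
rewrite /counting; case: ifPn => /asboolP finA.
  by rewrite esum_fset// fsbig_finite//= sumEFin card_fset_sum1 natr_sum.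
apply/esym/eqyP => r r0.
have [B BA Br] := infinite_set_fset (Num.truncn r).+1 finA.
apply: esum_ge; exists [set` B]; first by split.
rewrite fsbig_finite//= set_fsetK sumEFin lee_fin.
have -> : (\sum_(i <- B) 1 = #|` B|%:R :> R)%R by rewrite card_fset_sum1 natr_sum.
by rewrite (le_trans (ltW (truncnS_gt _)))// ler_nat.
Qed.

Lemma nneseries_exp (x : R) : (0 <= x)%R ->
  \sum_(n <oo) (x ^+ n / n`!%:R)%:E = (expR x)%:E.
Proof.
move=> x0; rewrite expRE -EFin_lim; last first.
  rewrite /pseries/=; under eq_fun do rewrite mulrC.
  exact: is_cvg_series_exp_coeff.
apply/congr_lim/funext => n/=; rewrite /pseries/= /series/= -sumEFin//.
by under eq_bigr do rewrite mulrC.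
Qed.

Lemma poisson_mass_ge0 (r : R) m : (0 <= r)%R -> (0 <= poisson_mass r m)%R.
Proof. by move=> r0; rewrite /poisson_mass !mulr_ge0 ?exprn_ge0 ?expR_ge0. Qed.

Lemma poisson_generating (r s : R) : (0 <= r)%R -> (0 <= s)%R ->
  \sum_(m <oo) ((s ^+ m)%:E * (poisson_mass r m)%:E) = (expR (- ((1 - s) * r)))%:E.
Proof.
move=> r0 s0; rewrite (eq_eseriesr (g := fun m => (expR (- r))%:E * ((s * r) ^+ m /
  m`!%:R)%:E)); last first.
  by move=> m _; rewrite -!EFinM /poisson_mass exprMn; congr EFin; ring.
rewrite nneseriesZl; last first.
  by move=> m _; rewrite lee_fin mulr_ge0// exprn_ge0// mulr_ge0.
rewrite nneseries_exp ?mulr_ge0// -EFinM -expRD; congr (expR _)%:E; ring.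
Qed.

Lemma poisson_mean (r : R) : (0 <= r)%R ->
  \sum_(m <oo) (m%:R%:E * (poisson_mass r m)%:E) = r%:E.
Proof.
move=> r0; rewrite nneseries_recl//; last first.
  by move=> m _; rewrite -EFinM lee_fin mulr_ge0// poisson_mass_ge0.
rewrite mul0e add0e -(nneseries_addn 1); last first.
  by move=> m; rewrite -EFinM lee_fin mulr_ge0// poisson_mass_ge0.
rewrite (eq_eseriesr (g := fun m => r%:E * ((1 ^+ m)%:E * (poisson_mass r m)%:E))); last first.
  move=> m _; rewrite -!EFinM /poisson_mass expr1n addn1 factS natrM exprS; congr EFin.
  by field; rewrite nat1r !pnatr_eq0 -lt0n fact_gt0.
rewrite nneseriesZl; last first.
  by move=> m _; rewrite expr1n mul1e lee_fin poisson_mass_ge0.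
by rewrite poisson_generating// subrr mul0r oppr0 expR0 mule1.
Qed.

End counting_and_exponential_series.

Section step_functions.
Local Open Scope ereal_scope.
Context {R : realType}.
Import HBNNSimple.

(** The usual approximation by simple functions is cut off outside [-n, n], because Poisson laws are
    prescribed on sets of finite intensity and the intensity is only assumed finite on bounded
    intervals. *)
Lemma nnsfun_approx_bounded (c : R -> \bar R) :
  measurable_fun setT c -> (forall x, 0 <= c x) ->
  exists f : nat -> {nnsfun measurableTypeR R >-> R},
    [/\ forall x, nondecreasing_seq (fun n => (f n x)%:E),
        forall x, (f n x)%:E @[n --> \oo] --> c x &
        forall n x, f n x != 0%R -> x \in `[(- n%:R)%R, n%:R%R]].
Proof.
move=> mc c0.
have mI n : measurable (`[(- n%:R)%R, n%:R%R]%classic : set (measurableTypeR R)).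
  exact: measurable_itv.
pose g := nnsfun_approx (T := measurableTypeR R) measurableT mc.
have fE n (x : R) : proj_nnsfun (g n) (mI n) x = if x \in `[(- n%:R)%R, n%:R%R] then g n x
  else 0%R.
  rewrite /= mindicE /=; case: ifPn => xI.
    by rewrite mem_set ?mulr1//=.
  by rewrite memNset ?mulr0//=; exact/negP.
exists (fun n => proj_nnsfun (g n) (mI n)); split.
- move=> x m n mn; rewrite !fE lee_fin.
  case: ifPn => [xm|_]; last by case: ifP => // _; exact: fun_ge0.
  have -> : x \in `[(- n%:R)%R, n%:R%R].
    move: xm; rewrite !in_itv/= => /andP[a b]; apply/andP; split.
      by rewrite (le_trans _ a)// lerN2 ler_nat.
    by rewrite (le_trans b)// ler_nat.
  have := nd_nnsfun_approx (T := measurableTypeR R) measurableT mc mn.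
  by move=> /lefP/(_ x).
- move=> x; have := cvg_nnsfun_approx (T := measurableTypeR R) measurableT mc (fun x _ => c0
  x) (x := x) I.
  apply: cvg_trans; apply: near_eq_cvg.
  near=> n; have xn : x \in `[(- n%:R)%R, n%:R%R].
    by rewrite in_itv/= -ler_norml; near: n; exact: nbhs_infty_ger.
  by rewrite fE xn.
- by move=> n x; rewrite fE; case: ifPn => //; rewrite eqxx.
Unshelve. all: end_near.
Qed.

(** The value 0 is left out: its level set contains the complement of a bounded set in the
    application and may have infinite intensity. *)
Definition level_values (f : {nnsfun measurableTypeR R >-> R}) : seq R :=
  fset_set (range f `\ 0%R).

Definition level_set (f : {nnsfun measurableTypeR R >-> R})
    (k : 'I_(size (level_values f))) : set R :=
  f @^-1` [set nth 0%R (level_values f) k].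
Arguments level_set f k : clear implicits.

Variable f : {nnsfun measurableTypeR R >-> R}.

Lemma mem_level_values x : (f x \in level_values f) = (f x != 0%R).
Proof.
rewrite /level_values in_fset_set; last exact: finite_setD.
apply/idP/idP => [/set_mem[_ /eqP]//|f0]; apply/mem_set; split; last exact/eqP.
by exists x.
Qed.

Lemma level_value_gt0 k : (k < size (level_values f))%N ->
  (0 < nth 0 (level_values f) k)%R.
Proof.
move=> /(mem_nth 0%R); rewrite /level_values in_fset_set; last exact: finite_setD.
by move=> /set_mem[[x _ <-] /eqP]; rewrite lt0r => ->/=; exact: fun_ge0.
Qed.

Lemma measurable_level_set k : measurable (level_set f k).
Proof. by rewrite -[level_set f k]setTI; exact: (measurable_funP f). Qed.

Lemma trivIset_level_set : trivIset setT (level_set f).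
Proof.
apply/trivIsetP => i j _ _ /eqP ij; apply/seteqP; split=> // x [].
rewrite /level_set/= => -> /eqP; rewrite nth_uniq ?fset_uniq// => /eqP/val_inj/ij[].
Qed.

Lemma level_setE (phi : R -> \bar R) x : phi 0%R = 0 ->
  phi (f x) = \sum_(k < size (level_values f))
    phi (nth 0%R (level_values f) k) * (\1_(level_set f k) x)%:E.
Proof.
move=> phi0; have [f0|f0] := eqVneq (f x) 0%R.
  rewrite f0 phi0 big1// => k _; rewrite indicE memNset ?mule0//= => fx.
  by have := level_value_gt0 (ltn_ord k); rewrite -fx f0 ltxx.
have fk : (index (f x) (level_values f) < size (level_values f))%N.
  by rewrite index_mem mem_level_values.
rewrite (bigD1 (Ordinal fk))//= nth_index ?mem_level_values//.
rewrite indicE mem_set ?mule1/=; last first.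
  by rewrite /level_set/= nth_index ?mem_level_values.
rewrite big1 ?adde0// => k kn; rewrite indicE memNset ?mule0//= => fx.
case/eqP: kn; apply: val_inj => /=.
by rewrite fx index_uniq ?fset_uniq.
Qed.

End step_functions.
Arguments level_set {R} f k.
Section extended_series.
Local Open Scope ereal_scope.
Context {R : realType}.

Lemma nneseriesMl (c : \bar R) (a : nat -> \bar R) : 0 <= c ->
  (forall n, 0 <= a n) -> \sum_(n <oo) (c * a n) = c * \sum_(n <oo) a n.
Proof.
move=> c0 a0; rewrite -!ge0_integral_count//; last by move=> n; exact: mule_ge0.
by rewrite ge0_integralZl.
Qed.

Lemma nneseries_single (a : nat -> \bar R) m0 : (forall m, 0 <= a m) ->
  \sum_(m <oo) ((m == m0)%:R%:E * a m) = a m0.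
Proof.
move=> a0; rewrite (@nneseriesD1 _ _ m0)//; last by move=> m _; rewrite mule_ge0 ?lee_fin.
rewrite eqxx mul1e eseries0 ?adde0// => m _ /andP[_ /negbTE ->].
by rewrite mul0e.
Qed.

(** The extension of [g] by 0 to every extended real that is not a natural number, +oo included, in
    the form of a series whose terms are measurable. *)
Definition value_at (g : nat -> \bar R) (x : \bar R) : \bar R :=
  \sum_(m <oo) (g m * (x == m%:R%:E)%:R%:E).

Lemma cvg_integral_monotone d (T : measurableType d)
    (mu : {measure set T -> \bar R}) (u : nat -> T -> \bar R) (l : T -> \bar R) :
  (forall n, measurable_fun setT (u n)) -> (forall n x, 0 <= u n x) ->
  (forall x, nondecreasing_seq (u ^~ x)) ->
  (forall x, u n x @[n --> \oo] --> l x) ->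
  \int[mu]_x u n x @[n --> \oo] --> \int[mu]_x l x.
Proof.
move=> mu_ u0 ndu ul.
have -> : \int[mu]_x l x = \int[mu]_x limn (u ^~ x).
  by apply: eq_integral => x _; apply/esym/cvg_lim.
by apply: cvg_monotone_convergence => //= x _; exact: ndu.
Qed.

(** Monotone convergence for the counting measure. *)
Lemma cvg_nneseries_monotone (u : nat -> nat -> \bar R) (l : nat -> \bar R) :
  (forall n i, 0 <= u n i) -> (forall i, nondecreasing_seq (u ^~ i)) ->
  (forall i, u n i @[n --> \oo] --> l i) ->
  \sum_(i <oo) u n i @[n --> \oo] --> \sum_(i <oo) l i.
Proof.
move=> u0 ndu ul.
have l0 i : 0 <= l i.
  by rewrite -(cvg_lim _ (ul i))//; apply: lime_ge; [apply/cvg_ex; exists (l i)|apply: nearW].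
rewrite -ge0_integral_count//; under eq_fun do rewrite -ge0_integral_count//.
exact: cvg_integral_monotone.
Qed.

Lemma measurable_eprod d (T : measurableType d) (I : Type) (s : seq I)
    (f : I -> T -> \bar R) : (forall i, measurable_fun setT (f i)) ->
  measurable_fun setT (fun w => \prod_(i <- s) f i w).
Proof.
move=> mf; elim: s => [|i s IH].
  by under eq_fun do rewrite big_nil; exact: measurable_cst.
by under eq_fun do rewrite big_cons; exact: emeasurable_funM.
Qed.

Lemma measurable_eq_nat d (T : measurableType d) (f : T -> \bar R) m :
  measurable_fun setT f ->
  measurable_fun setT (fun w => (f w == m%:R%:E)%:R%:E : \bar R).
Proof.
move=> mf.
have mA : measurable (f @^-1` [set m%:R%:E]).
  by rewrite -[_ @^-1` _]setTI; exact: mf.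
rewrite (_ : (fun _ => _) = fun w => (\1_(f @^-1` [set m%:R%:E]) w)%:E).
  exact/measurable_EFinP/measurable_indic.
apply/funext => w; rewrite indicE; congr ((nat_of_bool _)%:R%:E).
by apply/idP/idP => [/eqP fw|/set_mem/= ->]; first exact/mem_set.
Qed.

Lemma value_at_nat (g : nat -> \bar R) m0 : (forall m, 0 <= g m) ->
  value_at g m0%:R%:E = g m0.
Proof.
move=> g0; rewrite /value_at -[RHS](@nneseries_single g)//.
apply: eq_eseriesr => m _; rewrite muleC eqe eqr_nat eq_sym; congr (_ * _).
Qed.

Lemma value_at_pinfty (g : nat -> \bar R) : value_at g +oo = 0.
Proof. by rewrite /value_at eseries0// => m _ _; rewrite mule0. Qed.

Lemma value_at_ge0 (g : nat -> \bar R) x : (forall m, 0 <= g m) ->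
  0 <= value_at g x.
Proof.
by move=> g0; apply: nneseries_ge0 => m _ _; rewrite mule_ge0 ?lee_fin.
Qed.

Lemma measurable_value_at d (T : measurableType d) (f : T -> \bar R)
    (g : nat -> \bar R) : (forall m, 0 <= g m) -> measurable_fun setT f ->
  measurable_fun setT (fun w => value_at g (f w)).
Proof.
move=> g0 mf; apply: ge0_emeasurable_sum => [m w _ _|m _].
  by rewrite mule_ge0 ?lee_fin.
by apply: measurable_funeM; exact: measurable_eq_nat.
Qed.

End extended_series.

(** * Mean and Laplace functional of a Poisson process *)

Section poisson.
Local Open Scope ereal_scope.
Context d (T : measurableType d) {R : realType} (P : probability T R).
Context (lam : R -> R) (X : nat -> T -> \bar R).
Hypothesis lam_ge0 : forall x, (0 <= lam x)%R.
Hypothesis mlam : measurable_fun setT lam.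
Hypothesis lam_fin : forall n : nat,
  intensity_measure lam `[(- n%:R)%R, n%:R%R] < +oo.
Hypothesis XP : poisson_process P lam X.

Let mX n : measurable_fun setT (X n).
Proof. by case: XP. Qed.

Definition pt_sum (c : R -> \bar R) (w : T) : \bar R :=
  \sum_(n <oo) on_fin c (X n w).

Lemma pt_sum_ge0 c w : (forall x, 0 <= c x) -> 0 <= pt_sum c w.
Proof. by move=> c0; apply: nneseries_ge0 => n _ _; exact: on_fin_ge0. Qed.

Lemma measurable_pt_sum c : measurable_fun setT c -> (forall x, 0 <= c x) ->
  measurable_fun setT (pt_sum c).
Proof.
move=> mc c0; apply: ge0_emeasurable_sum => [n w _ _|n _]; first exact: on_fin_ge0.
by apply: measurableT_comp => //; exact: measurable_on_fin.
Qed.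

Lemma nb_pointsE w B : nb_points X w B = pt_sum (fun x => (\1_B x)%:E) w.
Proof.
rewrite /nb_points counting_esum /pt_sum nneseries_esumT; last first.
  by move=> n; apply: on_fin_ge0 => x.
rewrite esum_mkcond; apply: eq_esum => n _.
case: ifPn => [/set_mem[x Bx ->]|/negP nX]; first by rewrite /= indicE mem_set.
case E : (X n w) => [x||]//=; rewrite indicE memNset// => Bx.
by apply: nX; apply/mem_set; exists x.
Qed.

Lemma intensity_ge0 B : 0 <= intensity_measure lam B.
Proof. by apply: integral_ge0 => x _; rewrite lee_fin. Qed.

(** The definition of a Poisson process is the case where every [g k] is the indicator of one
    integer. Both sides are linear in each [g k], even for countable nonnegative combinations, and
    every [g k] is such a combination of indicators. *)
Lemma poisson_joint n (B : 'I_n -> set R) (g : 'I_n -> nat -> \bar R) :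
  (forall k, measurable (B k)) -> trivIset setT B ->
  (forall k, intensity_measure lam (B k) < +oo) ->
  (forall k m, 0 <= g k m) ->
  \int[P]_w (\prod_(k < n) value_at (g k) (nb_points X w (B k))) =
  \prod_(k < n) \sum_(m <oo)
    (g k m * (poisson_mass (fine (intensity_measure lam (B k))) m)%:E).
Proof.
move=> mB tB fB.
have mN k : measurable_fun setT (fun w => nb_points X w (B k)).
  under eq_fun do rewrite nb_pointsE; apply: measurable_pt_sum => //.
  exact/measurable_EFinP/measurable_indic.
have mval gg k : (forall m, 0 <= gg m) ->
    measurable_fun setT (fun w => value_at gg (nb_points X w (B k))).
  by move=> gg0; exact: measurable_value_at.
have pm0 k m : 0 <= (poisson_mass (fine (intensity_measure lam (B k))) m)%:E.
  by rewrite lee_fin poisson_mass_ge0// fine_ge0// intensity_ge0.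
have val_single m0 x : value_at (fun m => (m == m0)%:R%:E) x = (x == m0%:R%:E)%:R%:E.
  by apply: (nneseries_single (a := fun m => (x == m%:R%:E)%:R%:E)) => m; rewrite lee_fin.
(* Induction on the number [j] of leading coordinates where [g] is arbitrary; in all the others it
   is the indicator of an integer. *)
suff S j : forall g : 'I_n -> nat -> \bar R, (forall k m, 0 <= g k m) ->
    (forall k : 'I_n, (j <= k)%N -> exists m0, g k = fun m => (m == m0)%:R%:E) ->
  \int[P]_w (\prod_(k < n) value_at (g k) (nb_points X w (B k))) =
  \prod_(k < n) \sum_(m <oo)
    (g k m * (poisson_mass (fine (intensity_measure lam (B k))) m)%:E).
  move=> g0; apply: (S n) => // k; by rewrite leqNgt ltn_ord.
elim: j => [{}g g0 gs|j IH {}g g0 gs].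
  have [m0 gE] := choice (fun k => gs k (leq0n k)).
  under eq_integral do under eq_bigr do rewrite gE val_single.
  under [RHS]eq_bigr do rewrite gE nneseries_single ?pm0//.
  rewrite prodEFin -(proj2 XP n B m0)//.
  rewrite -[in RHS](setIT [set w | _]) -integral_indic//; last first.
    rewrite [X in measurable X](_ : _ = \bigcap_(k in setT)
      ((fun w => nb_points X w (B k)) @^-1` [set (m0 k)%:R%:E])); last first.
      by apply/seteqP; split=> w /= h k; [move=> _|]; exact: h.
    apply: fin_bigcap_measurable => // k _.
    by rewrite -[_ @^-1` _]setTI; exact: mN.
  apply: eq_integral => w _; rewrite prodEFin indicE; congr EFin.
  have [wA|wA] := boolP (w \in _).
    by move/set_mem : wA => /= wA; rewrite big1// => k _; rewrite wA eqxx.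
  apply/eqP; rewrite prodf_seq_eq0; apply/hasP.
  have [k /eqP kN] : exists k, nb_points X w (B k) <> (m0 k)%:R%:E.
    by apply/existsNP => wA'; move/negP : wA; apply; exact/mem_set.
  by exists k; rewrite ?mem_index_enum//= (negbTE kN).
have [jn|nj] := ltnP j n; last first.
  apply: IH => // k jk; have := leq_trans nj jk.
  by rewrite leqNgt ltn_ord.
pose kj := Ordinal jn.
pose g' m k := if k == kj then (fun i : nat => (i == m)%:R%:E : \bar R) else g k.
have g'0 m k i : 0 <= g' m k i by rewrite /g'; case: ifP.
have g'j m : g' m kj = fun i => (i == m)%:R%:E by rewrite /g' eqxx.
have H m : \int[P]_w (\prod_(k < n) value_at (g' m k) (nb_points X w (B k))) =
  \prod_(k < n) \sum_(i <oo)
    (g' m k i * (poisson_mass (fine (intensity_measure lam (B k))) i)%:E).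
  apply: IH => // k; rewrite leq_eqVlt => /predU1P[jk|jk].
    by exists m; rewrite /g' ifT//; apply/eqP/val_inj.
  rewrite /g' ifF; first exact: gs.
  by apply/eqP => kkj; rewrite kkj ltnn in jk.
(* The factor of coordinate [kj] is expanded over the values of its count, each term falling under
   the induction hypothesis. *)
transitivity (\int[P]_w (\sum_(m <oo) (g kj m *
    \prod_(k < n) value_at (g' m k) (nb_points X w (B k))))).
  apply: eq_integral => w _; rewrite (bigD1 kj)//= muleC [value_at (g kj) _]/value_at
    -nneseriesMl//; last 2 first.
  - by apply: prode_ge0 => k _; exact: value_at_ge0.
  - by move=> m; rewrite mule_ge0.
  apply: eq_eseriesr => m _; rewrite [in RHS](bigD1 kj)//= g'j.
  rewrite val_single muleC muleA.
  by congr (_ * _); apply: eq_bigr => k kkj; rewrite /g' (negbTE kkj).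
rewrite integral_nneseries//; last 2 first.
- move=> m; apply: measurable_funeM; apply: measurable_eprod => k.
  by apply: mval => i; exact: g'0.
- by move=> m w _; rewrite mule_ge0//; apply: prode_ge0 => k _; exact: value_at_ge0.
rewrite (bigD1 kj)//= muleC -nneseriesMl; last 2 first.
- apply: prode_ge0 => k _; apply: nneseries_ge0 => m _ _.
  by rewrite mule_ge0.
- by move=> m; rewrite mule_ge0.
apply: eq_eseriesr => m _; rewrite ge0_integralZl//; last 2 first.
- by apply: measurable_eprod => k; apply: mval => i; exact: g'0.
- by move=> w _; apply: prode_ge0 => k _; exact: value_at_ge0.
rewrite H (bigD1 kj)//= g'j nneseries_single ?pm0// muleA muleC.
by congr (_ * _); apply: eq_bigr => k kkj; rewrite /g' (negbTE kkj).
Qed.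

Lemma measurable_nb_points B : measurable B ->
  measurable_fun setT (fun w => nb_points X w B).
Proof.
move=> mB; under eq_fun do rewrite nb_pointsE; apply: measurable_pt_sum => //.
exact/measurable_EFinP/measurable_indic.
Qed.

Lemma nb_points_ge0 w B : 0 <= nb_points X w B.
Proof. by rewrite nb_pointsE pt_sum_ge0// => x; rewrite lee_fin. Qed.

Lemma nb_points_cases w B :
  nb_points X w B = +oo \/ exists m, nb_points X w B = m%:R%:E.
Proof. by rewrite /nb_points /counting; case: ifPn => _; [right; eexists|left]. Qed.

Definition intensity_integral (c : R -> \bar R) :=
  \int[lebesgue_measure]_x (c x * (lam x)%:E).

Import HBNNSimple.

Section step.
Context (f : {nnsfun measurableTypeR R >-> R}).

Let s k : R := nth 0%R (level_values f) k.

Let s_gt0 (k : 'I_(size (level_values f))) : (0 < s k)%R.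
Proof. exact: level_value_gt0. Qed.

Let measurable_indicE (B : set R) : measurable B ->
  measurable_fun [set: R] (fun x => (\1_B x)%:E : \bar R).
Proof. by move=> mB; exact/measurable_EFinP/measurable_indic. Qed.

Lemma pt_sum_step w : pt_sum (EFin \o f) w =
  \sum_(k < size (level_values f)) (s k)%:E * nb_points X w (level_set f k).
Proof.
rewrite /pt_sum; under eq_eseriesr => n _.
  rewrite (_ : on_fin _ _ = \sum_(k < size (level_values f))
      (s k)%:E * on_fin (fun x => (\1_(level_set f k) x)%:E) (X n w)); last first.
    case: (X n w) => [x||]/=; last 2 first.
    + by rewrite big1// => k _; rewrite mule0.
    + by rewrite big1// => k _; rewrite mule0.
    exact: (@level_setE R f EFin).
  over.
rewrite nneseries_sum; last first.
  by move=> n k _; rewrite mule_ge0 ?lee_fin ?(ltW (s_gt0 _))//; apply: on_fin_ge0.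
apply: eq_bigr => k _; rewrite nneseriesMl ?nb_pointsE ?lee_fin ?(ltW (s_gt0 _))//.
by move=> n; apply: on_fin_ge0.
Qed.

Lemma intensity_integral_step (phi : R -> \bar R) : phi 0%R = 0 ->
  (forall x, (0 <= x)%R -> 0 <= phi x) -> intensity_integral (phi \o f) =
  \sum_(k < size (level_values f)) phi (s k) * intensity_measure lam (level_set f k).
Proof.
move=> phi0 phi_ge0.
have s0 k : 0 <= phi (nth 0%R (level_values f) (k : 'I_(size (level_values f)))).
  exact/phi_ge0/ltW/s_gt0.
rewrite /intensity_integral; under eq_integral => x _.
  rewrite /= (@level_setE R f phi x phi0) ge0_sume_distrl; last first.
    by move=> k _; rewrite mule_ge0.
  over.
rewrite ge0_integral_sum//; last 2 first.
- move=> k; apply: emeasurable_funM; last exact/measurable_EFinP.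
  by apply: measurable_funeM; apply: measurable_indicE; exact: measurable_level_set.
- by move=> k x _; rewrite mule_ge0 ?lee_fin// mule_ge0.
apply: eq_bigr => k _; under eq_integral do rewrite -muleA.
rewrite ge0_integralZl//; last 2 first.
- apply: emeasurable_funM; last exact/measurable_EFinP.
  by apply: measurable_indicE; exact: measurable_level_set.
- by move=> x _; rewrite mule_ge0 ?lee_fin.
congr (_ * _); rewrite /intensity_measure [RHS]integral_mkcond.
apply: eq_integral => x _; rewrite patchE indicE.
by case: ifP; rewrite ?mul1e ?mul0e.
Qed.

End step.

(** [poisson_joint] does not see infinite counts, [value_at] being 0 there. Taking g = 1 first shows
    that the count is almost surely finite; the identity then gives the mean. *)
Lemma mean_nb_points B : measurable B -> intensity_measure lam B < +oo ->
  \int[P]_w nb_points X w B = intensity_measure lam B.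
Proof.
move=> mB fB.
have mN := measurable_nb_points mB.
have joint1 (g : nat -> \bar R) : (forall m, 0 <= g m) ->
    \int[P]_w value_at g (nb_points X w B) =
    \sum_(m <oo) (g m * (poisson_mass (fine (intensity_measure lam B)) m)%:E).
  move=> g0; have := @poisson_joint 1 (fun=> B) (fun=> g).
  rewrite big_ord1; under eq_integral do rewrite big_ord1.
  apply => //; apply/trivIsetP => i j _ _; by rewrite !ord1.
have r0 : (0 <= fine (intensity_measure lam B))%R by rewrite fine_ge0// intensity_ge0.
have rf : intensity_measure lam B \is a fin_num by rewrite ge0_fin_numE ?intensity_ge0.
transitivity (\int[P]_w value_at (fun m => m%:R%:E) (nb_points X w B)); last first.
  by rewrite joint1 ?poisson_mean ?fineK// => m; rewrite lee_fin.
have mv : measurable_fun setT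
    (fun w => value_at (fun m => m%:R%:E : \bar R) (nb_points X w B)).
  by apply: measurable_value_at => // m; rewrite lee_fin.
apply: ae_eq_integral => //.
pose A := [set w | nb_points X w B = +oo].
have mA : measurable A by rewrite -[A]setTI; exact: (mN measurableT [set +oo]).
exists A; split => //.
  have PAC : P (~` A) = 1.
    rewrite -(setIT (~` A)) -integral_indic//; last exact: measurableC.
    have := joint1 (fun m => (1 ^+ m)%:E) (fun m => _).
    rewrite poisson_generating// subrr mul0r oppr0 expR0 => <-; last first.
      by move=> m; rewrite expr1n lee_fin.
    apply: eq_integral => w _; rewrite indicE.
    case: (nb_points_cases w B) => [wA|[m wm]].
      by rewrite wA value_at_pinfty memNset//= => /(_ wA).
    by rewrite wm value_at_nat ?expr1n// mem_set//= /A/= wm.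
  by rewrite -[A]setCK [LHS]probability_setC ?PAC ?subee//; exact: measurableC.
move=> w /= nw; apply: contrapT => /= wA; apply: nw => _.
case: (nb_points_cases w B) => [//|[m ->]].
by rewrite value_at_nat// => i; rewrite lee_fin.
Qed.

Lemma finite_level_set (f : {nnsfun measurableTypeR R >-> R}) (n : nat) k :
  (forall x, f x != 0%R -> x \in `[(- n%:R)%R, n%:R%R]) ->
  intensity_measure lam (level_set f k) < +oo.
Proof.
move=> fn; apply: le_lt_trans (lam_fin n).
apply: ge0_subset_integral => //.
- exact: measurable_level_set.
- exact/measurable_EFinP/measurable_funTS.
- by move=> x _; rewrite lee_fin.
- move=> x; rewrite /level_set/= => fx; apply: fn.
  by rewrite fx gt_eqF// level_value_gt0.
Qed.

Lemma cvg_pt_sum (u : nat -> R -> \bar R) (c : R -> \bar R) w :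
  (forall n x, 0 <= u n x) -> (forall x, nondecreasing_seq (u ^~ x)) ->
  (forall x, u n x @[n --> \oo] --> c x) ->
  pt_sum (u n) w @[n --> \oo] --> pt_sum c w.
Proof.
move=> u0 ndu uc; apply: cvg_nneseries_monotone => [n i|i|i].
- exact: on_fin_ge0.
- by move=> m n mn; case: (X i w) => //= x; exact: ndu.
- by case: (X i w) => [x||]/=; [exact: uc|exact: cvg_cst|exact: cvg_cst].
Qed.

Lemma le_pt_sum (c c' : R -> \bar R) w : (forall x, 0 <= c x) ->
  (forall x, c x <= c' x) -> pt_sum c w <= pt_sum c' w.
Proof.
move=> c0 cc'; apply: lee_nneseries => [n _ _|n _]; first exact: on_fin_ge0.
by case: (X n w) => /=.
Qed.

Lemma cvg_intensity_integral (u : nat -> R -> \bar R) (c : R -> \bar R) :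
  (forall n, measurable_fun setT (u n)) ->
  (forall n x, 0 <= u n x) -> (forall x, nondecreasing_seq (u ^~ x)) ->
  (forall x, u n x @[n --> \oo] --> c x) ->
  intensity_integral (u n) @[n --> \oo] --> intensity_integral c.
Proof.
move=> mu u0 ndu uc; apply: cvg_integral_monotone => [n|n x|x|x].
- by apply: emeasurable_funM; [exact: mu|exact/measurable_EFinP].
- by rewrite mule_ge0 ?lee_fin.
- by move=> m n mn; rewrite lee_wpmul2r ?lee_fin//; exact: ndu.
- by apply: cvgeZr => //; exact: uc.
Qed.

(** Exact on step functions by [mean_nb_points]; both sides pass to increasing limits. *)
Lemma campbell (c : R -> \bar R) : measurable_fun setT c -> (forall x, 0 <= c x) ->
  \int[P]_w pt_sum c w = intensity_integral c.
Proof.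
move=> mc c0; have [f [ndf fc fb]] := nnsfun_approx_bounded mc c0.
have mf n : measurable_fun setT (EFin \o f n) by exact/measurable_EFinP.
have f0 n x : 0 <= (EFin \o f n) x by rewrite lee_fin.
have step n : \int[P]_w pt_sum (EFin \o f n) w = intensity_integral (EFin \o f n).
  under eq_integral do rewrite pt_sum_step.
  have s0 (k : 'I_(size (level_values (f n)))) : 0 <= (nth 0%R (level_values (f n)) k)%:E.
    by rewrite lee_fin ltW// level_value_gt0.
  rewrite ge0_integral_sum//; last 2 first.
  - by move=> k; apply: measurable_funeM; apply: measurable_nb_points; exact:
    measurable_level_set.
  - move=> k w _; apply: mule_ge0; [exact: s0|exact: nb_points_ge0].
  rewrite (@intensity_integral_step (f n) EFin)//.
  apply: eq_bigr => k _; have mB := measurable_level_set k.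
  rewrite -mean_nb_points//; last exact: finite_level_set (fb n).
  by apply: ge0_integralZl => //; exact: measurable_nb_points.
have cvL : \int[P]_w pt_sum (EFin \o f n) w @[n --> \oo] --> \int[P]_w pt_sum c w.
  apply: cvg_integral_monotone => [n|n w|w|w].
  - exact: measurable_pt_sum (mf n) (f0 n).
  - exact: pt_sum_ge0 (f0 n).
  - by move=> m n mn; apply: le_pt_sum => // x; exact: ndf.
  - exact: cvg_pt_sum.
rewrite (funext step) in cvL; apply: (cvg_unique _ cvL) => //.
exact: cvg_intensity_integral.
Qed.

(** For a step function the counts of the level sets are independent Poisson variables, and the
    generating function at exp(-s) of one with mean r is exp(-(1 - exp(-s)) r). Both sides pass to
    increasing limits. *)
Lemma poisson_laplace (c : R -> \bar R) : measurable_fun setT c ->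
  (forall x, 0 <= c x) ->
  \int[P]_w lap (pt_sum c w) = lap (intensity_integral (fun x => 1 - lap (c x))).
Proof.
move=> mc c0; have [f [ndf fc fb]] := nnsfun_approx_bounded mc c0.
have mf n : measurable_fun setT (EFin \o f n) by exact/measurable_EFinP.
have f0 n x : 0 <= (EFin \o f n) x by rewrite lee_fin.
pose phi (y : R) : \bar R := 1 - lap y%:E.
have phi0 x : (0 <= x)%R -> 0 <= phi x.
  by move=> x0; rewrite sube_ge0 ?lap_le1// lap_fin_num.
have step n : \int[P]_w lap (pt_sum (EFin \o f n) w) =
    lap (intensity_integral (phi \o f n)).
  rewrite intensity_integral_step//; last by rewrite /phi lap0 subee.
  rewrite lap_sum; last first.
    by move=> k _; rewrite mule_ge0 ?intensity_ge0// phi0// ltW// level_value_gt0.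
  have fin k : intensity_measure lam (level_set (f n) k) < +oo.
    exact: finite_level_set (fb n).
  pose g k m : \bar R := (expR (- nth 0%R (level_values (f n)) k) ^+ m)%:E.
  have g0 k m : 0 <= g k m by rewrite lee_fin exprn_ge0// expR_ge0.
  transitivity (\int[P]_w \prod_(k < size (level_values (f n)))
      value_at (g k) (nb_points X w (level_set (f n) k))).
    apply: eq_integral => w _; rewrite pt_sum_step lap_sum; last first.
      by move=> k _; rewrite mule_ge0 ?nb_points_ge0// lee_fin ltW// level_value_gt0.
    apply: eq_bigr => k _; have sk := level_value_gt0 (ltn_ord k).
    (* For an infinite count both sides vanish, because the level value is positive. *)
    case: (nb_points_cases w (level_set (f n) k)) => [->|[m ->]].
      by rewrite value_at_pinfty gt0_muley ?lte_fin.
    by rewrite value_at_nat// /lap /g/= -expRM_natr mulNr.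
  rewrite poisson_joint//; last 2 first.
  - by move=> k; exact: measurable_level_set.
  - exact: trivIset_level_set.
  apply: eq_bigr => k _; have r0 := intensity_ge0 (level_set (f n) k).
  rewrite poisson_generating ?expR_ge0 ?fine_ge0//.
  have rf : intensity_measure lam (level_set (f n) k) \is a fin_num.
    by rewrite ge0_fin_numE.
  by rewrite -[X in lap (_ * X)](fineK rf).
have cvL : \int[P]_w lap (pt_sum (EFin \o f n) w) @[n --> \oo] -->
    \int[P]_w lap (pt_sum c w).
  have e1 (u : T -> \bar R) :
      \int[P]_w lap (u w) = \int[P]_w (cst 1 w * lap (u w)).
    by apply: eq_integral => w _; rewrite mul1e.
  rewrite (e1 (pt_sum c)) (funext (fun n => e1 (pt_sum (EFin \o f n)))).
  apply: cvg_integral_lap => //.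
  - by move=> w; rewrite lee01 lexx.
  - by move=> n; exact: measurable_pt_sum (mf n) (f0 n).
  - by move=> n w; exact: pt_sum_ge0 (f0 n).
  - by move=> w m n mn; apply: le_pt_sum => // x; exact: ndf.
  - by move=> w; exact: cvg_pt_sum.
rewrite (funext step) in cvL; apply: (cvg_unique _ cvL) => //.
have phi_le x : 0 <= 1 - lap (c x) by rewrite sube_ge0 ?lap_le1// lap_fin_num.
have mphi n : measurable_fun setT (phi \o f n).
  by apply: emeasurable_funB => //; apply: measurableT_comp (mf n); exact: measurable_lap.
have ndphi x : nondecreasing_seq (fun n => phi (f n x)).
  by move=> m n mn; rewrite leeB// le_lap ?ltNyr//; exact: ndf.
apply: cvg_lap => [m n mn|n|].
- apply: ge0_le_integral => //.
  + by move=> x _; apply: mule_ge0; [exact: phi0|rewrite lee_fin].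
  + by apply: emeasurable_funM => //; exact/measurable_EFinP.
  + by apply: emeasurable_funM => //; exact/measurable_EFinP.
  + by move=> x _; rewrite lee_wpmul2r ?lee_fin//; exact: ndphi.
- by apply: integral_ge0 => x _; apply: mule_ge0; [exact: phi0|rewrite lee_fin].
apply: cvg_intensity_integral => //.
- by move=> n x; exact: phi0.
- move=> x; apply: cvgeB; [|exact: cvg_cst|by apply: cvg_lap => // n; rewrite lee_fin].
  by rewrite fin_num_adde_defr.
Qed.

End poisson.
(** * Splitting the clusters according to the location of the immigrants *)

Section cluster.
Local Open Scope ereal_scope.
Context {R : realType} {d : nat} {disp : measure_display}
  {Omega : measurableType disp} (P : probability Omega R).
Context (eta : 'I_d -> R) (h : 'I_d -> 'I_d -> R -> R).
Context (xi : label d -> 'I_d -> nat -> Omega -> \bar R).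
Hypothesis eta_ge0 : forall j, (0 <= eta j)%R.
Hypothesis h_ge0 : forall i j x, (0 <= h i j x)%R.
Hypothesis h_integrable : forall i j,
  lebesgue_measure.-integrable [set: R] (EFin \o h i j).
Hypothesis xi_poisson :
  forall u j, poisson_process P (offspring_intensity eta h u j) (xi u j).
Hypothesis xi_indep : mutually_independent P
  (fun uj : label d * 'I_d => sigma_sequence (xi uj.1 uj.2)).
Context (t : R).

Local Notation lam := (offspring_intensity eta h).

Lemma lam_ge0 u j x : (0 <= lam u j x)%R.
Proof. by case: u => [|[i n] u]//=. Qed.

Lemma measurable_lam u j : measurable_fun setT (lam u j).
Proof.
case: u => [|[i n] u]/=; first exact: measurable_cst.
by have /measurable_int/measurable_EFinP := h_integrable i j.
Qed.

Lemma lam_fin u j (n : nat) :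
  intensity_measure (lam u j) `[(- n%:R)%R, n%:R%R] < +oo.
Proof.
case: u => [|[i m] u].
  rewrite /intensity_measure /= integral_cst//= lebesgue_measure_itv/=.
  by case: ifP; rewrite ?mule0 ?ltry// => _; rewrite -EFinD -EFinM ltry.
have := h_integrable i j => /integrableP[mh]; apply: le_lt_trans.
under [leRHS]eq_integral do rewrite /= ger0_norm//.
by apply: ge0_subset_integral => // x _; rewrite lee_fin lam_ge0.
Qed.

Lemma xi_measurable u j n : measurable_fun setT (xi u j n).
Proof. by case: (xi_poisson u j). Qed.

(** Labels are written youngest first, so the last entry is that of the immigrant. The value at the
    empty label is a placeholder. *)
Definition root_location (u : label d) (w : Omega) : \bar R :=
  if u is x :: v then location xi [:: last x v] w else 0.

Definition left_side (u : label d) (w : Omega) : bool := root_location u w <= t%:E.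

Lemma left_side_cons jn u w : u != [::] -> left_side (jn :: u) w = left_side u w.
Proof. by case: u => [|x u]. Qed.

Implicit Types c : bool -> 'I_d -> R -> \bar R.

Definition cost c (u : label d) (w : Omega) : \bar R :=
  if u is (j, _) :: _ then on_fin (c (left_side u w) j) (location xi u w) else 0.

Definition good_cost c :=
  (forall s j, measurable_fun setT (c s j)) /\ (forall s j x, 0 <= c s j x).

Lemma cost_ge0 c u w : good_cost c -> 0 <= cost c u w.
Proof. by move=> [_ c0]; case: u => [|[j n] u]//=; exact: on_fin_ge0. Qed.

(* The side of an immigrant is determined by its own location, that of any other
   individual by the side of its parent. *)
Definition child_cost c (u : label d) j w (x : R) : \bar R :=
  c (if u is [::] then (x <= t)%R else left_side u w) j x.

Lemma cost_cons c u j n w :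
  cost c ((j, n) :: u) w =
  on_fin (child_cost c u j w) (location xi u w + xi u j n w).
Proof.
rewrite /cost /child_cost; case: u => [|x u]; last by rewrite left_side_cons.
by rewrite /left_side /root_location /=; case: (_ + _).
Qed.

(** The exponent that [poisson_laplace] produces for the children of type [j] of [u], when [u] is at
    [x]. *)
Definition mean_cost c u j w (x : R) : \bar R :=
  intensity_integral (lam u j) (fun z => 1 - lap (child_cost c u j w (x + z)%R)).

Definition total_mean c (p : label d * 'I_d) w : \bar R :=
  on_fin (mean_cost c p.1 p.2 w) (location xi p.1 w).

Section sub_sigma_algebra.
Context (J : set (label d * 'I_d)).

Definition generators : set (set Omega) :=
  \bigcup_(p in J) sigma_sequence (xi p.1 p.2).

Lemma generators_measurable : generators `<=` measurable.
Proof.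
move=> A [p _]; apply: g_sigma_algebra_sub_measurable => _ [n _] [B mB <-].
by rewrite -[_ @^-1` _]setTI; exact: xi_measurable.
Qed.

Definition subOmega := g_sigma_algebraType generators.

Lemma measurable_subOmega d' (T' : measurableType d') (f : Omega -> T') :
  measurable_fun [set: subOmega] f -> measurable_fun [set: Omega] f.
Proof.
move=> mf _ B mB; have := mf measurableT B mB; rewrite !setTI.
exact: (g_sigma_algebra_sub_measurable generators_measurable).
Qed.

Lemma sub_xi_measurable p n : J p -> measurable_fun [set: subOmega] (xi p.1 p.2 n).
Proof.
move=> Jp _ B mB; rewrite setTI; apply: sub_gen_smallest; exists p => //.
by apply: sub_gen_smallest; exists n => //; exists B.
Qed.

Context (k : nat).
Hypothesis Jk : forall p, (size p.1 < k)%N -> J p.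

(** A label of size at most [k] is located by litters of labels of size less than [k], all of which
    are in [J]. *)
Lemma sub_location_measurable u : (size u <= k)%N ->
  measurable_fun [set: subOmega] (location xi u).
Proof.
elim: u => [_|[j n] u IH uk]; first exact: measurable_cst.
apply: emeasurable_funD; first exact: IH (ltnW uk).
by apply: (sub_xi_measurable (p := (u, j))); exact: Jk.
Qed.

Lemma sub_left_side_measurable u : (size u <= k)%N ->
  measurable_fun [set: subOmega] (left_side u).
Proof.
move=> uk; have mr : measurable_fun [set: subOmega] (root_location u).
  case: u uk => [|x u] uk; first exact: measurable_cst.
  by apply: sub_location_measurable; exact: leq_trans uk.
apply: (measurable_fun_bool true); rewrite setTI.
rewrite (_ : _ @^-1` _ = root_location u @^-1` `]-oo, t%:E]%classic).
  by rewrite -[_ @^-1` _]setTI; apply: mr => //; exact: emeasurable_itv.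
by apply/seteqP; split => w /=; rewrite in_itv.
Qed.

Lemma sub_cost_measurable c u : good_cost c -> (size u <= k)%N ->
  measurable_fun [set: subOmega] (cost c u).
Proof.
move=> [mc _]; case: u => [|[j n] u] uk; first exact: measurable_cst.
rewrite (_ : cost c _ = fun w => if left_side ((j, n) :: u) w
  then on_fin (c true j) (location xi ((j, n) :: u) w)
  else on_fin (c false j) (location xi ((j, n) :: u) w)); last first.
  by apply/funext => w; rewrite /cost; case: left_side.
apply: measurable_fun_ifT; first exact: sub_left_side_measurable.
- by apply: measurableT_comp (sub_location_measurable uk); exact: measurable_on_fin.
- by apply: measurableT_comp (sub_location_measurable uk); exact: measurable_on_fin.
Qed.

Lemma sub_left_case_measurable c u j d' (T' : measurableType d')
    (g : T' -> subOmega) (f : T' -> \bar R) : good_cost c -> (size u <= k)%N ->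
  measurable_fun setT g -> measurable_fun setT f ->
  measurable_fun setT (fun y => on_fin (child_cost c u j (g y)) (f y)).
Proof.
move=> [mc _] uk mg mf; rewrite /child_cost; case: u uk => [|x u] uk.
  apply: measurableT_comp mf; apply: measurable_on_fin.
  rewrite (_ : (fun _ => _) = fun x => if (x <= t)%R then c true j x else c false j x).
    by apply: measurable_fun_ifT => //; exact: measurable_fun_ler.
  by apply/funext => x; case: ifP.
rewrite (_ : (fun _ => _) = fun y => if left_side (x :: u) (g y)
  then on_fin (c true j) (f y) else on_fin (c false j) (f y)); last first.
  by apply/funext => y; case: left_side.
apply: measurable_fun_ifT.
- by apply: measurableT_comp mg; exact: sub_left_side_measurable.
- by apply: measurableT_comp mf; exact: measurable_on_fin.
- by apply: measurableT_comp mf; exact: measurable_on_fin.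
Qed.

Lemma measurable_conv_lap (l : R -> R) (c : R -> \bar R) :
  measurable_fun setT l -> (forall x, (0 <= l x)%R) ->
  measurable_fun setT c -> (forall x, 0 <= c x) ->
  measurable_fun [set: R]
    (fun x => intensity_integral l (fun z => 1 - lap (c (x + z)%R))).
Proof.
move=> ml l0 mc c0.
pose G (y : R * R) : \bar R := (1 - lap (c (y.1 + y.2)%R)) * (l y.2)%:E.
apply: (@measurable_fun_fubini_tonelli_F _ _ _ _ _ lebesgue_measure G).
- apply: emeasurable_funM; last first.
    by apply/measurable_EFinP; apply: measurableT_comp ml _; exact: measurable_snd.
  apply: emeasurable_funB; first exact: measurable_cst.
  apply: (measurableT_comp measurable_lap); apply: (measurableT_comp mc).
  by apply: measurable_funD; [exact: measurable_fst|exact: measurable_snd].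
- move=> y; rewrite mule_ge0 ?lee_fin//.
  by rewrite sube_ge0 ?lap_le1// lap_fin_num.
Qed.

Lemma child_cost_good c u j w : good_cost c ->
  measurable_fun setT (child_cost c u j w) /\ forall x, 0 <= child_cost c u j w x.
Proof.
move=> [mc c0]; rewrite /child_cost; split=> [|x]; last exact: c0.
case: u => [|x u]; last exact: mc.
rewrite (_ : (fun _ => _) = fun x => if (x <= t)%R then c true j x else c false j x).
  by apply: measurable_fun_ifT => //; exact: measurable_fun_ler.
by apply/funext => x; case: ifP.
Qed.

Lemma mean_cost_ge0 c u j w x : good_cost c -> 0 <= mean_cost c u j w x.
Proof.
move=> gc; apply: integral_ge0 => z _; rewrite mule_ge0 ?lee_fin ?lam_ge0//.
by rewrite sube_ge0 ?lap_fin_num// lap_le1//; case: (child_cost_good u j w gc).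
Qed.

Lemma total_mean_ge0 c p w : good_cost c -> 0 <= total_mean c p w.
Proof. by move=> gc; apply: on_fin_ge0 => x; exact: mean_cost_ge0. Qed.

Lemma sub_total_mean_measurable c p : good_cost c -> (size p.1 <= k)%N ->
  measurable_fun [set: subOmega] (total_mean c p).
Proof.
move=> gc; case: p => -[|x u] j; rewrite [(_, _).1]/= => uk.
  exact: (measurable_cst (intensity_integral (lam [::] j)
    (fun z => 1 - lap (c (0 + z <= t)%R j (0 + z)%R)))).
pose M s y := intensity_integral (lam (x :: u) j) (fun z => 1 - lap (c s j (y + z)%R)).
have mM s : measurable_fun setT (on_fin (M s)).
  apply: measurable_on_fin; apply: measurable_conv_lap => //.
  - exact: measurable_lam.
  - exact: lam_ge0.
  - by case: gc.
  - by case: gc.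
rewrite (_ : total_mean c _ = fun w => if left_side (x :: u) w
  then on_fin (M true) (location xi (x :: u) w)
  else on_fin (M false) (location xi (x :: u) w)); last first.
  by apply/funext => w; rewrite /total_mean /mean_cost /child_cost/=; case: left_side.
apply: measurable_fun_ifT; first exact: sub_left_side_measurable.
- by apply: measurableT_comp (sub_location_measurable uk); exact: mM.
- by apply: measurableT_comp (sub_location_measurable uk); exact: mM.
Qed.

End sub_sigma_algebra.

(** The litter [xi u j] is independent of all the others, which already determine the location and
    the side of [u]: these are frozen and the litter is integrated alone. If [u] is absent then so
    are its children, hence the value [G 0]. *)
Lemma litter_freezing (G : \bar R -> \bar R) c u j (Y : Omega -> \bar R) :
  measurable_fun setT G -> (forall x, 0 <= x -> 0 <= G x) -> good_cost c ->
  measurable_fun [set: subOmega [set p | p != (u, j)]] Y ->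
  (forall w, 0 <= Y w) ->
  \int[P]_w (Y w * G (\sum_(n <oo) cost c ((j, n) :: u) w)) =
  \int[P]_w (Y w * if location xi u w is x%:E then
    \int[P]_w' G (pt_sum (xi u j) (fun z => child_cost c u j w (x + z)%R) w')
    else G 0).
Proof.
move=> mG G0 gc mY Y0.
pose J := [set p | p != (u, j)].
pose G2 := [set xi u j n @^-1` B | n in [set: nat] & B in measurable].
pose F (x : subOmega J * g_sigma_algebraType G2) : \bar R :=
  Y x.1 * G (\sum_(n <oo) on_fin (child_cost c u j x.1) (location xi u x.1 + xi u j n x.2)).
have Jk p : (size p.1 < size u)%N -> J p.
  by move=> pu; rewrite /J/=; apply: contraTneq pu => ->; rewrite ltnn.
have c0 w x := (child_cost_good u j w gc).2 x.
have s0 x (y : nat -> \bar R) : 0 <= \sum_(n <oo) on_fin (child_cost c u j x) (y n).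
  by apply: nneseries_ge0 => n _ _; exact: on_fin_ge0.
have mF : measurable_fun setT F.
  apply: emeasurable_funM.
    by apply: (measurableT_comp mY); exact: measurable_fst.
  apply: (measurableT_comp mG).
  apply: ge0_emeasurable_sum => [n x _ _|n _]; first exact: on_fin_ge0.
  apply: (@sub_left_case_measurable J (size u) Jk c u j _
    (subOmega J * g_sigma_algebraType G2)%type fst
    (fun x => location xi u x.1 + xi u j n x.2)) => //.
  apply: emeasurable_funD.
    by apply: measurableT_comp (sub_location_measurable Jk (leqnn _)) _; exact: measurable_fst.
  apply: (@measurableT_comp _ _ _ _ _ _ (xi u j n : g_sigma_algebraType G2 -> \bar R)); last
    exact: measurable_snd.
  move=> _ B mB; rewrite setTI; apply: sub_gen_smallest.
  by exists n => //; exists B.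
have F0 x : 0 <= F x by rewrite mule_ge0// G0.
transitivity (\int[P]_w F (w, w)).
  apply: eq_integral => w _; congr (_ * G _); apply: eq_eseriesr => n _.
  exact: cost_cons.
rewrite (freezing (P := P) _ _ _ mF F0); last 3 first.
- exact: generators_measurable.
- move=> _ [n _] [B mB <-]; rewrite -[_ @^-1` _]setTI; exact: xi_measurable.
- apply: (indep_sets_rest (F := fun uj => sigma_sequence (xi uj.1 uj.2)) (i0 := (u, j))) => //.
  + move=> p; apply: g_sigma_algebra_sub_measurable => _ [n _] [B mB <-].
    by rewrite -[_ @^-1` _]setTI; exact: xi_measurable.
  + by move=> p; exact: smallest_sigma_algebra.
  + by rewrite /J/= eqxx.
apply: eq_integral => w _; rewrite /F/=.
rewrite ge0_integralZl//; last 2 first.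
- apply: (measurableT_comp mG).
  apply: ge0_emeasurable_sum => [n x _ _|n _]; first exact: on_fin_ge0.
  apply: measurableT_comp; first exact: measurable_on_fin (child_cost_good u j w gc).1.
  by apply: emeasurable_funD => //; exact: xi_measurable.
- by move=> w' _; exact: G0.
congr (_ * _).
have infinite_location : location xi u w \isn't a fin_num ->
    \int[P]_w' G (\sum_(n <oo)
      on_fin (child_cost c u j w) (location xi u w + xi u j n w')) = G 0.
  move=> luw; transitivity (\int[P]_w' (cst (G 0) w')); last first.
    by rewrite integral_cst// [X in _ * X]probability_setT mule1.
  apply: eq_integral => w' _; rewrite eseries0// => n _ _.
  by move: luw; case: (location xi u w) => [//||]; case: (xi u j n w').
case lu : (location xi u w) infinite_location => [x||] inf; [|exact: inf|exact: inf].
apply: eq_integral => w' _; congr G; apply: eq_eseriesr => n _.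
by case: (xi u j n w').
Qed.

Lemma child_cost_shift_good c u j w (x : R) : good_cost c ->
  measurable_fun setT (fun z : R => child_cost c u j w (x + z)%R) /\
  forall z : R, 0 <= child_cost c u j w (x + z)%R.
Proof.
move=> gc; split=> [|z]; last exact: (child_cost_good u j w gc).2.
apply: measurableT_comp; first exact: (child_cost_good u j w gc).1.
exact: measurable_funD.
Qed.

Lemma peel_one c u j (Y : Omega -> \bar R) : good_cost c ->
  measurable_fun [set: subOmega [set p | p != (u, j)]] Y ->
  (forall w, 0 <= Y w) ->
  \int[P]_w (Y w * lap (\sum_(n <oo) cost c ((j, n) :: u) w)) =
  \int[P]_w (Y w * lap (total_mean c (u, j) w)).
Proof.
move=> gc mY Y0; rewrite (litter_freezing measurable_lap)//; last first.
  by move=> x _; exact: lap_ge0.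
apply: eq_integral => w _; congr (_ * _); rewrite /total_mean/=.
case: (location xi u w) => [x||]/=; rewrite ?lap0//.
have [mc c0] := child_cost_shift_good u j w x gc.
exact: (poisson_laplace (lam_ge0 u j) (measurable_lam u j) (lam_fin u j) (xi_poisson u j)).
Qed.

Lemma cost_measurable c u : good_cost c -> measurable_fun setT (cost c u).
Proof.
move=> gc; apply: (@measurable_subOmega setT).
by apply: (@sub_cost_measurable setT (size u)).
Qed.

Lemma total_mean_measurable c p : good_cost c -> measurable_fun setT (total_mean c p).
Proof.
move=> gc; apply: (@measurable_subOmega setT).
by apply: (@sub_total_mean_measurable setT (size p.1)).
Qed.

(** * Integrating out a whole generation *)

Definition generation_cost k c w := \esum_(u in [set u : label d | size u = k]) cost c u w.

Definition parents k : set (label d * 'I_d) := [set p | size p.1 = k].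

(** A litter consists of the children of one type of one parent, so that it is driven by a single
    Poisson process [xi]. *)
Definition litter_cost c (p : label d * 'I_d) w :=
  \sum_(n <oo) cost c ((p.2, n) :: p.1) w.

Lemma litter_cost_ge0 c p w : good_cost c -> 0 <= litter_cost c p w.
Proof. by move=> gc; apply: nneseries_ge0 => n _ _; exact: cost_ge0. Qed.

Lemma generation_costS k c w : good_cost c ->
  generation_cost k.+1 c w = \esum_(p in parents k) litter_cost c p w.
Proof.
move=> gc; transitivity (\esum_(p in parents k)
    \esum_(n in [set: nat]) cost c ((p.2, n) :: p.1) w); last first.
  apply: eq_esum => p _; rewrite /litter_cost nneseries_esumT// => n.
  exact: cost_ge0.
rewrite esum_esum; last by move=> *; exact: cost_ge0.
rewrite /generation_cost.
apply: (reindex_esum _ _ (fun x : label d * 'I_d * nat => (x.1.2, x.2) :: x.1.1)).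
split.
- by move=> [[u j] n] [/= uk _]; rewrite uk.
- by move=> [[u j] n] [[u' j'] n'] _ _ /= [-> -> ->].
- by move=> [|[j n] u]//= [uk]; exists ((u, j), n).
Qed.

(** The litter [p] involves older generations and its own displacements; another litter (u, j) of
    the same generation does not enter. *)
Lemma sub_litter_cost_measurable k u j p c : good_cost c ->
  size u = k -> size p.1 = k -> p != (u, j) ->
  measurable_fun [set: subOmega [set p | p != (u, j)]] (litter_cost c p).
Proof.
move=> gc uk pk puj.
apply: ge0_emeasurable_sum => [n w _ _|n _]; first exact: cost_ge0.
pose J := [set p | p != (u, j)].
have Jk p' : (size p'.1 < k)%N -> J p'.
  by move=> pu; rewrite /J/=; apply: contraTneq pu => ->; rewrite -leqNgt uk.
rewrite (_ : cost c _ = fun w => on_fin (child_cost c p.1 p.2 w) (location xi p.1 w + xi p.1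
  p.2 n w)); last first.
  by apply/funext => w; rewrite cost_cons.
apply: (@sub_left_case_measurable J k Jk c p.1 p.2 _ (subOmega J) id
   (fun w => location xi p.1 w + xi p.1 p.2 n w)) => //; first by rewrite pk.
apply: emeasurable_funD; first by apply: (sub_location_measurable Jk); rewrite pk.
exact: sub_xi_measurable.
Qed.

Lemma sub_total_mean_measurable_gen k u j p c : good_cost c ->
  size u = k -> size p.1 = k ->
  measurable_fun [set: subOmega [set p | p != (u, j)]] (total_mean c p).
Proof.
move=> gc uk pk; apply: (@sub_total_mean_measurable _ k) => //; last by rewrite pk.
by move=> p' pu /=; apply: contraTneq pu => ->; rewrite -leqNgt uk.
Qed.

(** One litter is averaged at a time. The factors of the other litters, averaged or not, do not
    depend on it and are absorbed in [Y], which is why [Y] is universally quantified in the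
    induction. *)
Lemma peel_finite k c n (Y : Omega -> \bar R) : good_cost c ->
  (forall u j, size u = k -> measurable_fun [set: subOmega [set p | p != (u, j)]] Y) ->
  (forall w, 0 <= Y w) ->
  \int[P]_w (Y w * lap (\sum_(m < n) enum_term (parents k) (litter_cost c ^~ w) m)) =
  \int[P]_w (Y w * lap (\sum_(m < n) enum_term (parents k) (total_mean c ^~ w) m)).
Proof.
move=> gc; elim: n Y => [|n IH] Y mY Y0; first by under eq_integral do rewrite big_ord0;
  under [RHS]eq_integral do rewrite big_ord0.
have l0 m w : 0 <= enum_term (parents k) (litter_cost c ^~ w) m.
  by apply: enum_term_ge0 => p; exact: litter_cost_ge0.
have t0 m w : 0 <= enum_term (parents k) (total_mean c ^~ w) m.
  by apply: enum_term_ge0 => p; exact: total_mean_ge0.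
have S0 f w : (forall m w, 0 <= enum_term (parents k) (f ^~ w) m) -> 0 <= \sum_(m < n)
  enum_term (parents k) (f ^~ w) m.
  by move=> f0; exact: sume_ge0.
under eq_integral do rewrite big_ord_recr lapD ?S0// muleA.
under [RHS]eq_integral do rewrite big_ord_recr lapD ?S0// [X in _ * X]muleC muleA.
rewrite -IH; last 2 first.
- move=> u j uk; apply: emeasurable_funM; first exact: mY.
  apply: (measurableT_comp measurable_lap).
  by apply: measurable_enum_term => p pk; exact: (@sub_total_mean_measurable_gen k).
- by move=> w; rewrite mule_ge0 ?lap_ge0.
rewrite /enum_term; case En: (pickle_inv n) => [p|]; last first.
  by under [RHS]eq_integral do rewrite -muleA [X in _ * X]muleC muleA.
case: (boolP (p \in parents k)) => [/set_mem|_]; last first.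
  by under [RHS]eq_integral do rewrite -muleA [X in _ * X]muleC muleA.
case: p En => u j En /= uk.
rewrite (@peel_one c u j); last first.
- by move=> w; rewrite mule_ge0 ?lap_ge0.
- apply: emeasurable_funM; first exact: mY.
  apply: (measurableT_comp measurable_lap); apply: emeasurable_sum => m.
  case Em: (pickle_inv m) => [p|]; last exact: measurable_cst.
  case: (boolP (p \in parents k)) => [/set_mem pk|_]; last exact: measurable_cst.
  apply: (@sub_litter_cost_measurable k) => //.
  (* Distinct codes are decoded to distinct litters. *)
  apply: contraTneq (ltn_ord m) => pE.
  have := @pickle_invK (label d * 'I_d)%type m; rewrite Em /= pE => <-.
  by have := @pickle_invK (label d * 'I_d)%type n; rewrite En /= => <-; rewrite ltnn.
- by [].
by apply: eq_integral => w _; rewrite -!muleA [X in _ * X]muleC.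
Qed.

Lemma peel_generation k c (Y : Omega -> \bar R) : good_cost c ->
  (forall u j, size u = k -> measurable_fun [set: subOmega [set p | p != (u, j)]] Y) ->
  measurable_fun setT Y ->
  (forall w, 0 <= Y w <= 1) ->
  \int[P]_w (Y w * lap (generation_cost k.+1 c w)) =
  \int[P]_w (Y w * lap (\esum_(p in parents k) total_mean c p w)).
Proof.
move=> gc mYs mY Y01.
have Y0 w : 0 <= Y w by have /andP[] := Y01 w.
have ml p : measurable_fun setT (litter_cost c p).
  apply: ge0_emeasurable_sum => [n w _ _|n _]; first exact: cost_ge0.
  exact: cost_measurable.
have l0 p w : 0 <= litter_cost c p w by exact: litter_cost_ge0.
have t0 p w : 0 <= total_mean c p w by exact: total_mean_ge0.
under eq_integral do rewrite generation_costS//.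
have cvL := cvg_integral_lap_esum (P := P) mY Y01 l0 (fun p (_ : parents k p) => ml p).
have cvR := cvg_integral_lap_esum (P := P) mY Y01 t0
  (fun p (_ : parents k p) => total_mean_measurable p gc).
rewrite (funext (fun n => peel_finite n gc mYs Y0)) in cvL.
exact: (cvg_unique (@ereal_hausdorff R) cvL cvR).
Qed.

Lemma immigrant_total_mean c j w : good_cost c ->
  total_mean c ([::], j) w =
  intensity_integral (cst (eta j)) (fun z => 1 - lap (c (z <= t)%R j z)).
Proof.
move=> gc; rewrite /total_mean/= /mean_cost/=; apply: eq_integral => z _.
by rewrite /child_cost add0r.
Qed.

(** The side [s] is passed on unchanged, since children inherit it from their parent; this is what
    keeps the two sides decoupled. *)
Definition next_cost c : bool -> 'I_d -> R -> \bar R := fun s i x =>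
  \esum_(j in [set: 'I_d]) intensity_integral (h i j) (fun z => 1 - lap (c s j (x + z)%R)).

Lemma next_cost_good c : good_cost c -> good_cost (next_cost c).
Proof.
move=> [mc c0]; have I0 s i j x : 0 <= intensity_integral (h i j) (fun z => 1 - lap (c s j (x
  + z)%R)).
  apply: integral_ge0 => z _; rewrite mule_ge0 ?lee_fin//.
  by rewrite sube_ge0 ?lap_fin_num// lap_le1.
split=> [s i|s i x]; last exact: esum_ge0.
apply: measurable_esum => // j _; apply: measurable_conv_lap => //.
by have /measurable_int/measurable_EFinP := h_integrable i j.
Qed.

Lemma total_mean_parents k c w : good_cost c ->
  \esum_(p in parents k.+1) total_mean c p w = generation_cost k.+1 (next_cost c) w.
Proof.
move=> gc; transitivity (\esum_(u in [set u : label d | size u = k.+1])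
    \esum_(j in [set: 'I_d]) total_mean c (u, j) w).
  rewrite esum_esum; last by move=> *; exact: total_mean_ge0.
  rewrite (_ : parents _ = [set u : label d | size u = k.+1] `*`` fun=> setT).
    by apply: eq_esum => -[].
  by apply/seteqP; split => -[u j] //= [].
apply: eq_esum => -[|[i n] u]//= uk.
rewrite /total_mean /mean_cost/=; case: (location xi u w + xi u i n w) => [x||]//=.
- by rewrite esum1.
- by rewrite esum1.
Qed.

Definition past_cost k c w := \sum_(i < k) generation_cost i c w.

Lemma generation_cost_ge0 k c w : good_cost c -> 0 <= generation_cost k c w.
Proof. by move=> gc; apply: esum_ge0 => u _; exact: cost_ge0. Qed.

Lemma past_cost_ge0 k c w : good_cost c -> 0 <= past_cost k c w.
Proof. by move=> gc; apply: sume_ge0 => i _; exact: generation_cost_ge0. Qed.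

Definition addc c c' : bool -> 'I_d -> R -> \bar R := fun s j x => c s j x + c' s j x.

Lemma addc_good c c' : good_cost c -> good_cost c' -> good_cost (addc c c').
Proof.
move=> [mc c0] [mc' c'0]; split=> [s j|s j x]; last exact: adde_ge0.
exact: emeasurable_funD.
Qed.

Lemma generation_cost_add k c c' w : good_cost c -> good_cost c' ->
  generation_cost k (addc c c') w = generation_cost k c w + generation_cost k c' w.
Proof.
move=> gc gc'; rewrite /generation_cost -esumD; last 2 first.
- by move=> *; exact: cost_ge0.
- by move=> *; exact: cost_ge0.
apply: eq_esum => -[|[j n] u] _ /=; first by rewrite adde0.
by case: (_ + _) => [x||]/=; rewrite ?adde0.
Qed.

Lemma sub_past_cost_measurable k u j c : good_cost c -> size u = k ->
  measurable_fun [set: subOmega [set p | p != (u, j)]] (past_cost k.+1 c).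
Proof.
move=> gc uk; apply: emeasurable_sum => i; apply: measurable_esum.
  by move=> v w; exact: cost_ge0.
move=> v /= vi; apply: (@sub_cost_measurable _ k) => //.
  by move=> p' pu /=; apply: contraTneq pu => ->; rewrite -leqNgt uk.
by rewrite vi -ltnS.
Qed.

(** The last generation has a cost of its own because it is the only one whose cost changes when a
    generation is integrated out. Generations are indexed by the size of the labels, so that
    immigrants have index 1. *)
Definition cluster_laplace k c c' :=
  \int[P]_w lap (past_cost k c w + generation_cost k c' w).

Lemma past_cost_measurable k c : good_cost c -> measurable_fun setT (past_cost k c).
Proof.
move=> gc; apply: emeasurable_sum => i; apply: measurable_esum.
  by move=> v w; exact: cost_ge0.
by move=> v /= vi; exact: cost_measurable.
Qed.

(* Integrating out the youngest generation turns its cost into the cost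
   [next_cost c'] borne by its parents. *)
Lemma peel k c c' : good_cost c -> good_cost c' ->
  cluster_laplace k.+2 c c' = cluster_laplace k.+1 c (addc c (next_cost c')).
Proof.
move=> gc gc'; rewrite /cluster_laplace.
have gn := next_cost_good gc'.
under eq_integral do rewrite lapD ?past_cost_ge0 ?generation_cost_ge0//.
rewrite peel_generation//; last 3 first.
- move=> u j uk; apply: (measurableT_comp measurable_lap).
  exact: sub_past_cost_measurable.
- by apply: (measurableT_comp measurable_lap); exact: past_cost_measurable.
- by move=> w; rewrite lap_ge0 lap_le1// past_cost_ge0.
apply: eq_integral => w _; rewrite total_mean_parents// generation_cost_add//.
rewrite -lapD ?past_cost_ge0 ?generation_cost_ge0//.
by rewrite /past_cost big_ord_recr/= addeA.
Qed.

Definition restrict_cost b c : bool -> 'I_d -> R -> \bar R :=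
  fun s j x => if s == b then c s j x else 0.

Lemma restrict_cost_good b c : good_cost c -> good_cost (restrict_cost b c).
Proof.
move=> [mc c0]; split=> [s j|s j x]; rewrite /restrict_cost.
  by case: (s == b) => //; exact: measurable_cst.
by case: ifP.
Qed.

Lemma next_cost_restrict b c :
  next_cost (restrict_cost b c) = restrict_cost b (next_cost c).
Proof.
apply/funext => s; apply/funext => i; apply/funext => x.
rewrite /next_cost /restrict_cost; case: ifP => // _.
rewrite esum1// => j _; apply: integral0_eq => z _.
by rewrite lap0 subee// mul0e.
Qed.

Lemma addc_restrict b c c' :
  addc (restrict_cost b c) (restrict_cost b c') = restrict_cost b (addc c c').
Proof.
apply/funext => s; apply/funext => i; apply/funext => x.
by rewrite /addc /restrict_cost; case: ifP => // _; rewrite adde0.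
Qed.

Definition immigrant_mean c :=
  \esum_(j in [set: 'I_d])
    intensity_integral (cst (eta j)) (fun z => 1 - lap (c (z <= t)%R j z)).

Lemma cluster_laplace1 c c' : good_cost c -> good_cost c' ->
  cluster_laplace 1 c c' = lap (immigrant_mean c').
Proof.
move=> gc gc'; rewrite /cluster_laplace.
transitivity (\int[P]_w (cst 1 w * lap (generation_cost 1 c' w))).
  apply: eq_integral => w _; rewrite /past_cost big_ord1 mul1e; congr lap.
  by rewrite [X in X + _]esum1 ?add0e// => -[].
rewrite (@peel_generation 0 c' (cst 1) gc'); first last.
- by move=> w; rewrite lee01 lexx.
- exact: measurable_cst.
- by move=> u j _; exact: measurable_cst.
transitivity (\int[P]_w cst (lap (immigrant_mean c')) w); last first.
  by rewrite integral_cst// [X in _ * X]probability_setT mule1.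
apply: eq_integral => w _; rewrite mul1e; congr lap.
rewrite /immigrant_mean (reindex_esum setT (parents 0) (fun j => ([::], j))).
  by apply: eq_esum => j _; exact: immigrant_total_mean.
split=> [j _|j j' _ _ []//|] //=.
by move=> [u j]; rewrite /parents/= => /size0nil ->; exists j.
Qed.

Lemma child_cost_nil_measurable c j : good_cost c ->
  measurable_fun setT (fun x : R => 1 - lap (c (x <= t)%R j x)).
Proof.
move=> gc; apply: emeasurable_funB => //.
apply: (measurableT_comp measurable_lap).
by have [] := child_cost_good [::] j point gc.
Qed.

Lemma immigrant_mean_ge0 c : good_cost c -> 0 <= immigrant_mean c.
Proof.
move=> [mc c0]; apply: esum_ge0 => j _; apply: integral_ge0 => z _.
by rewrite mule_ge0 ?lee_fin//= sube_ge0 ?lap_fin_num// lap_le1.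
Qed.

(** An immigrant at [z] is on the side of [z] with respect to [t], so that at each [z] one of the
    two restricted costs is 0 and contributes 1 - lap 0 = 0. The independence of the two sides
    originates here. *)
Lemma immigrant_mean_split c : good_cost c -> immigrant_mean c =
  immigrant_mean (restrict_cost true c) + immigrant_mean (restrict_cost false c).
Proof.
move=> gc; have c0 := gc.2.
have l0 x : 0 <= x -> 0 <= 1 - lap x :> \bar R.
  by move=> x0; rewrite sube_ge0 ?lap_fin_num// lap_le1.
have g b := restrict_cost_good b gc.
rewrite /immigrant_mean -esumD; last 2 first.
- by move=> j _; apply: integral_ge0 => z _; rewrite mule_ge0 ?lee_fin//= l0//; exact: (g
  true).2.
- by move=> j _; apply: integral_ge0 => z _; rewrite mule_ge0 ?lee_fin//= l0//; exact: (g
  false).2.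
apply: eq_esum => j _; rewrite /intensity_integral.
have mm b : measurable_fun setT (fun z : R =>
    (1 - lap (restrict_cost b c (z <= t)%R j z)) * (cst (eta j) z)%:E).
  apply: emeasurable_funM; first exact: child_cost_nil_measurable.
  exact: (measurable_cst (eta j)%:E).
have nn b z : 0 <= (1 - lap (restrict_cost b c (z <= t)%R j z)) * (cst (eta j) z)%:E.
  by rewrite mule_ge0 ?lee_fin//= l0//; exact: (g b).2.
rewrite -ge0_integralD; [|by []|by []|exact: mm|by []|exact: mm].
apply: eq_integral => z _; rewrite /restrict_cost.
have tf : (true == false) = false by []; have ft : (false == true) = false by [].
by case: (z <= t)%R; rewrite ?eqxx ?tf ?ft lap0 subee// mul0e ?adde0 ?add0e.
Qed.

(** Restriction to a side commutes with [next_cost] and [addc], so [peel] brings the factorization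
    down to the immigrants, where [immigrant_mean_split] and [lapD] give it. *)
Lemma cluster_laplace_split k c c' : good_cost c -> good_cost c' ->
  cluster_laplace k.+1 c c' =
  cluster_laplace k.+1 (restrict_cost true c) (restrict_cost true c') *
  cluster_laplace k.+1 (restrict_cost false c) (restrict_cost false c').
Proof.
move=> gc; elim: k c' => [|k IH] c' gc'.
  rewrite !cluster_laplace1//; try exact: restrict_cost_good.
  by rewrite immigrant_mean_split// lapD// immigrant_mean_ge0//; exact: restrict_cost_good.
have gn := next_cost_good gc'; have ga := addc_good gc gn.
have gr b := restrict_cost_good b gc; have gr' b := restrict_cost_good b gc'.
rewrite (peel k gc gc') (IH _ ga).
rewrite (peel k (gr true) (gr' true)) (peel k (gr false) (gr' false)).
by rewrite !next_cost_restrict !addc_restrict.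
Qed.

Definition total_cost c w := \esum_(u in [set: label d]) cost c u w.

Lemma total_cost_ge0 c w : good_cost c -> 0 <= total_cost c w.
Proof. by move=> gc; apply: esum_ge0 => u _; exact: cost_ge0. Qed.

Lemma measurable_total_cost c : good_cost c -> measurable_fun setT (total_cost c).
Proof.
move=> gc; apply: measurable_esum => [u w|u _]; first exact: cost_ge0.
exact: cost_measurable.
Qed.

Lemma cvg_cluster_laplace c : good_cost c ->
  cluster_laplace k.+1 c (fun _ _ _ => 0) @[k --> \oo] -->
  \int[P]_w lap (total_cost c w).
Proof.
move=> gc.
have -> : (fun k => cluster_laplace k.+1 c (fun _ _ _ => 0)) =
    fun k => \int[P]_w (cst 1 w * lap (past_cost k.+1 c w)).
  apply/funext => k; apply: eq_integral => w _; rewrite mul1e.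
  congr lap; rewrite [X in _ + X]esum1 ?adde0// => -[|[j n] u] _//=.
  by case: (_ + _).
have -> : \int[P]_w lap (total_cost c w) = \int[P]_w (cst 1 w * lap (total_cost c w)).
  by apply: eq_integral => w _; rewrite mul1e.
apply: cvg_integral_lap => //.
- by move=> w; rewrite lee01 lexx.
- by move=> n; exact: past_cost_measurable.
- by move=> n w; exact: past_cost_ge0.
- move=> w m n mn; rewrite /past_cost -!(big_mkord xpredT (fun i => generation_cost i c w)).
  by apply: lee_sum_nneg_natr => // i _ _; exact: generation_cost_ge0.
- move=> w; rewrite /total_cost.
  rewrite (_ : setT = \bigcup_i [set u : label d | size u = i]); last first.
    by apply/seteqP; split => // u _; exists (size u).
  rewrite nneseries_sum_bigcup; last 2 first.
  + by apply/trivIsetP => i j _ _ /eqP ij; apply/seteqP; split => // u [/= -> /ij].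
  + by move=> u; exact: cost_ge0.
  have cv : \sum_(0 <= i < n) generation_cost i c w @[n --> \oo] -->
      \sum_(i <oo) generation_cost i c w.
    by apply: is_cvg_nneseries => i _ _; exact: generation_cost_ge0.
  move: cv; rewrite -cvg_shiftS (_ : [sequence _]_n = fun n => past_cost n.+1 c w)//.
  by apply/funext => n; rewrite /= big_mkord.
Qed.

Lemma laplace_split c : good_cost c ->
  \int[P]_w lap (total_cost c w) =
  \int[P]_w lap (total_cost (restrict_cost true c) w) *
  \int[P]_w lap (total_cost (restrict_cost false c) w).
Proof.
move=> gc; apply: (cvg_unique (@ereal_hausdorff R) (cvg_cluster_laplace gc)).
have g0 : good_cost (fun _ _ _ => 0) by split=> // s j; exact: measurable_cst.
have r0 b : restrict_cost b (fun _ _ _ => 0) = fun _ _ _ => 0.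
  by apply/funext => s; apply/funext => i; apply/funext => x; rewrite /restrict_cost if_same.
have gr b := restrict_cost_good b gc.
rewrite (_ : (fun _ => _) = fun k =>
    cluster_laplace k.+1 (restrict_cost true c) (fun _ _ _ => 0) *
    cluster_laplace k.+1 (restrict_cost false c) (fun _ _ _ => 0)); last first.
  by apply/funext => k; rewrite (cluster_laplace_split k gc g0) !r0.
apply: cvgeM; [|exact: cvg_cluster_laplace (gr true)|exact: cvg_cluster_laplace (gr false)].
have mt b := measurable_total_cost (gr b); have t0 b w := total_cost_ge0 w (gr b).
apply: mule_def_fin.
  exact: integral_lap_fin_num (mt true) (t0 true).
exact: integral_lap_fin_num (mt false) (t0 false).
Qed.

End cluster.

Lemma cvg_natmule_pinfty (R : realType) (e : \bar R) : (0 < e)%E ->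
  (n.+1%:R%:E * e)%E @[n --> \oo] --> +oo%E.
Proof.
case: e => [r|_|//]; last first.
  by under eq_fun do rewrite gt0_muley ?lte_fin//; exact: cvg_cst.
rewrite lte_fin => r0; apply/cvgeyPge => A; near=> n.
rewrite -EFinM lee_fin -ler_pdivrMr//; apply: (@le_trans _ _ n%:R).
  by near: n; exact: nbhs_infty_ger.
by rewrite ler_nat.
Unshelve. all: end_near.
Qed.

(** * From Laplace functionals to events about counts *)

Section laplace_to_counts.
Local Open Scope ereal_scope.
Context d (T : measurableType d) {R : realType} (P : probability T R).
Context (V : T -> \bar R).
Hypotheses (mV : measurable_fun setT V) (V01 : forall w, 0 <= V w <= 1).

Let V0 w : 0 <= V w. Proof. by have /andP[] := V01 w. Qed.

Definition unit_rv (Y : T -> \bar R) :=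
  measurable_fun setT Y /\ forall w, 0 <= Y w <= 1.

Definition uncorrelated (Y : T -> \bar R) :=
  \int[P]_w (Y w * V w) = (\int[P]_w Y w) * \int[P]_w V w.

Lemma unit_rvM Y Z : unit_rv Y -> unit_rv Z -> unit_rv (fun w => Y w * Z w).
Proof.
move=> [mY Y01] [mZ Z01]; split=> [|w]; first exact: emeasurable_funM.
have /andP[Y0 Y1] := Y01 w; have /andP[Z0 Z1] := Z01 w.
by rewrite mule_ge0//= (le_trans (lee_pmul _ _ Y1 Z1))// mule1.
Qed.

Lemma uncorrelated_cancel Y1 Y2 : unit_rv Y1 -> unit_rv Y2 ->
  uncorrelated Y1 -> uncorrelated (fun w => Y1 w + Y2 w) -> uncorrelated Y2.
Proof.
move=> [mY1 Y101] [mY2 Y201]; rewrite /uncorrelated => u1.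
have Y10 w : 0 <= Y1 w by have /andP[] := Y101 w.
have Y20 w : 0 <= Y2 w by have /andP[] := Y201 w.
under eq_integral do rewrite ge0_muleDl//.
rewrite ge0_integralD//; last 4 first.
- by move=> w _; exact: mule_ge0.
- exact: emeasurable_funM.
- by move=> w _; exact: mule_ge0.
- exact: emeasurable_funM.
rewrite ge0_integralD// u1.
have f1 : \int[P]_w Y1 w \is a fin_num by exact: integral_le1_fin_num.
have fV : \int[P]_w V w \is a fin_num by exact: integral_le1_fin_num.
have i1 : 0 <= \int[P]_w Y1 w by exact: integral_ge0.
have i2 : 0 <= \int[P]_w Y2 w by exact: integral_ge0.
move: (\int[P]_w Y1 w) (\int[P]_w Y2 w) (\int[P]_w V w) f1 fV i1 i2 => a b v fa fv a0 b0.
rewrite ge0_muleDl//; have fav : a * v \is a fin_num by rewrite fin_numM.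
case: (a * v) fav => // r _; case: (\int[P]_x (Y2 x * V x)) (b * v) => [x||] [y||]//=.
by move=> [/addrI ->].
Qed.

Lemma uncorrelatedZ (r : R) Y : (0 <= r)%R -> unit_rv Y ->
  uncorrelated Y -> uncorrelated (fun w => r%:E * Y w).
Proof.
move=> r0 [mY Y01]; rewrite /uncorrelated => u1.
have Y0 w : 0 <= Y w by have /andP[] := Y01 w.
under eq_integral do rewrite -muleA.
rewrite ge0_integralZl//; last 2 first.
- exact: emeasurable_funM.
- by move=> w _; exact: mule_ge0.
by rewrite ge0_integralZl// u1 muleA.
Qed.

Lemma uncorrelated_sum (I : Type) (s : seq I) (Y : I -> T -> \bar R) :
  (forall i, measurable_fun setT (Y i)) -> (forall i w, 0 <= Y i w) ->
  (forall i, uncorrelated (Y i)) -> uncorrelated (fun w => \sum_(i <- s) Y i w).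
Proof.
move=> mY Y0 uY; rewrite /uncorrelated.
under eq_integral do rewrite ge0_sume_distrl//.
rewrite ge0_integral_sum//; last 2 first.
- by move=> i; exact: emeasurable_funM.
- by move=> i w _; exact: mule_ge0.
rewrite ge0_integral_sum// ge0_sume_distrl; last by move=> i _; exact: integral_ge0.
by apply: eq_bigr => i _; exact: uY.
Qed.

Lemma uncorrelated_lim Y (u : nat -> T -> \bar R) (l : T -> \bar R) :
  unit_rv Y -> (forall n, measurable_fun setT (u n)) ->
  (forall n w, 0 <= u n w) -> (forall w, nondecreasing_seq (u ^~ w)) ->
  (forall w, u n w @[n --> \oo] --> l w) ->
  (forall n, uncorrelated (fun w => Y w * lap (u n w))) ->
  uncorrelated (fun w => Y w * lap (l w)).
Proof.
move=> uY mu u0 ndu ul un; have [mY Y01] := uY.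
have [mYV YV01] := unit_rvM uY (conj mV V01).
rewrite /uncorrelated.
have cY := cvg_integral_lap (P := P) mY Y01 mu u0 ndu ul.
have cYV := cvg_integral_lap (P := P) mYV YV01 mu u0 ndu ul.
have eYV f : \int[P]_w (Y w * V w * lap (f w)) = \int[P]_w (Y w * lap (f w) * V w).
  by apply: eq_integral => w _; rewrite muleAC.
rewrite eYV in cYV; apply: (cvg_unique _ cYV) => //.
rewrite (_ : (fun _ => _) = fun n => (\int[P]_w (Y w * lap (u n w))) * \int[P]_w V w).
  by apply: cvgeZr => //; exact: integral_le1_fin_num.
by apply/funext => n; rewrite eYV un.
Qed.

Lemma eq_uncorrelated Y Z : Y =1 Z -> uncorrelated Y -> uncorrelated Z.
Proof. by move=> /funext ->. Qed.

Section counts.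
(** [S] consists of costs whose Laplace factors are already known to be uncorrelated with [V]; it is
    stable under adding multiples of the counts in [C]. Large multiples isolate the values of the
    counts. *)
Context (S : set (T -> \bar R)) (C : set (T -> \bar R)).
Hypothesis S_rv : forall s, S s -> measurable_fun setT s /\ forall w, 0 <= s w.
Hypothesis S0 : S (fun=> 0).
Hypothesis C_rv : forall N, C N -> measurable_fun setT N /\
  forall w, N w = +oo \/ exists m, N w = m%:R%:E.
Hypothesis S_closed : forall s N n, S s -> C N -> S (fun w => s w + n%:R%:E * N w).
Hypothesis S_uncorrelated : forall s, S s -> uncorrelated (fun w => lap (s w)).

Let count_is (N : T -> \bar R) m w : \bar R := (N w == m%:R%:E)%:R%:E.
Let count_ge (N : T -> \bar R) m w : \bar R := (m%:R%:E <= N w)%E%:R%:E.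
Let excess (N : T -> \bar R) m w : \bar R := Order.max (N w - m%:R%:E) 0.

Let unit_rv_bool (b : T -> bool) : measurable_fun setT b ->
  unit_rv (fun w => (b w)%:R%:E).
Proof.
move=> mb; split=> [|w]; last by rewrite !lee_fin ler0n lern1 leq_b1.
rewrite (_ : (fun _ => _) = fun w => if b w then 1 else 0).
  by apply: measurable_fun_ifT.
by apply/funext => w; case: (b w).
Qed.

(* As n goes to infinity the last term isolates the event [N w = m] and all the terms
   of smaller index are already known to be uncorrelated with [V]. *)
Let lap_count N m n w : N w = +oo \/ (exists k, N w = k%:R%:E) -> (0 < n)%N ->
  lap (n%:R%:E * N w) =
  \sum_(k < m) (expR (- (n * k)%:R))%:E * count_is N k w +
  (expR (- (n * m)%:R))%:E * (count_ge N m w * lap (n%:R%:E * excess N m w)).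
Proof.
rewrite /count_is /count_ge /excess => -[->|[k ->]] n0.
  rewrite gt0_muley ?lte_fin ?ltr0n// big1 ?add0e; last by move=> i _; rewrite mule0.
  by rewrite lapy !mule0.
have [km|mk] := ltnP k m.
  rewrite [X in _ + _ * (X * _)](_ : _ = 0) ?mul0e ?mule0 ?adde0; last first.
    by rewrite lee_fin ler_nat leqNgt km.
  rewrite (bigD1 (Ordinal km))//= eqxx mule1 big1 ?adde0.
    by rewrite /lap/= natrM.
  move=> i ik; rewrite eqe eqr_nat (_ : (k == i :> nat) = false) ?mule0//.
  by apply/negbTE; rewrite eq_sym; exact: ik.
rewrite big1 ?add0e => [|i _]; last first.
  by rewrite eqe eqr_nat gtn_eqF ?mule0// (leq_trans (ltn_ord i)).
rewrite lee_fin ler_nat mk mul1e -EFinB -natrB// max_l ?lee_fin//.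
by rewrite /lap/= -EFinM -expRD -opprD -!natrM -natrD -mulnDr subnKC.
Qed.

(** Strong induction on [m]. Subtracting the terms of index below [m] from [lap_count] and rescaling
    leaves the remainder, which is therefore uncorrelated with [V], and so is its limit. [W] holds
    the count events treated before. *)
Lemma uncorrelated_count_step W N m : unit_rv W -> C N ->
  (forall s, S s -> uncorrelated (fun w => W w * lap (s w))) ->
  forall s, S s -> uncorrelated (fun w => W w * (N w == m%:R%:E)%:R%:E * lap (s w)).
Proof.
move=> uW CN Ws.
have [mN Nv] := C_rv CN.
have mis k : measurable_fun setT (fun w => N w == k%:R%:E).
  apply: (measurable_fun_bool true); rewrite setTI.
  rewrite (_ : _ @^-1` _ = N @^-1` [set k%:R%:E]).
    by rewrite -[_ @^-1` _]setTI; exact: mN.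
  by apply/seteqP; split => w /= /eqP.
have mge k : measurable_fun setT (fun w => k%:R%:E <= N w).
  apply: (measurable_fun_bool true); rewrite setTI.
  rewrite (_ : _ @^-1` _ = N @^-1` `[k%:R%:E, +oo]%classic).
    by rewrite -[_ @^-1` _]setTI; apply: mN => //; exact: emeasurable_itv.
  by apply/seteqP; split => w /=; rewrite in_itv/= leey andbT.
have uis k := unit_rv_bool (mis k); have uge k := unit_rv_bool (mge k).
have mex k : measurable_fun setT (excess N k).
  by apply: measurable_maxe => //; exact: emeasurable_funB.
have ex0 k w : 0 <= excess N k w by rewrite le_max lexx orbT.
have ul s : S s -> unit_rv (fun w => lap (s w)).
  move=> /S_rv[ms s0]; split=> [|w]; last by rewrite lap_ge0 lap_le1.
  by apply: measurableT_comp ms; exact: measurable_lap.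
elim/ltn_ind: m => m IH s Ss.
have uY : unit_rv (fun w => W w * lap (s w) * count_ge N m w).
  exact: unit_rvM (unit_rvM uW (ul _ Ss)) (uge m).
have [ms s0] := S_rv Ss.
have key n : uncorrelated (fun w => W w * lap (s w) * count_ge N m w *
    lap (n.+1%:R%:E * excess N m w)).
  have Ssn := S_closed n.+1 Ss CN.
  pose Z w := W w * lap (s w) * count_ge N m w * lap (n.+1%:R%:E * excess N m w).
  pose Y1 w := \sum_(k < m) (expR (- (n.+1 * k)%:R))%:E * (W w * count_is N k w * lap (s w)).
  pose Y2 w := (expR (- (n.+1 * m)%:R))%:E * Z w.
  have uZ : unit_rv Z.
    apply: unit_rvM uY _; split=> [|w].
      by apply: (measurableT_comp measurable_lap); exact: measurable_funeM.
    by rewrite lap_ge0 lap_le1// mule_ge0// lee_fin.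
  have uI k : unit_rv (fun w => W w * count_is N k w * lap (s w)).
    exact: unit_rvM (unit_rvM uW (uis k)) (ul _ Ss).
  have uU := unit_rvM uW (ul _ Ssn).
  have Nw0 w : 0 <= n.+1%:R%:E * N w.
    apply: mule_ge0; first by rewrite lee_fin.
    by case: (Nv w) => [->|[k ->]]; rewrite ?leey ?lee_fin.
  have UE w : W w * lap (s w + n.+1%:R%:E * N w) = Y1 w + Y2 w.
    rewrite lapD// (lap_count m (Nv w))// muleA.
    rewrite ge0_muleDr; last 2 first.
    - by apply: sume_ge0 => k _; rewrite mule_ge0 ?lee_fin ?expR_ge0.
    - by rewrite !mule_ge0 ?lap_ge0 ?lee_fin ?expR_ge0.
    congr (_ + _).
      rewrite ge0_sume_distrr; last by move=> k _; rewrite mule_ge0 ?lee_fin ?expR_ge0.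
      by apply: eq_bigr => k _; rewrite muleCA muleAC.
    by rewrite /Y2 /Z muleCA !muleA.
  have Z0 w : 0 <= Z w by have /andP[] := uZ.2 w.
  have Y10 w : 0 <= Y1 w.
    apply: sume_ge0 => k _; rewrite mule_ge0 ?lee_fin ?expR_ge0//.
    by have /andP[] := (uI k).2 w.
  have Y20 w : 0 <= Y2 w by rewrite mule_ge0 ?lee_fin ?expR_ge0.
  have uY2 : unit_rv Y2.
    split=> [|w]; first by apply: measurable_funeM; exact: uZ.1.
    rewrite Y20 (le_trans _ (proj2 (andP (uU.2 w))))// UE; exact: leeDr.
  have uY1 : unit_rv Y1.
    split=> [|w].
      by apply: emeasurable_sum => k; apply: measurable_funeM; exact: (uI k).1.
    rewrite Y10 (le_trans _ (proj2 (andP (uU.2 w))))// UE; exact: leeDl.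
  have uncY2 : uncorrelated Y2.
    apply: (uncorrelated_cancel uY1) => //.
      apply: uncorrelated_sum => [k|k w|k].
      - by apply: measurable_funeM; exact: (uI k).1.
      - by rewrite mule_ge0 ?lee_fin ?expR_ge0//; have /andP[] := (uI k).2 w.
      - by apply: uncorrelatedZ; [exact: expR_ge0|exact: uI|exact: IH].
    by apply: eq_uncorrelated (Ws _ Ssn) => w; exact: UE.
  apply: eq_uncorrelated (uncorrelatedZ (expR_ge0 (n.+1 * m)%:R) uY2 uncY2) => w.
  by rewrite /Y2 muleA -EFinM -expRD subrr expR0 mul1e.
have mu n : measurable_fun setT (fun w => n.+1%:R%:E * excess N m w).
  exact: measurable_funeM.
have u0 n w : 0 <= n.+1%:R%:E * excess N m w by rewrite mule_ge0// lee_fin.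
have ndu w : nondecreasing_seq (fun n => n.+1%:R%:E * excess N m w).
  by move=> n n' nn'; rewrite lee_wpmul2r// lee_fin ler_nat.
(* [lap] of this limit is the indicator of N <= m; the factor [count_ge] reduces it to N = m. *)
pose l w : \bar R := if excess N m w == 0 then 0 else +oo.
have ul' w : n.+1%:R%:E * excess N m w @[n --> \oo] --> l w.
  rewrite /l; case: ifPn => [/eqP ->|e0].
    by under eq_fun do rewrite mule0; exact: cvg_cst.
  by apply: cvg_natmule_pinfty; rewrite lt0e e0 ex0.
apply: eq_uncorrelated (uncorrelated_lim uY mu u0 ndu ul' key) => w.
rewrite /l /excess /count_ge; case: (Nv w) => [->|[k ->]].
  have -> : Order.max (+oo - m%:R%:E) 0 == 0 :> \bar R = false.
    by rewrite addye// max_l ?leey.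
  by rewrite lapy !mule0 mul0e.
have [km|mk|->] := ltngtP k m.
- by rewrite lee_fin ler_nat leqNgt km eqe eqr_nat ltn_eqF// !mule0 !mul0e.
- rewrite eqe eqr_nat gtn_eqF// mule0 mul0e -EFinB -natrB ?(ltnW mk)// max_l ?lee_fin//.
  by rewrite eqe pnatr_eq0 subn_eq0 leqNgt mk lapy mule0.
- by rewrite subee// maxxx lexx !eqxx lap0 !mule1.
Qed.

(** Finite intersections of events fixing the value of a count: a pi-system, built by adding one
    count at a time as [uncorrelated_count_step] does. *)
Inductive count_event : set T -> Prop :=
| count_eventT : count_event setT
| count_eventI N m A : C N -> count_event A ->
    count_event (A `&` [set w | N w = m%:R%:E]).

Lemma count_event_setI : setI_closed count_event.
Proof.
move=> A B cA; elim=> [|N m B' CN cB' IH]; first by rewrite setIT.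
by rewrite setIA; exact: count_eventI.
Qed.

Lemma count_event_measurable : count_event `<=` measurable.
Proof.
move=> A; elim=> [//|N m B CN _ mB]; apply: measurableI => //.
have [mN _] := C_rv CN.
by rewrite -[X in measurable X]setTI; exact: (mN measurableT [set m%:R%:E]).
Qed.

Lemma count_event_uncorrelated A : count_event A ->
  \int[P]_(w in A) V w = P A * \int[P]_w V w.
Proof.
move=> cA; have mA := count_event_measurable cA.
(* The factor [lap] of an arbitrary member of [S] is kept for the induction; the member 0 gives the
   claim. *)
suff [_ W] : unit_rv (fun w => (\1_A w)%:E) /\
    forall s, S s -> uncorrelated (fun w => (\1_A w)%:E * lap (s w)).
  have := W _ S0; rewrite /uncorrelated.
  under eq_integral do rewrite lap0 mule1.
  under [X in _ = X * _]eq_integral do rewrite lap0 mule1.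
  rewrite integral_indic// setIT => <-; rewrite [LHS]integral_mkcond.
  apply: eq_integral => w _; rewrite patchE indicE.
  by case: ifP; rewrite ?mul1e ?mul0e.
elim: cA {mA} => [|N m B CN cB [uB IH]].
  split=> [|s Ss].
    split=> [|w]; last by rewrite indicT/= lee01 lexx.
    by rewrite indicT; exact: (measurable_cst 1).
  by apply: eq_uncorrelated (S_uncorrelated Ss) => w; rewrite indicT mul1e.
have mN := count_event_measurable (count_eventI m CN cB).
split.
  split=> [|w]; first exact/measurable_EFinP/measurable_indic.
  by rewrite !lee_fin indicE ler0n lern1 leq_b1.
move=> s Ss; apply: eq_uncorrelated (uncorrelated_count_step m uB CN IH Ss) => w.
congr (_ * _); rewrite !indicE -EFinM -natrM mulnb in_setI; congr (nat_of_bool (_ && _))%:R%:E.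
by apply/eqP/idP => [Nw|/set_mem//]; exact/mem_set.
Qed.

End counts.

End laplace_to_counts.

(** * Independence of the left and the right counts *)

Section sides.
Local Open Scope ereal_scope.
Context {R : realType} {d : nat} {disp : measure_display}
  {Omega : measurableType disp} (P : probability Omega R).
Context (eta : 'I_d -> R) (h : 'I_d -> 'I_d -> R -> R).
Context (xi : label d -> 'I_d -> nat -> Omega -> \bar R).
Hypothesis eta_ge0 : forall j, (0 <= eta j)%R.
Hypothesis h_ge0 : forall i j x, (0 <= h i j x)%R.
Hypothesis h_integrable : forall i j,
  lebesgue_measure.-integrable [set: R] (EFin \o h i j).
Hypothesis xi_poisson :
  forall u j, poisson_process P (offspring_intensity eta h u j) (xi u j).
Hypothesis xi_indep : mutually_independent P
  (fun uj : label d * 'I_d => sigma_sequence (xi uj.1 uj.2)).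
Context (t : R).

Implicit Types f g : 'I_d -> R -> \bar R.

Definition sided_cost b f : bool -> 'I_d -> R -> \bar R :=
  fun s j x => if s == b then f j x else 0.

Definition good_side_cost f :=
  (forall j, measurable_fun setT (f j)) /\ (forall j x, 0 <= f j x).

Lemma sided_cost_good b f : good_side_cost f -> good_cost (sided_cost b f).
Proof.
move=> [mf f0]; split=> [s j|s j x]; rewrite /sided_cost.
  by case: (s == b) => //; exact: measurable_cst.
by case: ifP.
Qed.

Definition side_total b f w := total_cost xi t (sided_cost b f) w.

Lemma side_total_ge0 b f w : good_side_cost f -> 0 <= side_total b f w.
Proof. by move=> gf; apply: total_cost_ge0; exact: sided_cost_good. Qed.

Lemma measurable_side_total b f : good_side_cost f ->
  measurable_fun setT (side_total b f).
Proof.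
by move=> gf; apply: (measurable_total_cost xi_poisson); exact: sided_cost_good.
Qed.

Lemma total_cost_add c c' w : good_cost c -> good_cost c' ->
  total_cost xi t (addc c c') w = total_cost xi t c w + total_cost xi t c' w.
Proof.
move=> gc gc'; rewrite /total_cost -esumD; last 2 first.
- by move=> *; exact: cost_ge0.
- by move=> *; exact: cost_ge0.
apply: eq_esum => -[|[j n] u] _ /=; first by rewrite adde0.
by case: (_ + _) => [x||]/=; rewrite ?adde0.
Qed.

Lemma side_total_add b f g w : good_side_cost f -> good_side_cost g ->
  side_total b (fun j x => f j x + g j x) w = side_total b f w + side_total b g w.
Proof.
move=> gf gg; rewrite /side_total -total_cost_add; try exact: sided_cost_good.
congr (total_cost xi t _ w).
apply/funext => s; apply/funext => j; apply/funext => x.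
by rewrite /sided_cost /addc; case: ifP; rewrite ?adde0.
Qed.

Lemma side_total_uncorrelated b f g : good_side_cost f -> good_side_cost g ->
  uncorrelated P (fun w => lap (side_total (~~ b) g w)) (fun w => lap (side_total b f w)).
Proof.
wlog : b f g / b.
  move=> H; case: b => gf gg; first exact: H.
  rewrite /uncorrelated; under eq_integral do rewrite muleC.
  by rewrite [RHS]muleC; exact: (H true g f).
move=> -> gf gg /=; rewrite /uncorrelated.
pose c (s : bool) (j : 'I_d) (x : R) := if s then f j x else g j x.
have gc : good_cost c.
  split=> [s j|s j x]; first by case: s; [exact: gf.1|exact: gg.1].
  by rewrite /c; case: ifP => _; [exact: gf.2|exact: gg.2].
have := laplace_split eta_ge0 h_ge0 h_integrable xi_poisson xi_indep t gc.
have -> : restrict_cost true c = sided_cost true f.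
  by apply/funext => -[]; apply/funext => j; apply/funext => x.
have -> : restrict_cost false c = sided_cost false g.
  by apply/funext => -[]; apply/funext => j; apply/funext => x.
move=> <-; apply: eq_integral => w _.
rewrite -lapD ?side_total_ge0// -total_cost_add; try exact: sided_cost_good.
congr (lap (total_cost xi t _ w)).
apply/funext => s; apply/funext => j; apply/funext => x.
by rewrite /addc /c /sided_cost; case: s; rewrite /= ?adde0 ?add0e.
Qed.

Definition side_count b j (B : set R) (w : Omega) : \bar R :=
  counting [set u | [/\ has_type j u, left_side xi t u w = b &
                        exists2 x, B x & location xi u w = x%:E]].

Let indic_cost j (B : set R) : 'I_d -> R -> \bar R :=
  fun i x => if i == j then (\1_B x)%:E else 0.

Let indic_cost_good j B : measurable B -> good_side_cost (indic_cost j B).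
Proof.
move=> mB; split=> [i|i x]; rewrite /indic_cost.
  case: (i == j); last exact: measurable_cst.
  exact/measurable_EFinP/measurable_indic.
by case: ifP; rewrite // lee_fin.
Qed.

Lemma side_countE b j B w : side_count b j B w = side_total b (indic_cost j B) w.
Proof.
rewrite /side_count counting_esum esum_mkcond; apply: eq_esum => u _.
case: ifPn => [/set_mem[]|/negP nu].
  case: u => [//|[i n] u] /= /eqP -> su [x Bx ux].
  by rewrite ux /= /sided_cost su eqxx /indic_cost eqxx indicE mem_set.
case: u nu => [//|[i n] u] nu /=.
case ux : (location xi u w + xi u i n w) => [x||]//=.
rewrite /sided_cost; case: eqP => // su; rewrite /indic_cost; case: eqP => // ij.
rewrite indicE memNset// => Bx; apply: nu; apply/mem_set; split => //=.
  exact/eqP.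
by exists x.
Qed.

Definition side_totals b : set (Omega -> \bar R) :=
  [set side_total b f | f in good_side_cost].

Definition side_counts b : set (Omega -> \bar R) :=
  [set N | exists j B, measurable B /\ N = side_count b j B].

Lemma side_totals_rv b s : side_totals b s ->
  measurable_fun setT s /\ forall w, 0 <= s w.
Proof.
move=> [f gf <-]; split=> [|w]; first exact: measurable_side_total.
exact: side_total_ge0.
Qed.

Lemma side_totals0 b : side_totals b (fun=> 0).
Proof.
exists (fun _ _ => 0); first by split=> // j; exact: measurable_cst.
apply/funext => w; rewrite /side_total /total_cost esum1// => -[|[j n] u] _//=.
by rewrite /sided_cost if_same; case: (_ + _).
Qed.

Lemma side_counts_rv b N : side_counts b N ->
  measurable_fun setT N /\ forall w, N w = +oo \/ exists m, N w = m%:R%:E.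
Proof.
move=> [j [B [mB ->]]]; split=> [|w].
  rewrite (_ : side_count b j B = side_total b (indic_cost j B)).
    exact/measurable_side_total/indic_cost_good.
  by apply/funext => w; exact: side_countE.
by rewrite /side_count /counting; case: ifPn => _; [right; eexists|left].
Qed.

Lemma side_totals_closed b s N n : side_totals b s -> side_counts b N ->
  side_totals b (fun w => s w + n%:R%:E * N w).
Proof.
move=> ss [j [B [mB ->]]]; elim: n => [|n [f gf fE]].
  by rewrite (_ : (fun _ => _) = s)//; apply/funext => w; rewrite mul0e adde0.
exists (fun i x => f i x + indic_cost j B i x).
  have gi := indic_cost_good j mB; split=> [i|i x]; last exact: adde_ge0 (gf.2 _ _) (gi.2 _ _).
  by apply: emeasurable_funD; [exact: gf.1|exact: gi.1].
apply/funext => w; rewrite side_total_add//; last exact: indic_cost_good.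
rewrite -side_countE fE -addeA; congr (_ + _).
by rewrite -natr1 EFinD ge0_muleDl ?mul1e// lee_fin.
Qed.

(** [count_event_uncorrelated] is used twice. First [V] is a Laplace factor of the right side and
    the events are left ones; then [V] is the indicator of a left event, and the first use supplies
    the hypothesis needed for the right events. *)
Lemma side_counts_indep :
  indep_sets P <<s count_event (side_counts true) >> <<s count_event (side_counts false) >>.
Proof.
have m b := count_event_measurable (@side_counts_rv b).
apply: indep_sets_sigma => //; try exact: count_event_setI.
move=> A B cA cB.
have mA := m _ _ cA; have mB := m _ _ cB.
have step1 g : good_side_cost g ->
    uncorrelated P (fun w => (\1_A w)%:E) (fun w => lap (side_total false g w)).
  move=> gg; have mV : measurable_fun setT (fun w => lap (side_total false g w)).
    by apply: measurableT_comp (measurable_side_total false gg); exact: measurable_lap.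
  have V01 w : 0 <= lap (side_total false g w) <= 1.
    by rewrite lap_ge0 lap_le1// side_total_ge0.
  have SV s : side_totals true s ->
      uncorrelated P (fun w => lap (side_total false g w)) (fun w => lap (s w)).
    by move=> [f gf <-]; exact: (@side_total_uncorrelated true f g gf gg).
  have := count_event_uncorrelated mV V01 (@side_totals_rv true) (@side_totals0 true)
    (@side_counts_rv true) (@side_totals_closed true) SV cA.
  rewrite /uncorrelated integral_indic// setIT [RHS]muleC => <-.
  rewrite [RHS]integral_mkcond; apply: eq_integral => w _.
  by rewrite patchE indicE; case: ifP; rewrite ?mule1 ?mule0.
have mV : measurable_fun setT (fun w => (\1_A w)%:E : \bar R).
  exact/measurable_EFinP/measurable_indic.
have V01 w : 0 <= ((\1_A w)%:E : \bar R) <= 1.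
  by rewrite !lee_fin indicE ler0n lern1 leq_b1.
have SV s : side_totals false s -> uncorrelated P (fun w => (\1_A w)%:E) (fun w => lap (s w)).
  by move=> [f gf <-]; exact: step1.
have := count_event_uncorrelated mV V01 (@side_totals_rv false) (@side_totals0 false)
  (@side_counts_rv false) (@side_totals_closed false) SV cB.
by rewrite !integral_indic// setIT muleC => <-.
Qed.

End sides.

(** * Contraction of a power weight by the reproduction kernel *)

Lemma normc_ge0 (R : rcfType) (z : R[i]) : 0 <= Normc.normc z.
Proof. by case: z => a b; exact: sqrtr_ge0. Qed.

(** * A positive vector from the spectral radius condition *)

Section positive_resolvent.
Context {R : realType} {d : nat} (M : 'M[R]_d).
Hypothesis M_ge0 : forall i j, 0 <= M i j.
Hypothesis M_radius : spectral_radius M < 1.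

Lemma real_eigenvalue_lt1 (a : R) : eigenvalue M a -> a < 1.
Proof.
move=> Ma; pose Mc := map_mx (real_complex R) M.
have Mca : eigenvalue Mc (real_complex R a).
  move/eigenvalueP : Ma => [u uM u0]; apply/eigenvalueP.
  exists (map_mx (real_complex R) u); last by rewrite map_mx_eq0.
  by rewrite -map_mxM uM map_mxZ.
apply: le_lt_trans M_radius; apply: (@le_trans _ _ (Normc.normc (real_complex R a))).
  by rewrite /= expr0n addr0 sqrtr_sqr ler_norm.
apply: ub_le_sup; last by exists (real_complex R a).
(* [sup] dominates a set only if the set is bounded; here the sum of the moduli of the roots of the
   characteristic polynomial is a bound. *)
have [rs rsE] := closed_field_poly_normal (char_poly Mc).
exists (\sum_(r <- rs) Normc.normc r) => _ [z zM <-].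
have : z \in rs.
  move: zM; rewrite /= eigenvalue_root_char rsE.
  by rewrite (monicP (char_poly_monic _)) scale1r root_prod_XsubC.
elim: rs {rsE} => [//|r rs IH].
rewrite inE big_cons => /predU1P[<-|/IH zr].
  by rewrite lerDl; apply: sumr_ge0 => ? _; exact: normc_ge0.
by rewrite (le_trans zr)// lerDr normc_ge0.
Qed.

(** A nonzero row with u = x u M would make 1 / x a real eigenvalue that is at least 1. *)
Lemma unit_resolvent (x : R) : 0 <= x <= 1 -> 1%:M - x *: M \in unitmx.
Proof.
move=> /andP[x0 x1]; rewrite -row_free_unit -kermx_eq0; apply/eqP/row_matrixP => i.
rewrite row0; set u := row i _.
have uM : u = x *: (u *m M).
  have : u *m (1%:M - x *: M) = 0 by apply/eqP; rewrite -sub_kermx row_sub.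
  by rewrite mulmxBr mulmx1 -scalemxAr => /eqP; rewrite subr_eq0 => /eqP.
apply/eqP; apply/negPn/negP => u0.
have xN0 : x != 0 by apply: contra_neq u0 => x00; rewrite uM x00 scale0r.
have : eigenvalue M x^-1.
  by apply/eigenvalueP; exists u => //; rewrite {2}uM scalerA mulVf// scale1r.
by move=> /real_eigenvalue_lt1; rewrite invf_lt1 ?lt0r ?xN0// ltNge x1.
Qed.

(** By Cramer's rule, the value at x of q_i / p is the i-th entry of (1 - x M)^-1 applied to the
    all-ones vector. As polynomials in x, [p] and [q] can be followed from x = 0, where they are 1,
    to x = 1. *)
Let A : 'M[{poly R}]_d := 1%:M - 'X *: map_mx polyC M.
Let p : {poly R} := \det A.
Let q i : {poly R} := \sum_j (\adj A) i j.

(** Row sums of the identity stating that [A] times its adjugate is its determinant times 1. *)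
Let qE i (x : R) : (q i).[x] = p.[x] + x * \sum_k M i k * (q k).[x].
Proof.
have E : q i - 'X * \sum_k (M i k)%:P * q k = p.
  transitivity (\sum_j (A *m \adj A) i j); last first.
    rewrite mul_mx_adj (bigD1 i)//= mxE eqxx mulr1n big1 ?addr0// => j ji.
    by rewrite mxE eq_sym (negbTE ji).
  under [RHS]eq_bigr do rewrite mxE; rewrite exchange_big/=.
  under [RHS]eq_bigr => k _ do rewrite -mulr_sumr -/(q k).
  rewrite mulr_sumr (bigD1 i)//= [RHS](bigD1 i)//= !mxE eqxx mulr1n mulrBl mul1r opprD addrA
    mulrA; congr (_ + _).
  rewrite -sumrN; apply: eq_bigr => k ki; rewrite !mxE eq_sym (negbTE ki).
  by rewrite mulr0n sub0r mulNr mulrA.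
have hs : (\sum_k (M i k)%:P * q k).[x] = \sum_k M i k * (q k).[x].
  by rewrite horner_sum; apply: eq_bigr => k _; rewrite hornerM hornerC.
by rewrite -[in X in _ = X + _]E hornerD hornerN hornerM hornerX hs subrK.
Qed.

Let pE (x : R) : p.[x] = \det (1%:M - x *: M).
Proof.
rewrite (_ : 1%:M - x *: M = map_mx (horner_eval x) A); first by rewrite det_map_mx.
apply/matrixP => i j; rewrite !mxE /horner_eval hornerD hornerN hornerM hornerX hornerC.
by case: (i == j); rewrite ?hornerC ?horner0.
Qed.

Let p_neq0 (x : R) : 0 <= x <= 1 -> p.[x] != 0.
Proof. by move=> /unit_resolvent; rewrite unitmxE unitfE pE. Qed.

Let p0 : p.[0] = 1. Proof. by rewrite pE scale0r subr0 det1. Qed.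

Let p_gt0 (x : R) : 0 <= x <= 1 -> 0 < p.[x].
Proof.
move=> /andP[x0 x1]; rewrite ltNge; apply/negP => px.
have px0 : p.[0] * p.[x] <= 0 by rewrite p0 mul1r.
have [y /[!in_itv]/= /andP[y0 yx] /eqP py] := polyrcf.poly_ivt x0 px0.
  by have := p_neq0 (x := y); rewrite y0 (le_trans yx)// py eqxx => /(_ isT).
Qed.

(* At the smallest positive root [x] of the product of the [q k], all the [q k] would
   be nonnegative at [x], and then [qE] makes them positive. *)
Let q_gt0 i : 0 < (q i).[1].
Proof.
have q0 k : (q k).[0] = 1 by rewrite qE mul0r addr0 p0.
rewrite ltNge; apply/negP => qi1.
pose Q := \prod_k q k.
have Q0 : Q != 0.
  apply/eqP => Q0; have := horner0 (0 : R); rewrite -Q0 horner_prod big1 => [/eqP|k _//].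
  by rewrite oner_eq0.
have Qroot k x : root (q k) x -> root Q x.
  by move=> qx; rewrite /Q (bigD1 k)//= rootM qx.
have qi0 : (q i).[0] * (q i).[1] <= 0 by rewrite q0 mul1r.
have [y /[!in_itv]/= /andP[y0 y1] qy] := polyrcf.poly_ivt ler01 qi0.
have y_gt0 : 0 < y.
  rewrite lt0r y0 andbT; apply: contraTneq qy => ->.
  by rewrite /root q0 oner_eq0.
(* [roots] lists the roots in an open interval, and ]0, 2[ contains ]0, 1]. *)
have yQ : y \in roots Q 0 2.
  apply: root_in_roots => //; last exact: Qroot qy.
  by rewrite in_itv/= y_gt0 (le_lt_trans y1)// ltr1n.
case E : (roots Q 0 2) yQ => [//|x s] yQ.
have := roots_cons Q 0 2 x s; rewrite E eqxx => /esym/and5P[_ x02 /eqP Qx Qrx _].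
have xy : x <= y.
  rewrite leNgt; apply/negP => yx.
  have yI : y \in `]0, x[ by rewrite in_itv/= y_gt0.
  by have := roots_nil Q0 Qx yI; rewrite (Qroot _ _ qy).
have x0 : 0 < x by move: x02; rewrite in_itv/= => /andP[].
have qk k : 0 <= (q k).[x].
  rewrite leNgt; apply/negP => qkx.
  have qk0 : (q k).[0] * (q k).[x] < 0 by rewrite q0 mul1r.
  have [z zI qz] := polyrcf.poly_ivtoo (ltW x0) qk0.
  by have := roots_nil Q0 Qx zI; rewrite (Qroot _ _ qz).
have : Q.[x] != 0.
  rewrite horner_prod; apply/prodf_neq0 => k _.
  rewrite gt_eqF// qE ltr_pwDl//.
    by rewrite p_gt0// (ltW x0) (le_trans xy).
  by rewrite mulr_ge0 ?(ltW x0)//; apply: sumr_ge0 => l _; rewrite mulr_ge0.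
by rewrite (eqP Qrx) eqxx.
Qed.

Lemma positive_resolvent : exists v : 'I_d -> R,
  (forall i, 1 <= v i) /\ forall i, v i = 1 + \sum_j M i j * v j.
Proof.
have p1 : 0 < p.[1] by apply: p_gt0; rewrite ler01 lexx.
have vE i : (q i).[1] / p.[1] = 1 + \sum_j M i j * ((q j).[1] / p.[1]).
  rewrite {1}qE mul1r mulrDl divff ?gt_eqF//; congr (_ + _).
  by rewrite mulr_suml; apply: eq_bigr => j _; rewrite mulrA.
exists (fun i => (q i).[1] / p.[1]); split=> // i; rewrite vE lerDl.
by apply: sumr_ge0 => j _; rewrite mulr_ge0// divr_ge0// ltW.
Qed.

End positive_resolvent.

(** * Power weights *)

Section power_weights.
Context {R : realType}.
Implicit Types x y z e p : R.

(** The decrement of the convex function x^-a is at least the length of the interval times the slope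
    at its right end. It follows from ln (x / y) <= x / y - 1 and exp s >= 1 + s. *)
Lemma powR_drop (a x y : R) : 0 < a -> 0 < x -> x <= y ->
  a * (y - x) * y `^ (- (1 + a)) <= x `^ (- a) - y `^ (- a).
Proof.
move=> a0 x0 xy; have y0 := lt_le_trans x0 xy.
have lnxy : (y - x) / y <= ln y - ln x.
  have xy0 : -1 < x / y - 1 by rewrite ltrBrDr addrC subrr divr_gt0.
  have := le_ln1Dx xy0; rewrite addrC subrK ln_div ?posrE// => lnle.
  by rewrite mulrBl divff ?gt_eqF//; lra.
have -> : x `^ (- a) = y `^ (- a) * expR (a * (ln y - ln x)).
  rewrite /powR !gt_eqF// -expRD; congr expR; ring.
have -> : y `^ (- (1 + a)) = y `^ (- a) * y^-1.
  rewrite (_ : - (1 + a) = - a + -1); last by ring.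
  by rewrite powRD; [rewrite powR_inv1 ?ltW|rewrite (gt_eqF y0) implybT].
have ya0 := powR_gt0 (- a) y0.
move: (y `^ (- a)) ya0 => Y Y0.
have := expR_ge1Dx (a * (ln y - ln x)); move: (expR _) => E E1.
rewrite (_ : _ * (Y / y) = Y * (a * ((y - x) / y))); last by ring.
rewrite (_ : Y * E - Y = Y * (E - 1)); last by ring.
rewrite ler_wpM2l ?(ltW Y0)//.
have : a * ((y - x) / y) <= a * (ln y - ln x) by rewrite ler_wpM2l// ltW.
lra.
Qed.

(** [powR_drop] compares the sum with a telescoping one. *)
Lemma sum_powR_le (a e : R) n : 0 < a -> 0 < e ->
  \sum_(k < n) (1 + e * k.+1%:R) `^ (- (1 + a)) <= (a * e)^-1.
Proof.
move=> a0 e0.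
pose u k := (1 + e * k%:R) `^ (- a).
have u0 k : 0 <= u k by exact: powR_ge0.
have step k : (1 + e * k.+1%:R) `^ (- (1 + a)) <= (a * e)^-1 * (u k - u k.+1).
  rewrite ler_pdivlMl ?mulr_gt0//.
  have := @powR_drop a (1 + e * k%:R) (1 + e * k.+1%:R) a0.
  rewrite (_ : 1 + e * k.+1%:R - (1 + e * k%:R) = e); last by rewrite -natr1; ring.
  apply; first by rewrite ltr_pwDl// mulr_ge0// ltW.
  by rewrite lerD2l ler_pM2l// ler_nat.
apply: (@le_trans _ _ (\sum_(k < n) (a * e)^-1 * (u k - u k.+1))).
  by apply: ler_sum => k _; exact: step.
have -> : \sum_(k < n) (a * e)^-1 * (u k - u k.+1) = (a * e)^-1 * (u 0%N - u n).
  rewrite -mulr_sumr; congr (_ * _).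
  elim: n => [|n IH]; first by rewrite big_ord0 subrr.
  by rewrite big_ord_recr/= IH addrA subrK.
rewrite -[leRHS]mulr1 ler_wpM2l ?invr_ge0 ?mulr_ge0 ?(ltW a0) ?(ltW e0)//.
by rewrite {1}/u mulr0 addr0 powR1 gerBl.
Qed.

(** The positive part is subadditive, and 1 + e (a + b) <= (1 + e a) (1 + e b) for nonnegative a and
    b. *)
Lemma weight_submult (p e : R) (T x z : R) : 0 <= p -> 0 <= e ->
  (1 + e * Num.max 0 (T - x)) `^ p <=
  (1 + e * Num.max 0 (T - (x + z))) `^ p * (1 + e * Num.max 0 z) `^ p.
Proof.
move=> p0 e0.
have m0 (y : R) : 0 <= Num.max 0 y by rewrite le_max lexx.
have em0 y : 0 <= e * Num.max 0 y by rewrite mulr_ge0.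
rewrite -powRM ?addr_ge0// ge0_ler_powR ?nnegrE ?mulr_ge0 ?addr_ge0//.
apply: (@le_trans _ _ (1 + e * (Num.max 0 (T - (x + z)) + Num.max 0 z))).
  rewrite lerD2l ler_wpM2l// ge_max addr_ge0//=.
  have : T - (x + z) <= Num.max 0 (T - (x + z)) by rewrite le_max lexx orbT.
  have : z <= Num.max 0 z by rewrite le_max lexx orbT.
  lra.
have := mulr_ge0 (em0 (T - (x + z))) (em0 z); nra.
Qed.

(* [weight] decays polynomially with the distance to the left of [T]; a displacement [z]
   increases it by the factor [stretch] at most, see [weight_shift]. *)
Definition weight p e (T x : R) : R := (1 + e * Num.max 0 (T - x)) `^ (- p).

Definition stretch p e (z : R) : R := (1 + e * Num.max 0 z) `^ p.

Lemma weight_ge0 p e T x : 0 <= weight p e T x.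
Proof. exact: powR_ge0. Qed.

Lemma stretch_ge0 p e z : 0 <= stretch p e z.
Proof. exact: powR_ge0. Qed.

Lemma weight_shift p e T x z : 0 <= p -> 0 <= e ->
  weight p e T (x + z) <= weight p e T x * stretch p e z.
Proof.
move=> p0 e0.
have pos y : 0 < (1 + e * Num.max 0 y) `^ p.
  by apply: powR_gt0; rewrite ltr_pwDl// mulr_ge0// le_max lexx.
rewrite /weight /stretch !powRN [leRHS]mulrC ler_pdivlMr// ler_pdivrMl//.
exact: weight_submult.
Qed.

Lemma measurable_stretch p e : measurable_fun [set: R] (stretch p e).
Proof.
apply: (measurableT_comp (measurable_powR p)); apply: measurable_funD => //.
apply: measurable_funM => //; exact: measurable_maxr.
Qed.

Lemma measurable_weight p e T : measurable_fun [set: R] (weight p e T).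
Proof.
apply: (measurableT_comp (measurable_powR (- p))); apply: measurable_funD => //.
apply: measurable_funM => //; apply: measurable_maxr => //.
exact: measurable_funB.
Qed.

End power_weights.

Section kernel_contraction.
Context {R : realType} {d : nat} (h : 'I_d -> 'I_d -> R -> R) (beta : R).
Hypothesis d_gt0 : (0 < d)%N.
Hypothesis h_ge0 : forall i j x, 0 <= h i j x.
Hypothesis h_causal : forall i j x, x < 0 -> h i j x = 0.
Hypothesis h_integrable : forall i j,
  lebesgue_measure.-integrable [set: R] (EFin \o h i j).
Hypothesis subcritical : spectral_radius (reproduction_matrix h) < 1.
Hypothesis beta_gt0 : 0 < beta.
Hypothesis h_moment : (ereal_sup (range (fun ij : 'I_d * 'I_d =>
  \int[lebesgue_measure]_t (t `^ (1 + beta) * h ij.1 ij.2 t)%:E)) < +oo)%E.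

Local Notation p := (1 + beta).

Let p_ge0 : 0 <= p. Proof. by rewrite addr_ge0// ltW. Qed.

Let mh i j : measurable_fun setT (h i j).
Proof. by have /measurable_int/measurable_EFinP := h_integrable i j. Qed.

Lemma integral_hE i j :
  (\int[lebesgue_measure]_z (h i j z)%:E = (reproduction_matrix h i j)%:E)%E.
Proof.
rewrite mxE /Rintegral fineK.
  by apply: eq_integral => z _; rewrite ger0_norm.
have /integrableP[_] := h_integrable i j.
by rewrite ge0_fin_numE// integral_ge0.
Qed.

(** A bound uniform in [e], for dominated convergence: the base 1 + e z is at most 2 when z <= 1 and
    at most 2 z when z > 1. *)
Lemma stretch_le (e z : R) : 0 <= e <= 1 -> 0 <= z ->
  stretch p e z <= 2 `^ p * (1 + z `^ p).
Proof.
move=> /andP[e0 e1] z0; rewrite /stretch max_r//.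
have [z1|z1] := leP z 1.
  apply: (@le_trans _ _ (2 `^ p)).
    have ez := mulr_ile1 e0 z0 e1 z1.
    by apply: ge0_ler_powR => //; rewrite ?nnegrE ?addr_ge0 ?mulr_ge0//; lra.
  by rewrite ler_peMr ?powR_ge0// lerDl powR_ge0.
apply: (@le_trans _ _ ((2 * z) `^ p)).
  have ez : e * z <= z by rewrite ler_piMl.
  by apply: ge0_ler_powR => //; rewrite ?nnegrE ?addr_ge0 ?mulr_ge0//; lra.
by rewrite powRM// ler_wpM2l ?powR_ge0// lerDr.
Qed.

Let dominant i j z := 2 `^ p * (h i j z + z `^ p * h i j z).

Let dominant_integrable i j :
  lebesgue_measure.-integrable [set: R] (EFin \o dominant i j).
Proof.
have mz : measurable_fun [set: R] (fun z => z `^ p * h i j z).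
  by apply: measurable_funM => //; exact: measurable_powR.
have : lebesgue_measure.-integrable [set: R] (fun z => (z `^ p * h i j z)%:E).
  apply/integrableP; split; first exact/measurable_EFinP.
  apply: le_lt_trans h_moment.
  under eq_integral do rewrite gee0_abs ?lee_fin ?mulr_ge0 ?powR_ge0//.
  by apply: ereal_sup_ubound; exists (i, j).
move=> /(integrableD measurableT (h_integrable i j)) /(integrableZl measurableT (2 `^ p)).
by apply: eq_integrable => // z _; rewrite /dominant/= EFinM EFinD.
Qed.

Let stretch_dominated (e : R) i j z : 0 <= e <= 1 ->
  stretch p e z * h i j z <= dominant i j z.
Proof.
move=> e01; have [z0|z0] := ltP z 0.
  by rewrite /dominant !h_causal// !mulr0 addr0 mulr0.
rewrite /dominant -[X in _ * (X + _)]mul1r -mulrDl mulrA ler_wpM2r//.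
exact: stretch_le.
Qed.

Lemma cvg_stretch (z : R) : stretch p n.+1%:R^-1 z @[n --> \oo] --> (1 : R).
Proof.
rewrite /stretch; have ze n : 0 < 1 + n.+1%:R^-1 * Num.max 0 z.
  by rewrite ltr_pwDl// mulr_ge0// le_max lexx.
have -> : (fun n => (1 + n.+1%:R^-1 * Num.max 0 z) `^ p) =
    fun n => expR (p * ln (1 + n.+1%:R^-1 * Num.max 0 z)).
  by apply/funext => n; rewrite /powR gt_eqF.
have cy : n.+1%:R^-1 * Num.max 0 z @[n --> \oo] --> (0 : R).
  rewrite -[X in _ --> X](mul0r (Num.max 0 z)).
  by apply: cvgM; [exact: cvg_harmonic|exact: cvg_cst].
have c1 : 1 + n.+1%:R^-1 * Num.max 0 z @[n --> \oo] --> (1 : R).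
  by rewrite -[X in _ --> X]addr0; apply: cvgD => //; exact: cvg_cst.
have c2 : ln (1 + n.+1%:R^-1 * Num.max 0 z) @[n --> \oo] --> (0 : R).
  by rewrite -[X in _ --> X](@ln1 R); apply: (@continuous_cvg _ _ _ _ _ _ (@ln R)) => //;
    exact: continuous_ln.
have c3 : p * ln (1 + n.+1%:R^-1 * Num.max 0 z) @[n --> \oo] --> (0 : R).
  by rewrite -[X in _ --> X](mulr0 p); apply: cvgM => //; exact: cvg_cst.
rewrite -[X in _ --> X]expR0; apply: (@continuous_cvg _ _ _ _ _ _ expR) => //.
exact: continuous_expR.
Qed.

Lemma cvg_integral_stretch i j :
  (\int[lebesgue_measure]_z (stretch p n.+1%:R^-1 z * h i j z)%:E @[n --> \oo] -->
   (reproduction_matrix h i j)%:E)%E.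
Proof.
rewrite -integral_hE.
have e01 n : 0 <= (n.+1%:R^-1 : R) <= 1 by rewrite invr_ge0 ler0n invf_le1 ?ler1n.
pose f_ n (z : R) := (stretch p n.+1%:R^-1 z * h i j z)%:E.
have mf n : measurable_fun setT (f_ n).
  by apply/measurable_EFinP; apply: measurable_funM => //; exact: measurable_stretch.
have mfh : measurable_fun setT (EFin \o h i j) by exact/measurable_EFinP.
have cf : {ae lebesgue_measure, forall z, setT z -> f_ ^~ z @ \oo --> (EFin \o h i j) z}.
  apply: aeW => z _; apply: cvg_EFin; first by near=> n.
  have -> : fine \o f_ ^~ z = fun n => stretch p n.+1%:R^-1 z * h i j z by [].
  rewrite -[X in _ --> X]mul1r; apply: cvgM; [exact: cvg_stretch|exact: cvg_cst].
have bf : {ae lebesgue_measure, forall z n, setT z -> (`|f_ n z| <= (EFin \o dominant i j)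
  z)%E}.
  apply: aeW => z n _; rewrite /f_ /= lee_fin ger0_norm.
    exact: stretch_dominated.
  by rewrite mulr_ge0// powR_ge0.
by have [_ _] := @dominated_convergence _ (measurableTypeR R) R lebesgue_measure
  setT measurableT f_ _ _ mf mfh cf (dominant_integrable i j) bf.
Unshelve. all: end_near.
Qed.

(** The stretched kernel tends to the reproduction matrix, for which the sum is v_i - 1; hence it is
    below v_i - 1/2 once [e] is small. As v_i <= V, this is at most (1 - 1 / (2 V)) v_i, which
    dictates [theta]. *)
Lemma kernel_contraction : exists (e theta : R) (v : 'I_d -> R),
  [/\ 0 < e, 0 <= theta < 1, forall i, 1 <= v i &
      forall i, (\sum_(j < d)
        (v j)%:E * \int[lebesgue_measure]_z (stretch p e z * h i j z)%:E <=
        (theta * v i)%:E)%E].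
Proof.
have M_ge0 i j : 0 <= reproduction_matrix h i j.
  rewrite -lee_fin -integral_hE; apply: integral_ge0 => z _.
  by rewrite lee_fin.
have [v [v1 vE]] := positive_resolvent M_ge0 subcritical.
pose V := \sum_i v i.
have vV i : v i <= V.
  rewrite /V (bigD1 i)//= lerDl; apply: sumr_ge0 => k _.
  exact: le_trans (v1 k).
have V1 : 1 <= V by exact: le_trans (v1 (Ordinal d_gt0)) (vV _).
have V0 : 0 < V by exact: lt_le_trans V1.
have cv i : (\sum_(j < d) (v j)%:E *
      \int[lebesgue_measure]_z (stretch p n.+1%:R^-1 z * h i j z)%:E @[n --> \oo] -->
    (v i - 1)%:E)%E.
  have -> : (v i - 1)%:E = (\sum_(j < d) (v j)%:E * (reproduction_matrix h i j)%:E)%E.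
    rewrite sumEFin vE addrC addKr; congr EFin.
    by apply: eq_bigr => j _; rewrite mulrC.
  apply: cvg_nnesum => j _; last by apply: cvgeZl => //; exact: cvg_integral_stretch.
  apply: nearW => n; rewrite mule_ge0 ?lee_fin ?(le_trans _ (v1 j))//.
  by apply: integral_ge0 => z _; rewrite lee_fin mulr_ge0// powR_ge0.
have ev i : exists N, forall n, (N <= n)%N -> (\sum_(j < d) (v j)%:E *
      \int[lebesgue_measure]_z (stretch p n.+1%:R^-1 z * h i j z)%:E <
    (v i - 2^-1)%:E)%E.
  have vi : ((v i - 1)%:E < (v i - 2^-1)%:E)%E by rewrite lte_fin; lra.
  by have [N _ NE] := cv i _ (open_ereal_lt' vi); exists N.
have [N NE] := choice ev.
pose n := \max_i N i.
have nE i := NE i n (leq_bigmax i).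
exists n.+1%:R^-1, (1 - (2 * V)^-1), v; split=> //.
- have : (2 * V)^-1 <= 1 by rewrite invf_le1 ?mulr_gt0//; lra.
  have : 0 < (2 * V)^-1 by rewrite invr_gt0 mulr_gt0.
  by move=> *; apply/andP; split; lra.
- move=> i; apply: le_trans (ltW (nE i)) _; rewrite lee_fin.
  have : (2 * V)^-1 * v i <= 2^-1.
    rewrite invfM -mulrA ler_piMr// ?invr_ge0//.
    by rewrite mulrC ler_pdivrMr// mul1r.
  by rewrite mulrBl mul1r; lra.
Qed.

End kernel_contraction.

(** The integral of a nonnegative function is the supremum over the simple functions below it, an
    expression that is monotone whatever the measurability of [f] and [g]. *)
Lemma le_integral_ge0 (R : realType) d (T : measurableType d)
    (mu : {measure set T -> \bar R}) (f g : T -> \bar R) :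
  (forall x, 0 <= f x)%E -> (forall x, f x <= g x)%E ->
  (\int[mu]_x f x <= \int[mu]_x g x)%E.
Proof.
move=> f0 fg; have g0 x : (0 <= g x)%E by exact: le_trans (fg x).
rewrite !ge0_integralTE//; apply: le_ereal_sup => _ [s sf <-].
by exists s => // x; exact: le_trans (sf x) (fg x).
Qed.

Lemma esum_fintype (R : realType) (I : finType) (f : I -> \bar R) :
  (forall i, 0 <= f i)%E -> (\esum_(i in [set: I]) f i = \sum_i f i)%E.
Proof.
move=> f0; rewrite esum_fset; [|exact: finite_finset|by []].
rewrite fsbig_finite; last exact: finite_finset.
apply: perm_big; apply: uniq_perm; rewrite ?fset_uniq ?index_enum_uniq// => i.
rewrite mem_index_enum in_fset_set; last exact: finite_finset.
by rewrite mem_set.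
Qed.

(** * Decay of the expected contribution of the old clusters *)

Section means.
Local Open Scope ereal_scope.
Context {R : realType} {d : nat} {disp : measure_display}
  {Omega : measurableType disp} (P : probability Omega R).
Context (eta : 'I_d -> R) (h : 'I_d -> 'I_d -> R -> R).
Context (xi : label d -> 'I_d -> nat -> Omega -> \bar R).
Hypothesis eta_ge0 : forall j, (0 <= eta j)%R.
Hypothesis h_ge0 : forall i j x, (0 <= h i j x)%R.
Hypothesis h_integrable : forall i j,
  lebesgue_measure.-integrable [set: R] (EFin \o h i j).
Hypothesis xi_poisson :
  forall u j, poisson_process P (offspring_intensity eta h u j) (xi u j).
Hypothesis xi_indep : mutually_independent P
  (fun uj : label d * 'I_d => sigma_sequence (xi uj.1 uj.2)).
Context (t : R).

Local Notation lam := (offspring_intensity eta h).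

(** [litter_freezing] with the identity for [G], followed by Campbell's formula. *)
Lemma mean_litter c u j : good_cost c ->
  \int[P]_w litter_cost xi t c (u, j) w =
  \int[P]_w on_fin (fun x => intensity_integral (lam u j)
    (fun z => child_cost xi t c u j w (x + z)%R)) (location xi u w).
Proof.
move=> gc.
have := litter_freezing xi_poisson xi_indep t (measurable_id (D := setT))
  (fun x x0 => x0) gc (measurable_cst 1 : measurable_fun [set: subOmega xi [set p | p != (u,
    j)]] _)
  (fun=> lee01).
under eq_integral do rewrite mul1e.
move=> ->; apply: eq_integral => w _; rewrite mul1e.
case: (location xi u w) => [x||]//=.
have [mc c0] := child_cost_shift_good xi t u j w x gc.
exact: (campbell (lam_ge0 eta_ge0 h_ge0 u j) (measurable_lam eta h_integrable u j)
  (lam_fin eta_ge0 h_ge0 h_integrable u j) (xi_poisson u j) mc c0).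
Qed.

Definition mean_generation c k := \int[P]_w generation_cost xi t k c w.

Lemma measurable_litter_cost c p : good_cost c ->
  measurable_fun setT (litter_cost xi t c p).
Proof.
move=> gc; apply: ge0_emeasurable_sum => [n w _ _|n _]; first exact: cost_ge0.
exact: (cost_measurable xi_poisson).
Qed.

Lemma mean_generationS c k : good_cost c -> mean_generation c k.+1 =
  \esum_(p in parents k) \int[P]_w litter_cost xi t c p w.
Proof.
move=> gc; rewrite /mean_generation.
under eq_integral do rewrite generation_costS//.
apply: integral_esum => [p w|p _]; first exact: litter_cost_ge0.
exact: measurable_litter_cost.
Qed.

Lemma mean_immigrants c : good_cost c -> mean_generation c 1 =
  \sum_(j < d) intensity_integral (cst (eta j)) (fun z => c (z <= t)%R j z).
Proof.
move=> gc; rewrite mean_generationS// (reindex_esum setT (parents 0) (fun j => ([::], j))).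
  rewrite esum_fintype; last first.
    by move=> j; apply: integral_ge0 => w _; exact: litter_cost_ge0.
  apply: eq_bigr => j _; rewrite mean_litter// /= .
  transitivity (\int[P]_w cst (intensity_integral (cst (eta j)) (fun z => c (z <= t)%R j z)) w).
    apply: eq_integral => w _; apply: eq_integral => z _.
    by rewrite /child_cost add0r.
  by rewrite integral_cst// [X in _ * X]probability_setT mule1.
split=> [j _|j j' _ _ []//|] //=.
by move=> [u j]; rewrite /parents/= => /size0nil ->; exists j.
Qed.

Context (p e theta T : R) (v : 'I_d -> R).
Hypotheses (p_ge0 : (0 <= p)%R) (e_ge0 : (0 <= e)%R) (theta01 : (0 <= theta < 1)%R).
Hypothesis v_ge1 : forall i, (1 <= v i)%R.
Hypothesis contraction : forall i, \sum_(j < d)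
  (v j)%:E * \int[lebesgue_measure]_z (stretch p e z * h i j z)%:E <= (theta * v i)%:E.

Let v_ge0 i : (0 <= v i)%R. Proof. exact: le_trans (v_ge1 i). Qed.

Definition weight_cost (a : 'I_d -> R) : bool -> 'I_d -> R -> \bar R :=
  fun s j x => if s then (a j * weight p e T x)%:E else 0.

Lemma weight_cost_good a : (forall j, (0 <= a j)%R) -> good_cost (weight_cost a).
Proof.
move=> a0; split=> [s j|s j x]; rewrite /weight_cost.
  case: s; last exact: measurable_cst.
  by apply/measurable_EFinP; apply: measurable_funM => //; exact: measurable_weight.
by case: ifP => // _; rewrite lee_fin mulr_ge0// powR_ge0.
Qed.

Lemma cost_weight (a : 'I_d -> R) i n u w : cost xi t (weight_cost a) ((i, n) :: u) w =
  (a i)%:E * cost xi t (weight_cost (fun=> 1%R)) ((i, n) :: u) w.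
Proof.
rewrite /cost; case: (location xi _ w) => [x||]/=; rewrite ?mule0//.
by rewrite /weight_cost; case: ifP; rewrite ?mule0// mul1r.
Qed.

(** By [weight_shift] a child weighs at most the weight of its parent times the stretch of its
    displacement, and the side is the same. The parent is therefore charged without its type factor,
    and the integral over displacements comes out. *)
Lemma mean_litter_le i n u j :
  \int[P]_w litter_cost xi t (weight_cost v) ((i, n) :: u, j) w <=
  (v j)%:E * \int[lebesgue_measure]_z (stretch p e z * h i j z)%:E *
  \int[P]_w cost xi t (weight_cost (fun=> 1%R)) ((i, n) :: u) w.
Proof.
have g1 := weight_cost_good (fun=> ler01); have gv := weight_cost_good v_ge0.
have m0 : 0 <= \int[lebesgue_measure]_z (stretch p e z * h i j z)%:E.
  by apply: integral_ge0 => z _; rewrite lee_fin mulr_ge0// powR_ge0.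
rewrite mean_litter//.
rewrite -ge0_integralZl//; last 3 first.
- exact: (cost_measurable xi_poisson).
- by move=> w _; exact: cost_ge0.
- by rewrite mule_ge0 ?lee_fin.
apply: le_integral_ge0 => w.
  apply: on_fin_ge0 => x; apply: integral_ge0 => z _.
  apply: mule_ge0; first exact: (child_cost_good xi t ((i, n) :: u) j w gv).2.
  by rewrite lee_fin; exact: lam_ge0.
rewrite /cost; case: (location xi ((i, n) :: u) w) => [x||]; [|by rewrite /= mule0|by rewrite
  /= mule0].
rewrite /on_fin /intensity_integral /child_cost /weight_cost.
case: ifP => _; last by rewrite mule0 integral0_eq// => z _; rewrite mul0e.
have msh : measurable_fun setT (fun z : R => (stretch p e z * h i j z)%:E).
  apply/measurable_EFinP; apply: measurable_funM; first exact: measurable_stretch.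
  exact: (measurable_lam eta h_integrable ((i, n) :: u) j).
have sh0 z : 0 <= (stretch p e z * h i j z)%:E.
  by rewrite lee_fin mulr_ge0// stretch_ge0.
rewrite mul1r -muleA [X in _ <= _ * X]muleC -!ge0_integralZl//.
- apply: le_integral_ge0 => z.
    rewrite -EFinM lee_fin; apply: mulr_ge0; first by rewrite mulr_ge0 ?weight_ge0.
    exact: lam_ge0.
  rewrite -!EFinM lee_fin -mulrA ler_wpM2l// mulrA ler_wpM2r//; first exact: h_ge0.
  exact: weight_shift.
- exact: measurable_funeM.
- by move=> z _; apply: mule_ge0; rewrite // lee_fin weight_ge0.
- by rewrite lee_fin.
- by rewrite lee_fin weight_ge0.
Qed.

(** Summed over the type of the child, [mean_litter_le] and [contraction] give back the type factor
    of the parent, multiplied by [theta]. *)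
Lemma mean_step k : mean_generation (weight_cost v) k.+2 <=
  theta%:E * mean_generation (weight_cost v) k.+1.
Proof.
have gv := weight_cost_good v_ge0; have g1 := weight_cost_good (fun=> ler01).
have litter0 q : 0 <= \int[P]_w litter_cost xi t (weight_cost v) q w.
  by apply: integral_ge0 => w _; exact: litter_cost_ge0.
have theta0 : (0 <= theta)%R by case/andP: theta01.
have cost0 u : 0 <= \int[P]_w cost xi t (weight_cost v) u w.
  by apply: integral_ge0 => w _; exact: cost_ge0.
rewrite mean_generationS//.
have -> : parents k.+1 = [set u : label d | size u = k.+1] `*`` fun=> [set: 'I_d].
  by apply/seteqP; split => -[u j] //= [].
rewrite (_ : \esum_(p in _) _ = \esum_(u in [set u : label d | size u = k.+1])
    \esum_(j in [set: 'I_d]) \int[P]_w litter_cost xi t (weight_cost v) (u, j) w); last first.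
  by rewrite esum_esum//; apply: eq_esum => -[].
apply: (@le_trans _ _ (\esum_(u in [set u : label d | size u = k.+1])
    (theta%:E * \int[P]_w cost xi t (weight_cost v) u w))).
  apply: le_esum => -[//|[i n] u] _.
  rewrite esum_fintype; last by move=> j; exact: litter0.
  apply: (@le_trans _ _ (\sum_(j < d) (v j)%:E *
      \int[lebesgue_measure]_z (stretch p e z * h i j z)%:E *
      \int[P]_w cost xi t (weight_cost (fun=> 1%R)) ((i, n) :: u) w)).
    by apply: lee_sum => j _; exact: mean_litter_le.
  rewrite -ge0_sume_distrl; last first.
    move=> j _; rewrite mule_ge0 ?lee_fin//; apply: integral_ge0 => z _.
    by rewrite lee_fin mulr_ge0// stretch_ge0.
  under [in leRHS]eq_integral do rewrite cost_weight.
  rewrite ge0_integralZl//; last 3 first.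
  - exact: (cost_measurable xi_poisson).
  - by move=> w _; exact: cost_ge0.
  - by rewrite lee_fin.
  rewrite muleA -EFinM; apply: lee_wpmul2r => //.
  by apply: integral_ge0 => w _; exact: cost_ge0.
rewrite /mean_generation /generation_cost integral_esum; last 2 first.
- by move=> u w; exact: cost_ge0.
- by move=> u _; exact: (cost_measurable xi_poisson).
have tcost0 u : 0 <= theta%:E * \int[P]_w cost xi t (weight_cost v) u w.
  by rewrite mule_ge0 ?lee_fin ?cost0.
rewrite (esum_enum _ tcost0) (esum_enum _ cost0).
rewrite -nneseriesMl ?lee_fin//; last by move=> m; exact: enum_term_ge0 cost0.
apply: lee_nneseries => [m _ _|m _]; first exact: enum_term_ge0 tcost0.
by rewrite /enum_term; case: pickle_inv => [u|]; rewrite ?mule0//; case: ifP; rewrite ?mule0.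
Qed.

Definition mean_total := \int[P]_w total_cost xi t (weight_cost v) w.

Lemma mean_total_le (B : R) : mean_generation (weight_cost v) 1 <= B%:E ->
  mean_total <= (B / (1 - theta))%:E.
Proof.
move=> mB; have gv := weight_cost_good v_ge0.
have [theta0 theta1] := andP theta01.
have B0 : (0 <= B)%R.
  rewrite -lee_fin (le_trans _ mB)//; apply: integral_ge0 => w _.
  exact: generation_cost_ge0.
have mk k : mean_generation (weight_cost v) k.+1 <= (theta ^+ k * B)%:E.
  elim: k => [|k IH]; first by rewrite expr0 mul1r.
  apply: (le_trans (mean_step k)); rewrite exprS -mulrA EFinM.
  by apply: lee_wpmul2l; rewrite ?lee_fin.
have gm k : measurable_fun setT (generation_cost xi t k (weight_cost v)).
  apply: measurable_esum => [u w|u _]; first exact: cost_ge0.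
  exact: (cost_measurable xi_poisson).
have -> : mean_total = \sum_(k <oo) mean_generation (weight_cost v) k.
  rewrite /mean_total /mean_generation -integral_nneseries//; last first.
    by move=> k w _; exact: generation_cost_ge0.
  apply: eq_integral => w _; rewrite /total_cost.
  rewrite (_ : setT = \bigcup_i [set u : label d | size u = i]); last first.
    by apply/seteqP; split => // u _; exists (size u).
  rewrite nneseries_sum_bigcup//.
  + by apply/trivIsetP => i j _ _ /eqP ij; apply/seteqP; split => // u [/= -> /ij].
  + by move=> u; exact: cost_ge0.
have m0 k : 0 <= mean_generation (weight_cost v) k.
  by apply: integral_ge0 => w _; exact: generation_cost_ge0.
apply: lime_le; first exact: is_cvg_nneseries.
apply: nearW => -[|n].
  by rewrite big_geq// lee_fin divr_ge0// subr_ge0 ltW.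
(* Index 0 is that of the empty label, which bears no cost. *)
rewrite big_nat_recl//= [X in X + _](_ : _ = 0) ?add0e; last first.
  by apply: integral0_eq => w _; rewrite /generation_cost esum1// => -[].
apply: (@le_trans _ _ (\sum_(0 <= k < n) (theta ^+ k * B)%:E)).
  by apply: lee_sum.
rewrite sumEFin lee_fin -mulr_suml mulrC ler_wpM2l//.
rewrite -[leRHS]mul1r ler_pdivlMr ?subr_gt0//.
rewrite (_ : ((\sum_(0 <= k < n) theta ^+ k) * (1 - theta) = 1 - theta ^+ n)%R).
  by rewrite gerBl exprn_ge0.
rewrite big_mkord -(opprB theta 1) mulrN mulrC -subrX1.
by rewrite opprB.
Qed.

End means.

(** * Total weight of the immigrants before t *)

Section immigrant_weight.
Context {R : realType}.

Lemma le_powR_opp (a x y : R) : 0 <= a -> 0 < x -> x <= y -> y `^ (- a) <= x `^ (- a).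
Proof.
move=> a0 x0 xy; have y0 := lt_le_trans x0 xy.
rewrite !powRN lef_pV2 ?posrE ?powR_gt0//.
by apply: ge0_ler_powR => //; rewrite nnegrE ltW.
Qed.

Context (e beta gamma t tau : R).
Hypotheses (e_gt0 : 0 < e) (gamma_gt0 : 0 < gamma) (gamma_lt : gamma < beta).
Hypothesis tau_gt0 : 0 < tau.

(** Bound for the weight at a distance between k and k + 1 to the left of [t]. The exponent 1 + beta
    is split into gamma, spent on [tau], and 1 + (beta - gamma), which makes the bounds summable in
    k. *)
Let b (k : nat) := (e * tau) `^ (- gamma) * (1 + e * k%:R) `^ (- (1 + (beta - gamma))).

Let b_ge0 k : 0 <= b k.
Proof. by rewrite mulr_ge0 ?powR_ge0. Qed.

(** The base 1 + e (t + tau - z) is at least e tau and at least 1 + e k; each bound serves one part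
    of the exponent. *)
Lemma weight_le_truncn z : z <= t ->
  weight (1 + beta) e (t + tau) z <= b (Num.truncn (t - z)).
Proof.
move=> zt; have tz0 : 0 <= t - z by rewrite subr_ge0.
have /andP[kz _] := truncn_itv tz0.
set k := Num.truncn _ in kz *; rewrite /weight /b.
have k0 : 0 <= k%:R :> R by [].
have T0 : 0 <= t + tau - z by rewrite addrAC addr_ge0// ltW.
rewrite (max_idPr T0).
have le1 : e * tau <= 1 + e * (t + tau - z).
  apply: (@le_trans _ _ (e * (t + tau - z))); last by rewrite lerDr.
  by rewrite ler_wpM2l ?(ltW e_gt0)// addrAC lerDr.
have le2 : 1 + e * k%:R <= 1 + e * (t + tau - z).
  by rewrite lerD2l ler_wpM2l ?(ltW e_gt0)// (le_trans kz)// addrAC lerDl ltW.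
have p2 : 0 < 1 + e * k%:R by rewrite ltr_pwDl// mulr_ge0// ltW.
rewrite (_ : - (1 + beta) = - gamma + - (1 + (beta - gamma))); last by ring.
rewrite powRD; last by rewrite (gt_eqF (lt_le_trans p2 le2)) implybT.
apply: ler_pM; rewrite ?powR_ge0//.
  by apply: le_powR_opp => //; [exact: ltW|exact: mulr_gt0].
by apply: le_powR_opp => //; rewrite addr_ge0// subr_ge0 ltW.
Qed.

Lemma integral_weight_le :
  (\int[lebesgue_measure]_z (if (z <= t)%R then (weight (1 + beta) e (t + tau) z)%:E else 0) <=
   (e `^ (- gamma) * (1 + ((beta - gamma) * e)^-1) * tau `^ (- gamma))%:E)%E.
Proof.
pose I (k : nat) : set R := `]t - k.+1%:R, t - k%:R]%classic.
have step0 k (z : R) : (0 <= (b k)%:E * (\1_(I k) z)%:E)%E.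
  by rewrite mule_ge0 ?lee_fin.
apply: (@le_trans _ _ (\int[lebesgue_measure]_z \sum_(k <oo) ((b k)%:E * (\1_(I k) z)%:E))%E).
  apply: le_integral_ge0 => z.
    by case: ifP => // _; rewrite lee_fin weight_ge0.
  case: ifP => [zt|_]; last exact: nneseries_ge0.
  have tz0 : 0 <= t - z by rewrite subr_ge0.
  have /andP[kz kz1] := truncn_itv tz0.
  set k := Num.truncn (t - z) in kz kz1.
  rewrite (@nneseries_split_cond _ _ 0 k.+1 xpredT)//.
  apply: (@le_trans _ _ (\sum_(0 <= i < k.+1) ((b i)%:E * (\1_(I i) z)%:E))%E).
    rewrite big_nat_recr//= -[leLHS]add0e leeD ?sume_ge0//.
    rewrite indicE mem_set ?mule1 ?lee_fin ?weight_le_truncn//.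
    by rewrite /I /= in_itv/=; apply/andP; split; lra.
  by rewrite add0n leeDl// nneseries_ge0.
rewrite integral_nneseries//; last first.
  move=> k; apply: emeasurable_funM; first exact: measurable_cst.
  by apply/measurable_EFinP; apply: measurable_indic; exact: measurable_itv.
apply: lime_le; first by apply: is_cvg_nneseries => k _ _; apply: integral_ge0 => z _; exact:
  step0.
apply: nearW => n.
apply: (@le_trans _ _ (\sum_(0 <= k < n) (b k)%:E)%E).
  apply: lee_sum => k _; rewrite ge0_integralZl//; last 2 first.
  - by apply/measurable_EFinP; apply: measurable_indic; exact: measurable_itv.
  - by rewrite lee_fin.
  rewrite integral_indic//; last exact: measurable_itv.
  rewrite setIT; have I1 : lebesgue_measure (I k) = 1%E.
    rewrite /I lebesgue_measure_itv/= lte_fin ltrD2l ltrN2 ltr_nat ltnSn -EFinD -natr1.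
    by congr EFin; ring.
  by have := lexx (b k)%:E; rewrite -[X in (X <= _)%E]mule1 -I1.
rewrite sumEFin lee_fin /b -mulr_sumr powRM ?(ltW e_gt0) ?(ltW tau_gt0)// -!mulrA ler_wpM2l
  ?powR_ge0//.
rewrite mulrC ler_wpM2r ?powR_ge0//.
have delta_gt0 : 0 < beta - gamma by rewrite subr_gt0.
case: n => [|n]; first by rewrite big_geq// addr_ge0// invr_ge0 mulr_ge0 ?ltW.
(* The term k = 0 is the summand 1 of the constant, and [sum_powR_le] bounds the others. *)
rewrite big_mkord big_ord_recl/= mulr0 addr0 powR1 lerD2l.
exact: sum_powR_le.
Qed.

End immigrant_weight.

Section immigrant_mean_total.
Local Open Scope ereal_scope.
Context {R : realType} {d : nat} {disp : measure_display}
  {Omega : measurableType disp} (P : probability Omega R).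
Context (eta : 'I_d -> R) (h : 'I_d -> 'I_d -> R -> R).
Context (xi : label d -> 'I_d -> nat -> Omega -> \bar R).
Hypothesis eta_ge0 : forall j, (0 <= eta j)%R.
Hypothesis h_ge0 : forall i j x, (0 <= h i j x)%R.
Hypothesis h_integrable : forall i j,
  lebesgue_measure.-integrable [set: R] (EFin \o h i j).
Hypothesis xi_poisson :
  forall u j, poisson_process P (offspring_intensity eta h u j) (xi u j).
Hypothesis xi_indep : mutually_independent P
  (fun uj : label d * 'I_d => sigma_sequence (xi uj.1 uj.2)).
Context (e beta gamma theta : R) (v : 'I_d -> R).
Hypotheses (e_gt0 : (0 < e)%R) (gamma_gt0 : (0 < gamma)%R) (gamma_lt : (gamma < beta)%R).
Hypotheses (theta01 : (0 <= theta < 1)%R) (v_ge1 : forall i, (1 <= v i)%R).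
Hypothesis contraction : forall i, \sum_(j < d)
  (v j)%:E * \int[lebesgue_measure]_z (stretch (1 + beta) e z * h i j z)%:E <= (theta * v i)%:E.

(** The weighted immigration rate, the constant of [integral_weight_le], and the sum 1 / (1 - theta)
    of the geometric series over the generations. *)
Definition decay_constant : R := ((\sum_(j < d) v j * eta j) *
  (e `^ (- gamma) * (1 + ((beta - gamma) * e)^-1)) / (1 - theta))%R.

Lemma mean_total_decay t tau : (0 < tau)%R ->
  mean_total P xi t (1 + beta) e (t + tau) v <= (decay_constant * tau `^ (- gamma))%:E.
Proof.
move=> tau0; have v0 j : (0 <= v j)%R by apply: le_trans (v_ge1 j).
have beta0 : (0 <= 1 + beta)%R by rewrite addr_ge0// ltW// (lt_trans gamma_gt0).
rewrite /decay_constant mulrAC.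
apply: (mean_total_le eta_ge0 h_ge0 h_integrable xi_poisson xi_indep beta0 (ltW e_gt0)
  theta01 v_ge1 contraction).
rewrite (mean_immigrants eta_ge0 h_ge0 h_integrable xi_poisson xi_indep); last exact:
  weight_cost_good.
rewrite -mulrA mulr_suml -sumEFin; apply: lee_sum => j _.
rewrite EFinM; apply: le_trans.
  2: apply: lee_wpmul2l; last exact: (integral_weight_le t e_gt0 gamma_gt0 gamma_lt tau0).
  2: by rewrite lee_fin mulr_ge0.
rewrite -ge0_integralZl ?lee_fin ?mulr_ge0//; last 2 first.
- apply: measurable_fun_ifT => //.
    exact: measurable_fun_ler.
  by apply/measurable_EFinP; exact: measurable_weight.
- by move=> z _; case: ifP => // _; rewrite lee_fin weight_ge0.
rewrite /intensity_integral; apply: le_integral_ge0 => z.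
  apply: mule_ge0; last by rewrite lee_fin; exact: eta_ge0.
  by rewrite /weight_cost; case: ifP => // _; rewrite lee_fin mulr_ge0// weight_ge0.
rewrite /weight_cost; case: ifP => _; rewrite ?mul0e ?mule0//.
by rewrite -!EFinM lee_fin mulrAC.
Qed.

End immigrant_mean_total.

Lemma esum_ge_term (R : realType) (I : choiceType) (S : set I) (a : I -> \bar R) i :
  S i -> (a i <= \esum_(j in S) a j)%E.
Proof.
move=> Si; apply: esum_ge; exists [set i]; last by rewrite fsbig_set1.
by split; [exact: finite_set1|move=> j ->].
Qed.

(** * From cluster independence to mixing *)

Section approximate_independence.
Local Open Scope ereal_scope.
Context {R : realType} {disp : measure_display} {Omega : measurableType disp}
  (P : probability Omega R).
Implicit Types (A B Z : set Omega).

Lemma covariance_indic A B : measurable A -> measurable B ->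
  covariance P \1_A \1_B = P (A `&` B) - P A * P B.
Proof.
move=> mA mB; have mAB := measurableI _ _ mA mB.
have L1 D : measurable D -> (\1_D : Omega -> R) \in Lfun P 1.
  by move=> mD; apply/Lfun1_integrable; exact: integrable_indic.
have I : (\1_A * \1_B)%R = \1_(A `&` B) :> (Omega -> R) by rewrite indicI.
by rewrite covarianceE ?I ?L1// !expectation_indic.
Qed.

Lemma dist_probability_le A B Z : measurable A -> measurable B -> measurable Z ->
  A `\` Z = B `\` Z -> (`|fine (P A) - fine (P B)| <= fine (P Z))%R.
Proof.
move=> mA mB mZ AB; have fP D : measurable D -> P D = (fine (P D))%:E.
  by move=> mD; rewrite fineK// fin_num_measure.
have half D E : measurable D -> measurable E -> D `\` Z = E `\` Z ->
    (fine (P D) <= fine (P E) + fine (P Z))%R.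
  move=> mD mE DE; rewrite -lee_fin EFinD -!fP//.
  apply: le_trans (measureU2 P mE mZ); apply: le_measure; rewrite ?mem_set//.
    exact: measurableU.
  move=> w Dw; have [Zw|Zw] := pselect (Z w); first by right.
  by left; have : (D `\` Z) w by []; rewrite DE => -[].
rewrite ler_norml; apply/andP; split.
  by rewrite lerBrDr addrC lerBlDr half.
by rewrite lerBlDl half.
Qed.

(** The covariance of the modified events is 0, and each of the probabilities of [A], of [B] and of
    their intersection differs from the modified one by at most that of [Z]. *)
Lemma covariance_indic_le A B A' B' Z : measurable A -> measurable B ->
  measurable A' -> measurable B' -> measurable Z ->
  A `\` Z = A' `\` Z -> B `\` Z = B' `\` Z -> P (A' `&` B') = P A' * P B' ->
  `|covariance P \1_A \1_B| <= 3%:E * P Z.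
Proof.
move=> mA mB mA' mB' mZ AA' BB' indep.
have fP D : measurable D -> P D = (fine (P D))%:E.
  by move=> mD; rewrite fineK// fin_num_measure.
have mAB := measurableI _ _ mA mB; have mAB' := measurableI _ _ mA' mB'.
rewrite covariance_indic// (fP _ mAB) (fP _ mA) (fP _ mB) (fP _ mZ) -!EFinM -EFinB lee_fin.
have := dist_probability_le mA mA' mZ AA'; have := dist_probability_le mB mB' mZ BB'.
have : (A `&` B) `\` Z = (A' `&` B') `\` Z.
  by rewrite !setDE -(setIid (~` Z)) !(setIACA _ _ (~` Z)) -!setDE AA' BB'.
move=> /(dist_probability_le mAB mAB' mZ).
have eq' : fine (P (A' `&` B')) = (fine (P A') * fine (P B'))%R.
  by rewrite indep fineM// fin_num_measure.
rewrite eq'; have P01 D : measurable D -> (0 <= fine (P D) <= 1)%R.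
  by move=> mD; rewrite -!lee_fin -fP// measure_ge0 probability_le1.
move: (P01 _ mA) (P01 _ mB) (P01 _ mA') (P01 _ mB') (P01 _ mZ).
move: (fine (P (A `&` B))) (fine (P A)) (fine (P B)) (fine (P A')) (fine (P B')) (fine (P Z))
  => ab a b a' b' z.
move=> /andP[a0 a1] /andP[b0 b1] /andP[a'0 a'1] /andP[b'0 b'1] /andP[z0 _].
move=> ab_le b_le a_le.
rewrite (_ : ab - a * b = (ab - a' * b') - (a * (b - b') + b' * (a - a')))%R; last by ring.
rewrite (le_trans (ler_normB _ _))//.
rewrite (_ : 3 * z = z + (z + z))%R; last by ring.
rewrite lerD// (le_trans (ler_normD _ _))// !normrM ger0_norm// (ger0_norm b'0).
by apply: lerD; [rewrite (le_trans _ b_le)// ler_piMl|rewrite (le_trans _ a_le)// ler_piMl].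
Qed.

(** The sets [A] whose preimage agrees off [Z] with an event of the generated sigma-algebra
    themselves form a sigma-algebra. *)
Lemma sigma_preimage_setD (U : Type) (f : Omega -> U) (C : set (set U))
    (G : set (set Omega)) Z :
  (forall A : set U, C A -> exists2 A', <<s G >> A' & f @^-1` A `\` Z = A' `\` Z) ->
  forall A : set U, <<s C >> A -> exists2 A', <<s G >> A' & f @^-1` A `\` Z = A' `\` Z.
Proof.
move=> CG; apply: smallest_sub => //; split => /=.
- exists set0; last by rewrite preimage_set0.
  exact: (@measurable0 _ (g_sigma_algebraType G)).
- move=> A [A' GA' AA']; exists (~` A').
    exact: (@measurableC _ (g_sigma_algebraType G)).
  rewrite setTD; apply/seteqP; split => w [nA Zw]; split => // Aw; apply: nA.
    by have : (A' `\` Z) w by []; rewrite -AA' => -[].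
  by have : (f @^-1` A `\` Z) w by []; rewrite AA' => -[].
- move=> F FG; have /choice[F' F'P] : forall n, exists A',
      <<s G >> A' /\ f @^-1` (F n) `\` Z = A' `\` Z.
    by move=> n; have [A' ? ?] := FG n; exists A'.
  exists (\bigcup_n F' n).
    by apply: (@bigcupT_measurable _ (g_sigma_algebraType G)) => n; have [] := F'P n.
  rewrite preimage_bigcup !setD_bigcupl; apply: eq_bigcupr => n _.
  by have [] := F'P n.
Qed.

End approximate_independence.

(** * Causality: offspring are born after their parents *)

Section causality.
Local Open Scope ereal_scope.
Context {R : realType} {d : nat} {disp : measure_display}
  {Omega : measurableType disp} (P : probability Omega R).
Context (eta : 'I_d -> R) (h : 'I_d -> 'I_d -> R -> R).
Context (xi : label d -> 'I_d -> nat -> Omega -> \bar R).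
Hypothesis eta_ge0 : forall j, (0 <= eta j)%R.
Hypothesis h_ge0 : forall i j x, (0 <= h i j x)%R.
Hypothesis h_causal : forall i j x, (x < 0)%R -> h i j x = 0%R.
Hypothesis h_integrable : forall i j,
  lebesgue_measure.-integrable [set: R] (EFin \o h i j).
Hypothesis xi_poisson :
  forall u j, poisson_process P (offspring_intensity eta h u j) (xi u j).

Let neg (x : R) : \bar R := (x < 0)%R%:R%:E.

(* Vanishes almost surely, since the reproduction functions are supported on the
   positive half-line. *)
Definition backward_births (w : Omega) : \bar R :=
  \esum_(q in [set q : label d * 'I_d | q.1 != [::]])
    pt_sum (xi q.1 q.2) neg w.

Let neg_ge0 x : 0 <= neg x.
Proof. by rewrite lee_fin. Qed.

Let measurable_neg : measurable_fun setT neg.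
Proof.
rewrite (_ : neg = fun x => if (x < 0)%R then 1 else 0); last first.
  by apply/funext => x; rewrite /neg; case: (x < 0)%R.
by apply: measurable_fun_ifT => //; exact: measurable_fun_ltr.
Qed.

Lemma measurable_backward_births : measurable_fun setT backward_births.
Proof.
apply: measurable_esum => [q w|q _]; first exact: pt_sum_ge0.
by apply: measurable_pt_sum => // n; exact: (xi_measurable xi_poisson).
Qed.

Lemma backward_births_ge0 w : 0 <= backward_births w.
Proof. by apply: esum_ge0 => q _; exact: pt_sum_ge0. Qed.

(** By Campbell's formula the mean number of negative displacements in a litter is the integral of a
    reproduction function over the negative half-line. *)
Lemma integral_backward_births : \int[P]_w backward_births w = 0.
Proof.
rewrite integral_esum; last 2 first.
- by move=> q w; exact: pt_sum_ge0.
- move=> q _; apply: measurable_pt_sum => // n; exact: (xi_measurable xi_poisson).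
apply: esum1 => -[u j] /= u0.
rewrite (campbell (lam_ge0 eta_ge0 h_ge0 u j) (measurable_lam eta h_integrable u j)
  (lam_fin eta_ge0 h_ge0 h_integrable u j) (xi_poisson u j))//.
apply: integral0_eq => x _; rewrite /neg.
have [x0|_] := ltP x 0%R; last by rewrite mul0e.
by case: u u0 => [//|[i n] u] _; rewrite /= h_causal// mule0.
Qed.

Lemma null_backward_births : P [set w | backward_births w != 0] = 0.
Proof.
have /(ae_eq_integral_abs P measurableT measurable_backward_births).1 [S [mS PS Sb]] :
    \int[P]_w `|backward_births w| = 0.
  rewrite -[RHS]integral_backward_births; apply: eq_integral => w _.
  by rewrite gee0_abs// backward_births_ge0.
apply: (@subset_measure0 _ _ _ P _ S) => //.
  rewrite [X in measurable X](_ : _ = ~` (backward_births @^-1` [set 0])).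
    by apply: measurableC; rewrite -[X in measurable X]setTI; exact: measurable_backward_births.
  by apply/seteqP; split => w /= /eqP.
by move=> w /= /eqP w0; apply: Sb => /(_ I).
Qed.

Lemma displacement_ge0 w u j n x : backward_births w = 0 -> u != [::] ->
  xi u j n w = x%:E -> (0 <= x)%R.
Proof.
move=> w0 u0 ux; rewrite leNgt; apply/negP => x0.
suff : 1 <= backward_births w by rewrite w0 lee_fin ler10.
apply: (@le_trans _ _ (pt_sum (xi u j) neg w)).
  apply: (@le_trans _ _ (on_fin neg (xi u j n w))).
    by rewrite ux /= /neg x0.
  rewrite /pt_sum (nneseries_split_cond 0 n.+1)//; last by move=> k _; exact: on_fin_ge0.
  rewrite add0n big_nat_recr//=; apply: (le_trans (leeDr _ _)); last first.
    by apply: leeDl; apply: nneseries_ge0 => k _ _; exact: on_fin_ge0.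
  by apply: sume_ge0 => k _; exact: on_fin_ge0.
exact: (esum_ge_term (fun q => pt_sum (xi q.1 q.2) neg w) (_ : _ (u, j))).
Qed.

(** Without backward births, locations can only increase along a line of descent that starts at an
    immigrant. *)
Lemma root_location_le w u x : backward_births w = 0 ->
  location xi u w = x%:E -> u != [::] -> root_location xi u w <= x%:E.
Proof.
move=> w0; elim: u x => [//|[j n] u IH] x.
have [->|u0] := eqVneq u [::]; first by move=> /= ->.
rewrite /=; case E1 : (location xi u w) => [y||]//; case E2 : (xi u j n w) => [z||]//.
move=> [yz] _; have z0 := displacement_ge0 w0 u0 E2.
have := IH y E1 u0; rewrite /root_location; case: u u0 {IH E1 E2} => [//|q u] _ /=.
by move=> /le_trans; apply; rewrite -yz lee_fin lerDl.
Qed.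

End causality.

Section windows.
Local Open Scope ereal_scope.
Context {R : realType} {d : nat} {disp : measure_display}
  {Omega : measurableType disp} (P : probability Omega R).
Context (N : {mfun Omega >-> config R d}).
Context (xi : label d -> 'I_d -> nat -> Omega -> \bar R).
Context (t : R) (Z : set Omega) (D : set R) (b : bool).
Hypothesis N_cluster : forall w, ~ Z w -> forall (j : 'I_d) (B : set R), measurable B ->
  N w j B = counting [set u | has_type j u /\ exists2 x, B x & location xi u w = x%:E].
Hypothesis window_side : forall w, ~ Z w -> forall j u x, has_type j u -> D x ->
  location xi u w = x%:E -> left_side xi t u w = b.

(** Off [Z] all the individuals found in [D] are on side [b], so the counts of [N] in [D] are counts
    of that side. *)
Lemma window_event A : <<s count_cylinders (d := d) D >> A ->
  exists2 A', <<s count_event (side_counts xi t b) >> A' & N @^-1` A `\` Z = A' `\` Z.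
Proof.
apply: sigma_preimage_setD => _ [B [m [mB BD ->]]].
exists (\bigcap_(i in [set: 'I_d]) [set w | side_count xi t b i B w = (m i)%:R%:E]).
  apply: (@fin_bigcap_measurable _ (g_sigma_algebraType (count_event (side_counts xi t b)))).
    exact: finite_finset.
  move=> i _; apply: sub_sigma_algebra; rewrite -[X in count_event _ X]setTI.
  by apply: count_eventI; [exists i, B|exact: count_eventT].
have sideE w i : ~ Z w -> N w i B = side_count xi t b i B w.
  move=> Zw; rewrite N_cluster//; congr counting; apply/seteqP; split => u /=.
    by move=> [ui [x Bx ux]]; split => //; [exact: (window_side Zw ui (BD _ Bx) ux)|exists x].
  by move=> [? _ ?].
apply/seteqP; split => w [Nw Zw]; split => // i; first by move=> _; rewrite /= -sideE.
by rewrite sideE//; exact: Nw.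
Qed.

End windows.

Section mixing.
Local Open Scope ereal_scope.
Context {R : realType} {d : nat}.

Lemma window_algebra_measurable (a b : \bar R) :
  window_algebra a b `<=` (measurable : set (set (config R d))).
Proof.
apply: smallest_sub; first exact: smallest_sigma_algebra.
by move=> _ [B [m [mB _ ->]]]; apply: sub_sigma_algebra; exists B, m.
Qed.

(** Transports covariances to the space that carries the genealogy: those of indicators of events
    about [N] depend on its law only. *)
Lemma covariance_same_law (disp disp' : measure_display) (Omega : measurableType disp)
    (Omega' : measurableType disp') (P : probability Omega R) (P' : probability Omega' R)
    (N : {mfun Omega >-> config R d}) (N' : {mfun Omega' >-> config R d})
    (A B : set (config R d)) :
  (forall C, measurable C -> P (N @^-1` C) = P' (N' @^-1` C)) ->
  measurable A -> measurable B ->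
  covariance P \1_(N @^-1` A) \1_(N @^-1` B) =
  covariance P' \1_(N' @^-1` A) \1_(N' @^-1` B).
Proof.
move=> law mA mB; rewrite !covariance_indic; try exact: measurable_funPTI.
by rewrite (law _ mA) (law _ mB); congr (_ - _); exact: law (measurableI _ _ mA mB).
Qed.

Context {disp : measure_display}
  {Omega : measurableType disp} (P : probability Omega R)
  (N : {mfun Omega >-> config R d}).
Context (eta : 'I_d -> R) (h : 'I_d -> 'I_d -> R -> R).
Hypothesis eta_ge0 : forall j, (0 <= eta j)%R.
Hypothesis h_ge0 : forall i j x, (0 <= h i j x)%R.
Hypothesis h_causal : forall i j x, (x < 0)%R -> h i j x = 0%R.
Hypothesis h_integrable : forall i j,
  lebesgue_measure.-integrable [set: R] (EFin \o h i j).
Context (e beta gamma theta : R) (v : 'I_d -> R).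
Hypotheses (e_gt0 : (0 < e)%R) (gamma_gt0 : (0 < gamma)%R) (gamma_lt : (gamma < beta)%R).
Hypotheses (theta01 : (0 <= theta < 1)%R) (v_ge1 : forall i, (1 <= v i)%R).
Hypothesis contraction : forall i, \sum_(j < d)
  (v j)%:E * \int[lebesgue_measure]_z (stretch (1 + beta) e z * h i j z)%:E <= (theta * v i)%:E.

Lemma cluster_covariance_le (t tau : R) (A B : set (config R d)) :
  poisson_cluster P N eta h -> (0 < tau)%R ->
  window_algebra -oo t%:E A -> window_algebra (t + tau)%:E +oo B ->
  `|covariance P \1_(N @^-1` A) \1_(N @^-1` B)| <=
  (3 * decay_constant eta e beta gamma theta v * tau `^ (- gamma))%:E.
Proof.
move=> [xi [xi_poisson xi_indep [S [mS PS NS]]]] tau0 wA wB.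
have v0 j : (0 <= v j)%R by apply: le_trans (v_ge1 j).
pose c := weight_cost (1 + beta) e (t + tau) v.
have gc : good_cost c by exact: weight_cost_good.
(* A left individual beyond t + tau has weight 1, hence a cost v_j >= 1; so [bad] contains the event
   of survival, and Markov's inequality bounds its probability by the mean total cost. *)
pose bad := [set w | 1 <= total_cost xi t c w].
pose back := [set w | backward_births xi w != 0].
have mtot := measurable_total_cost xi_poisson t gc.
have mbad : measurable bad.
  rewrite (_ : bad = total_cost xi t c @^-1` `[1, +oo[%classic).
    by rewrite -[X in measurable X]setTI; apply: mtot => //; exact: emeasurable_itv.
  by apply/seteqP; split => w; rewrite /= in_itv/= andbT.
have mback : measurable back.
  rewrite (_ : back = ~` (backward_births xi @^-1` [set 0])).
    apply: measurableC; rewrite -[X in measurable X]setTI.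
    exact: (measurable_backward_births xi_poisson).
  by apply/seteqP; split => w /= /eqP.
have Pback : P back = 0.
  exact: (null_backward_births eta_ge0 h_ge0 h_causal h_integrable xi_poisson).
have Pbad : P bad <= (decay_constant eta e beta gamma theta v * tau `^ (- gamma))%:E.
  apply: le_trans (mean_total_decay eta_ge0 h_ge0 h_integrable xi_poisson xi_indep
    e_gt0 gamma_gt0 gamma_lt theta01 v_ge1 contraction t tau0).
  have := le_integral_abse P measurableT mtot (@ltr01 R).
  rewrite mul1e setTI /mean_total -/c.
  under eq_integral do rewrite gee0_abs ?total_cost_ge0//.
  apply: le_trans; rewrite le_eqVlt; apply/orP; left; apply/eqP.
  congr (P _); apply/seteqP; split => w /=; rewrite gee0_abs// total_cost_ge0//.
(* Off [Z], no left cluster survives beyond t + tau, offspring are born after their parents, and [N]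
   is given by the clusters. Only [bad] may have positive probability. *)
pose Z := bad `|` (back `|` S).
have mZ : measurable Z by do 2 apply: measurableU => //.
have PZ : P Z <= (decay_constant eta e beta gamma theta v * tau `^ (- gamma))%:E.
  apply: le_trans Pbad; apply: (le_trans (measureU2 P mbad (measurableU _ _ mback mS))).
  have P0 : P (back `|` S) = 0 := etrans (measureU0 mback mS PS) Pback.
  by rewrite [X in _ + X]P0 adde0.
have cluster w : ~ Z w -> forall (j : 'I_d) (B : set R), measurable B -> N w j B =
    counting [set u | has_type j u /\ exists2 x, B x & location xi u w = x%:E].
  by move=> Zw; apply: contrapT => /NS Sw; apply: Zw; right; right.
have births w : ~ Z w -> backward_births xi w = 0.
  by move=> Zw; apply/eqP/negPn/negP => w0; apply: Zw; right; left.
have leftP w : ~ Z w -> forall j u (x : R), has_type j u -> [set x : R | -oo < x%:E <= t%:E]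
  x ->
    location xi u w = x%:E -> left_side xi t u w = true.
  move=> Zw j [|jn u] x // _ /andP[_ xt] ux.
  by apply: (le_trans _ xt); apply: (root_location_le (births w Zw) ux).
have rightP w : ~ Z w -> forall j u (x : R), has_type j u ->
    [set x : R | (t + tau)%:E < x%:E <= +oo] x ->
    location xi u w = x%:E -> left_side xi t u w = false.
  move=> Zw j [|[i n] u] x // _ /andP[tx _] ux; apply/negP => side; apply: Zw; left.
  apply: le_trans (esum_ge_term (fun u => cost xi t c u w) (_ : setT ((i, n) :: u))) => //.
  rewrite /cost ux /= side /c /weight_cost /weight lee_fin.
  rewrite lte_fin in tx; rewrite max_l ?subr_le0 ?(ltW tx)//.
  by rewrite mulr0 addr0 powR1 mulr1.
have [A' A'E NA] := window_event cluster leftP wA.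
have [B' B'E NB] := window_event cluster rightP wB.
have sub b : <<s count_event (side_counts xi t b) >> `<=` measurable.
  apply: smallest_sub; first exact: sigma_algebra_measurable.
  by apply: count_event_measurable; exact: (side_counts_rv xi_poisson).
have indep := side_counts_indep eta_ge0 h_ge0 h_integrable xi_poisson xi_indep A'E B'E.
have mN C : measurable C -> measurable (N @^-1` C) by exact: measurable_funPTI.
apply: (le_trans (covariance_indic_le (mN _ (window_algebra_measurable wA))
  (mN _ (window_algebra_measurable wB)) (sub _ _ A'E) (sub _ _ B'E) mZ NA NB indep)).
by rewrite -mulrA EFinM lee_pmul2l.
Qed.

End mixing.

Theorem theorem3p1 (R : realType) (d : nat) (d_gt0 : (0 < d)%N)
    (disp : measure_display) (Omega : measurableType disp)
    (P : probability Omega R) (N : {mfun Omega >-> config R d})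
    (eta : 'I_d -> R) (h : 'I_d -> 'I_d -> R -> R) (beta : R)
    (eta_gt0 : forall j, 0 < eta j)
    (h_ge0 : forall i j (x : R), 0 <= h i j x)
    (h_causal : forall i j (x : R), x < 0 -> h i j x = 0)
    (h_integrable : forall i j,
      lebesgue_measure.-integrable [set: R] (EFin \o h i j))
    (N_hawkes : hawkes P N eta h)
    (N_stationary : stationary P N)
    (subcritical : spectral_radius (reproduction_matrix h) < 1)
    (beta_gt0 : 0 < beta)
    (h_moment : (ereal_sup (range (fun ij : 'I_d * 'I_d =>
       \int[lebesgue_measure]_t (t `^ (1 + beta) * h ij.1 ij.2 t)%:E))
       < +oo)%E)
    (gamma : R) (gamma_gt0 : 0 < gamma) (gamma_lt : gamma < beta) :
  exists2 C : R, 0 < C &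
    \forall tau \near +oo,
      (strong_mixing P N tau <= (C * tau `^ (- gamma))%:E)%E.
Proof.
have [e [theta [v [e0 theta01 v1 contraction]]]] :=
  kernel_contraction d_gt0 h_ge0 h_causal h_integrable subcritical beta_gt0 h_moment.
have eta0 j : 0 <= eta j by exact: ltW.
case: N_hawkes => disp1 [T1 [P1 [N1 [cluster law]]]].
pose K := 3 * decay_constant eta e beta gamma theta v.
(* A constant above [K] that is visibly positive. *)
exists (`|K| + 1); first by rewrite ltr_wpDl.
near=> tau; have tau0 : 0 < tau by near: tau; exact: nbhs_pinfty_gt.
apply: ge_ereal_sup => _ [t _ <-]; apply: ge_ereal_sup => _ [A wA [B wB <-]].
rewrite (covariance_same_law law (window_algebra_measurable wA) (window_algebra_measurable wB)).
apply: (le_trans (cluster_covariance_le eta0 h_ge0 h_causal h_integrable e0 gamma_gt0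
  gamma_lt theta01 v1 contraction cluster tau0 wA wB)).
rewrite lee_fin ler_wpM2r ?powR_ge0//.
by rewrite (le_trans (ler_norm _))// lerDl.
Unshelve. all: by end_near.
Qed.
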